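(* Let $k,\ell\ge0$ be integers with $k+\ell\ge1$, let $\beta,z>0$ be real numbers, and denote $$r_{(k,\ell),\beta}(z)=\frac{\int_{\Omega_{(k,\ell),z}}\left[D_k(x)\cdot D_\ell(y)\cdot e^{-\frac{k+\ell}{2}\left(\sum x_i^2+\sum y_j^2\right)}\right]^\beta d^{(k+\ell-1)}(x;y)}{\int_{\Omega_{(k,\ell)}}\left[D_k(x)\cdot D_\ell(y)\cdot e^{-\frac{k+\ell}{2}\left(\sum x_i^2+\sum y_j^2\right)}\right]^\beta d^{(k+\ell-1)}(x;y)}.$$ Let $1\le p\le k$ and $1\le q\le\ell$. Then, as $n\to\infty$, $$\lambda^{(\beta;k,\ell)}_{p}(n,z)\sim\frac{n}{k+\ell}\cdot r_{(k,\ell),\beta}(z)\qquad\text{and}\qquad\lambda'^{(\beta;k,\ell)}_{q}(n,z)\sim\frac{n}{k+\ell}\cdot r_{(k,\ell),\beta}(z).$$ In other words, $$\lim_{n\to\infty}\frac{k+\ell}{n}\cdot\lambda^{(\beta;k,\ell)}_p(n,z)=r_{(k,\ell),\beta}(z)\qquad\text{and}\qquad\lim_{n\to\infty}\frac{k+\ell}{n}\cdot\lambda'^{(\beta;k,\ell)}_q(n,z)=r_{(k,\ell),\beta}(z).$$ (The row statement is for every $1\le p\le k$ and the column statement is for every $1\le q\le\ell$.)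
   Context: For a partition $\lambda=(\lambda_1,\lambda_2,\ldots)$ of $n$ (written $\lambda\vdash n$, with $\lambda_i=0$ for $i$ larger than the number of parts), $\lambda'=(\lambda'_1,\lambda'_2,\ldots)$ denotes the conjugate partition, and $f^\lambda$ denotes the number of standard Young tableaux of shape $\lambda$. For integers $k,\ell\ge0$, $H(k,\ell;n)=\{\lambda\vdash n\mid\lambda_{k+1}\le\ell\}$, and for real $z>0$ $$H(k,\ell;n,z)=\left\{\lambda\in H(k,\ell;n)\;\middle|\;\lambda_1\le\tfrac{n}{k+\ell}+z\sqrt n\ \text{ and }\ \lambda'_1\le\tfrac{n}{k+\ell}+z\sqrt n\right\}.$$ For $\beta>0$, $1\le p\le k$, $1\le q\le\ell$, the distribution of the length of the $p$-th row (resp. $q$-th column) as a function of $z$ is $$\lambda^{(\beta;k,\ell)}_p(n,z)=\frac{\sum_{\lambda\in H(k,\ell;n,z)}\lambda_{p}\,(f^\lambda)^{\beta}}{\sum_{\lambda\in H(k,\ell;n)}(f^\lambda)^{\beta}},\qquad \lambda'^{(\beta;k,\ell)}_q(n,z)=\frac{\sum_{\lambda\in H(k,\ell;n,z)}\lambda'_{q}\,(f^\lambda)^{\beta}}{\sum_{\lambda\in H(k,\ell;n)}(f^\lambda)^{\beta}}$$ (the numerator sums over $H(k,\ell;n,z)$, the denominator over all of $H(k,\ell;n)$). The integration domains are $$\Omega_{(k,\ell)}=\Big\{(x_1,\ldots,x_k,y_1,\ldots,y_\ell)\in\mathbb{R}^{k+\ell}\;\Big|\;x_1\ge\cdots\ge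 x_k,\ y_1\ge\cdots\ge y_\ell,\ \sum x_i+\sum y_j=0\Big\},$$ $$\Omega_{(k,\ell),z}=\{(x_1,\ldots,x_k,y_1,\ldots,y_\ell)\in\Omega_{(k,\ell)}\mid x_1\le z,\ y_1\le z\}$$ (a condition on $x_1$ or $y_1$ is void if $k=0$ or $\ell=0$, respectively). Here $D_r(x)=\prod_{1\le i<j\le r}(x_i-x_j)$ (equal to $1$ for $r\le1$), and $d^{(k+\ell-1)}(x;y)$ denotes $(k+\ell-1)$-dimensional Lebesgue measure on the hyperplane $\sum x_i+\sum y_j=0$ (the ratio does not depend on its normalization; if $k+\ell=1$ it is the unit mass at the single point $0$). For real sequences with $b_n\neq0$ for large $n$, $a_n\sim b_n$ means $\lim_{n\to\infty}a_n/b_n=1$. *)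

(* Defs.v *)
From HB Require Import structures.
From mathcomp Require Import all_boot all_order all_algebra.
From mathcomp Require Import all_classical all_reals all_analysis.

Set Implicit Arguments.
Unset Strict Implicit.
Unset Printing Implicit Defensive.

Import Order.TTheory GRing.Theory Num.Theory.
Import numFieldNormedType.Exports.

Local Open Scope classical_set_scope.
Local Open Scope ring_scope.

(* A partition of n is encoded by its first n parts, trailing zeros included. *)
Definition is_intpart (n : nat) (s : n.-tuple 'I_n.+1) : bool :=
  sorted geq [seq val i | i <- s] && (sumn [seq val i | i <- s] == n).

Definition intpart (n : nat) : predArgType :=
  {s : n.-tuple 'I_n.+1 | is_intpart s}.

HB.instance Definition _ (n : nat) := [Finite of intpart n by <:].

(* [part lam i] is lambda_i and [cpart lam j] is lambda'_j (the number of parts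
   that are at least j), with indices starting at 1 as in the usual notation;
   the values at index 0 are meaningless. *)
Definition part (n : nat) (lam : intpart n) (i : nat) : nat :=
  nth 0%N [seq val r | r <- val lam] i.-1.

Definition cpart (n : nat) (lam : intpart n) (j : nat) : nat :=
  count (leq j) [seq val r | r <- val lam].

(* Here rows and columns of the diagram are counted from 0. *)
Definition young (n : nat) (lam : intpart n) : {set 'I_n * 'I_n} :=
  [set c : 'I_n * 'I_n | (c.2 < part lam c.1.+1)%N]%SET.

(* The entries are 0, ..., n-1 instead of 1, ..., n; since the diagram has n
   cells, an injective filling uses each of them exactly once. *)
Definition is_syt (n : nat) (lam : intpart n)
    (T : {ffun {c | c \in young lam} -> 'I_n}) : bool :=
  injectiveb T &&
  [forall c : {c | c \in young lam},
   forall d : {c | c \in young lam},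
     (((val c).1 == (val d).1) && ((val c).2 < (val d).2)%N ||
      ((val c).2 == (val d).2) && ((val c).1 < (val d).1)%N)
     ==> (T c < T d)%N].

Definition nb_syt (n : nat) (lam : intpart n) : nat :=
  #|[set T | @is_syt n lam T]%SET|.

Definition hook_parts (k l n : nat) : {set intpart n} :=
  [set lam | (part lam k.+1 <= l)%N]%SET.

Definition hook_parts_le (R : realType) (k l n : nat) (z : R) :
    {set intpart n} :=
  [set lam in hook_parts k l n |
    ((part lam 1)%:R <= n%:R / (k + l)%:R + z * Num.sqrt n%:R) &&
    ((cpart lam 1)%:R <= n%:R / (k + l)%:R + z * Num.sqrt n%:R)]%SET.

Definition row_distr (R : realType) (k l : nat) (beta : R) (p n : nat) (z : R)
    : R :=
  (\sum_(lam in hook_parts_le k l n z)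
     (part lam p)%:R * (nb_syt lam)%:R `^ beta) /
  (\sum_(lam in hook_parts k l n) (nb_syt lam)%:R `^ beta).

Definition col_distr (R : realType) (k l : nat) (beta : R) (q n : nat) (z : R)
    : R :=
  (\sum_(lam in hook_parts_le k l n z)
     (cpart lam q)%:R * (nb_syt lam)%:R `^ beta) /
  (\sum_(lam in hook_parts k l n) (nb_syt lam)%:R `^ beta).

Definition vdm (R : realType) (r : nat) (x : 'I_r -> R) : R :=
  \prod_(i < r) \prod_(j < r | (i < j)%N) (x i - x j).

Section LebesgueMeasure.
Variable R : realType.

Definition Rn (n : nat) := n.-tuple (measurableTypeR R).

Definition consRn (n : nat) (u : measurableTypeR R * Rn n) : Rn n.+1 :=
  [the n.+1.-tuple (measurableTypeR R) of u.1 :: u.2].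

Lemma measurable_consRn (n : nat) : measurable_fun [set: _] (@consRn n).
Proof. exact: measurable_cons. Qed.

(* The instances of [pushforward] as a measure depend on a measurability proof
   that cannot be inferred, whence this explicit packing. *)
Definition image_measure d d' (T : measurableType d) (T' : measurableType d')
    (m : {measure set T -> \bar R}) (f : T -> T')
    (mf : measurable_fun [set: T] f) : {measure set T' -> \bar R} :=
  measure_function_pushforward__canonical__measure_function_Measure m mf.

Fixpoint lebesgueRn (n : nat) : {measure set (Rn n) -> \bar R} :=
  match n with
  | 0 => dirac ([tuple] : Rn 0)
  | m.+1 => image_measure
      ((@lebesgue_measure R \x^ lebesgueRn m)%E) (@measurable_consRn m)
  end.

Definition zero_sum_cons (n : nat) (v : Rn n) : Rn n.+1 :=
  consRn (- \sum_(i < n) (tnth v i : R), v).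

Lemma measurable_zero_sum_cons (n : nat) :
  measurable_fun [set: Rn n] (@zero_sum_cons n).
Proof.
apply: measurable_cons => //=.
apply: measurableT_comp => //.
apply: measurable_sum => i /=.
exact: measurable_tnth.
Qed.

(* Lebesgue measure on the hyperplane of the vectors of R^N with sum 0, in the
   linear coordinates given by the last N - 1 entries. This is the Euclidean
   (N-1)-dimensional measure divided by sqrt N. For N = 1 it is the unit mass
   at 0; for N = 0 it is a dummy value. *)
Definition hyperplane_measure (N : nat) : {measure set (Rn N) -> \bar R} :=
  match N with
  | 0 => dirac ([tuple] : Rn 0)
  | m.+1 => image_measure (lebesgueRn m) (@measurable_zero_sum_cons m)
  end.

End LebesgueMeasure.

Section HookIntegrals.
Variables (R : realType) (k l : nat).
Implicit Types t : Rn R (k + l).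

Definition xcoord t (i : 'I_k) : R := tnth t (lshift l i).
Definition ycoord t (j : 'I_l) : R := tnth t (rshift k j).

Definition Omega : set (Rn R (k + l)) :=
  [set t | [/\ forall i j : 'I_k, (i <= j)%N -> xcoord t j <= xcoord t i,
               forall i j : 'I_l, (i <= j)%N -> ycoord t j <= ycoord t i &
               \sum_(i < k) xcoord t i + \sum_(j < l) ycoord t j = 0]].

(* The conditions on the first entries are void when k = 0 or l = 0. *)
Definition Omega_le (z : R) : set (Rn R (k + l)) :=
  [set t | [/\ Omega t,
               forall i : 'I_k, i = 0%N :> nat -> xcoord t i <= z &
               forall j : 'I_l, j = 0%N :> nat -> ycoord t j <= z]].

Definition hook_density (beta : R) t : R :=
  (vdm (xcoord t) * vdm (ycoord t) *
   expR (- ((k + l)%:R / 2%:R *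
            (\sum_(i < k) xcoord t i ^+ 2 + \sum_(j < l) ycoord t j ^+ 2))))
  `^ beta.

Definition hook_ratio (beta z : R) : R :=
  (\int[hyperplane_measure R (k + l)]_(t in Omega_le z) hook_density beta t) /
  (\int[hyperplane_measure R (k + l)]_(t in Omega) hook_density beta t).

End HookIntegrals.

Definition asymp_equiv (R : realType) (a b : nat -> R) : Prop :=
  (\forall n \near \oo, b n != 0) /\
  (fun n => a n / b n) @ \oo --> (1 : R).

(* Main.v *)
From HB Require Import structures.
Require Import Defs.
From mathcomp Require Import all_boot all_order all_algebra.
From mathcomp Require Import zify ring lra.
From mathcomp Require Import all_classical all_reals all_analysis.
From mathcomp Require Import measurable_realfun.

Set Implicit Arguments.
Unset Strict Implicit.
Unset Printing Implicit Defensive.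

Import Order.TTheory GRing.Theory Num.Theory.
Import numFieldNormedType.Exports.

Local Open Scope classical_set_scope.
Local Open Scope ring_scope.

(** The number of standard tableaux of a partition [lambda] in the hook
    depends on [k] arms and [l] legs, measured from the corner of the
    [k] x [l] rectangle:

      a_i = lambda_i - l + (k - i),   b_j = lambda'_j - k + (l - j),

      f = n! D_k(a) D_l(b) / (prod a_i! prod b_j! prod (a_i + b_j + 1)).

    For [l = 0] and [k] large this is the formula of Frobenius
    ([frobenius_formula]), which follows from the recursion that removes the
    largest entry of a tableau, by Lagrange interpolation.  The right-hand side
    does not change when the corner moves by one step along the lower right
    border of the diagram, so it may be read off at any corner on the border
    ([nsyt_hook]).

    Put d = k + l, let u be the vector of all arms and legs, and let
    x = (u - n/d) / sqrt n.  The coordinates of u have a sum that depends on n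
    only, so that f is a quantity depending on n only ([hook_scale]) times a
    profile in u ([hook_profile]) made of three kinds of factors.  The ratios
    m! m^u / (u! m^m), with m the integral part of n/d, tend to
    exp(- d x^2 / 2); the Vandermonde products are those of x; and the factors
    (2 n/d) / (a_i + b_j + 1) tend to 1 ([profile_cvg]).  Moreover the profile
    is at most a constant times prod exp(- |x_i| / 4), uniformly in n
    ([profile_dominated]).

    Arms and legs can be any strictly decreasing sequences with the right sum.
    A sum of h(lambda) f^beta over the partitions that contain the rectangle is
    therefore, up to the scale, the integral of a step function on the
    hyperplane of the vectors with sum 0, with one cube of side 1 / sqrt n for
    each partition; by dominated convergence it tends to the integral of the
    limit profile to the power beta times the limit of h
    ([riemann_sum], [hook_sum_cvg]).  For a partition in the hook that misses the
    rectangle, the formula holds at a corner with fewer arms; in effect one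
    coordinate is 0, far from n/d, and the contribution of these partitions is
    exponentially small ([nonrect_negligible]).

    The denominator of the distributions is the case h = 1.  The numerator,
    multiplied by d/n, is the case where h is d/n times the length of the row or
    of the column, times the indicator of the truncation.  The length is one
    coordinate of u plus a constant, hence n/d + O(sqrt n), and h tends to the
    indicator of x_1 <= z, y_1 <= z, except where x_1 = z or y_1 = z, which is a
    set of measure zero ([ae_coord_neq]).  The scale cancels in the quotient. *)

(** * Linear extensions *)

Section LinearExtensions.
Local Open Scope set_scope.
Local Open Scope nat_scope.
Variables (C : finType) (r : rel C) (M : nat).
Implicit Types (A : {set C}) (T : {ffun C -> 'I_M.+1}).

(** Linear extensions of [A] are encoded as functions on the whole type that
    vanish outside [A]: they have the same type for all [A], so that an
    element can be erased without changing types. *)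
Definition linexts A n : {set {ffun C -> 'I_M.+1}} :=
  [set T : {ffun C -> 'I_M.+1} |
   [&& [forall c, (c \notin A) ==> (T c == ord0)],
       [forall c in A, T c < n],
       [forall c in A, forall d in A, (T c == T d) ==> (c == d)] &
       [forall c in A, forall d in A, r c d ==> (T c < T d)]]].

Lemma linextsP A n T :
  reflect [/\ forall c, c \notin A -> T c = ord0,
              forall c, c \in A -> T c < n,
              {in A &, injective T} &
              {in A &, forall c d, r c d -> T c < T d}]
          (T \in linexts A n).
Proof.
rewrite inE; apply: (iffP and4P) => [[h1 h2 h3 h4]|[h1 h2 h3 h4]]; split.
- by move=> c cA; apply/eqP; exact: (implyP (forallP h1 c)).
- by move=> c cA; exact: (implyP (forallP h2 c)).
- move=> c d cA dA Tcd; apply/eqP.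
  have /forallP/(_ d)/implyP/(_ dA)/implyP := implyP (forallP h3 c) cA.
  by apply; rewrite Tcd.
- move=> c d cA dA.
  by have /forallP/(_ d)/implyP/(_ dA)/implyP := implyP (forallP h4 c) cA.
- by apply/forallP => c; apply/implyP => /h1 ->.
- by apply/forallP => c; apply/implyP => /h2.
- apply/forallP => c; apply/implyP => cA; apply/forallP => d; apply/implyP => dA.
  by apply/implyP => /eqP /h3 ->.
- apply/forallP => c; apply/implyP => cA; apply/forallP => d; apply/implyP => dA.
  by apply/implyP; exact: h4.
Qed.

Definition maximal_in A x := (x \in A) && [forall d in A, ~~ r x d].

Lemma card_ord_ltn_le n : #|[set y : 'I_M.+1 | y < n]| <= n.
Proof.
have sub : [set y : 'I_M.+1 | y < n] \subset (fun i : 'I_n => inord i) @: [set: 'I_n].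
  apply/fintype.subsetP => y; rewrite inE => yn; apply/imsetP; exists (Ordinal yn) => //.
  by apply/val_inj; rewrite /= inordK.
apply: leq_trans (subset_leq_card sub) _; apply: leq_trans (leq_imset_card _ _) _.
by rewrite cardsT card_ord.
Qed.

(** An injection of [n.+1] elements into [n.+1] values takes the largest value
    exactly once. *)
Lemma linexts_top A n T : #|A| = n.+1 -> T \in linexts A n.+1 ->
  \sum_(x in A) (T x == n :> nat) = 1.
Proof.
move=> cA /linextsP[T0 Tn Tinj Tmono].
have [x xA Tx] : exists2 x, x \in A & T x = n :> nat.
  have [/existsP[x /andP[xA /eqP Tx]]|h] :=
    boolP [exists x, (x \in A) && (T x == n :> nat)]; first by exists x.
  have : #|T @: A| <= n.
    apply: leq_trans (card_ord_ltn_le n); apply/subset_leq_card/fintype.subsetP => y.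
    case/imsetP => x xA ->; rewrite inE ltn_neqAle -ltnS Tn // andbT.
    by move/existsPn : h => /(_ x); rewrite xA.
  by rewrite card_in_imset// cA ltnn.
rewrite (bigD1 x)//= Tx eqxx big1// => y /andP[yA yx].
apply/eqP; rewrite eqb0; apply: contra yx => /eqP Ty.
by apply/eqP/Tinj => //; apply/val_inj; rewrite /= Tx Ty.
Qed.

(** Erasing the largest value is a bijection, because nothing has to lie above
    a maximal element. *)
Lemma card_linexts_top A n x : n <= M -> maximal_in A x ->
  #|[set T in linexts A n.+1 | T x == n :> nat]| = #|linexts (A :\ x) n|.
Proof.
move=> nM /andP[xA /forallP xmax].
pose f (T : {ffun C -> 'I_M.+1}) := [ffun c => if c == x then ord0 else T c].
pose S := [set T in linexts A n.+1 | T x == n :> nat].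
suff -> : linexts (A :\ x) n = f @: S.
  rewrite card_in_imset// => T1 T2; rewrite !inE => /andP[_ /eqP T1x] /andP[_ /eqP T2x].
  move=> /ffunP fT; apply/ffunP => c; have := fT c; rewrite !ffunE.
  by case: eqP => // -> _; apply/val_inj; rewrite /= T1x T2x.
apply/finset.setP => T; apply/idP/imsetP.
- move=> /linextsP[T0 Tn Tinj Tmono].
  exists [ffun c => if c == x then inord n else T c].
    rewrite finset.in_set ffunE eqxx inordK// eqxx andbT.
    have Tlt c : c \in A -> c != x -> T c < n by move=> cA cx; apply: Tn; rewrite !inE cx.
    apply/linextsP; split.
    + move=> c cA; rewrite ffunE; case: eqP => [cx|_]; first by rewrite cx xA in cA.
      by apply: T0; rewrite !inE (negbTE cA) andbF.
    + move=> c cA; rewrite ffunE; case: (eqVneq c x) => [_|cx]; first by rewrite inordK.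
      by rewrite ltnW// ltnS Tlt.
    + move=> c d cA dA; rewrite !ffunE; case: (eqVneq c x) => [->|cx]; case: (eqVneq d x) => [->|dx] //.
      * by move=> /(congr1 val) /=; rewrite inordK// => h; have := Tlt _ dA dx; rewrite -h ltnn.
      * by move=> /(congr1 val) /=; rewrite inordK// => h; have := Tlt _ cA cx; rewrite h ltnn.
      * by apply: Tinj; rewrite !inE ?cx ?dx.
    + move=> c d cA dA rcd; rewrite !ffunE; case: (eqVneq c x) rcd => [->|cx] rcd.
        by have /implyP/(_ dA) := xmax d; rewrite rcd.
      case: (eqVneq d x) => [_|dx]; first by rewrite inordK// Tlt.
      by apply: Tmono; rewrite ?inE ?cx ?dx.
  apply/ffunP => c; rewrite !ffunE; case: eqP => // ->.
  by apply: T0; rewrite !inE eqxx.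
- case=> T'; rewrite finset.in_set => /andP[/linextsP[T0 Tn Tinj Tmono] /eqP T'x] ->.
  apply/linextsP; split.
  + move=> c; rewrite !inE negb_and negbK ffunE; case: eqVneq => //= _; exact: T0.
  + move=> c; rewrite !inE ffunE => /andP[/negbTE cx cA]; rewrite cx ltn_neqAle -ltnS Tn// andbT.
    apply: contraFN cx => /eqP h; apply/eqP/Tinj => //; apply/val_inj; rewrite /= h.
    by rewrite T'x.
  + move=> c d; rewrite !inE !ffunE => /andP[/negbTE -> cA] /andP[/negbTE -> dA]; exact: Tinj.
  + move=> c d; rewrite !inE !ffunE => /andP[/negbTE -> cA] /andP[/negbTE -> dA]; exact: Tmono.
Qed.

(** The largest value sits at exactly one element, which must be maximal. *)
Lemma card_linexts_rec A n : n <= M -> #|A| = n.+1 ->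
  #|linexts A n.+1| = \sum_(x | maximal_in A x) #|linexts (A :\ x) n|.
Proof.
move=> nM cA.
rewrite -sum1_card (eq_bigr (fun T : {ffun C -> 'I_M.+1} =>
  \sum_(x in A) (T x == n :> nat))); last by move=> T TA; rewrite linexts_top.
rewrite exchange_big /= (bigID (fun x => [forall d in A, ~~ r x d]))/= [X in _ + X]big1; last first.
  move=> x /andP[xA]; rewrite negb_forall => /existsP[d]; rewrite negb_imply negbK => /andP[dA rxd].
  apply: big1 => T /linextsP[_ Tn _ Tmono]; apply/eqP; rewrite eqb0 neq_ltn.
  by rewrite (leq_trans (Tmono _ _ xA dA rxd))// -ltnS Tn.
rewrite addn0; apply: eq_bigr => x xmax; rewrite -card_linexts_top// -sum1_card.
rewrite [in RHS](eq_bigl (fun T : {ffun C -> 'I_M.+1} => (T \in linexts A n.+1) && (T x == n :> nat))).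
  by rewrite -big_mkcondr.
by move=> T; rewrite finset.in_set.
Qed.

Lemma card_linexts0 : #|linexts finset.set0 0| = 1.
Proof.
apply/eqP/cards1P; exists [ffun=> ord0]; apply/finset.setP => T; rewrite [RHS]inE.
apply/linextsP/eqP => [[T0 _ _ _]|->].
  by apply/ffunP => c; rewrite ffunE T0// inE.
by split=> c; rewrite ?ffunE ?inE.
Qed.

End LinearExtensions.

(** * Standard tableaux and the removal of boxes *)

Section Tableaux.
Local Open Scope set_scope.
Local Open Scope nat_scope.

Definition remove_box (rho : nat -> nat) i := fun x => if x == i then (rho i).-1 else rho x.

(** Shapes are functions on [nat], so that removing a box requires no
    renumbering. The sum runs over the corners, that is, over the possible
    places of the largest entry. *)
Fixpoint nsyt N n (rho : nat -> nat) : nat :=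
  if n is n'.+1 then \sum_(i < N | rho i.+1 < rho i) nsyt N n' (remove_box rho i)
  else 1.

Definition is_shape N (rho : nat -> nat) := (forall i, rho i.+1 <= rho i) /\ rho N = 0.

Lemma shape_leq N rho : is_shape N rho -> forall i j, i <= j -> rho j <= rho i.
Proof.
move=> [h _] i j; elim: j => [|j IH]; first by rewrite leqn0 => /eqP ->.
by rewrite leq_eqVlt => /orP[/eqP->//|/IH]; exact: leq_trans.
Qed.

Lemma remove_box_shape N rho i : is_shape N rho -> rho i.+1 < rho i ->
  is_shape N (remove_box rho i).
Proof.
move=> [h hN] ri; split => [j|]; rewrite /remove_box.
  by have := h j; case: eqP => [<-|_]; case: eqP => [jj|_]; subst; lia.
by case: eqP => // <-; rewrite hN.
Qed.

Definition cells N (rho : nat -> nat) : {set 'I_N * 'I_N} := [set c : 'I_N * 'I_N | c.2 < rho c.1].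

Definition cell_lt N : rel ('I_N * 'I_N) := fun c d =>
  (c.1 == d.1) && (c.2 < d.2) || (c.2 == d.2) && (c.1 < d.1).
Arguments cell_lt : clear implicits.

Lemma card_cells N (rho : nat -> nat) : (forall i, i < N -> rho i <= N) -> #|cells N rho| = \sum_(i < N) rho i.
Proof.
move=> rN; rewrite -sum1_card (eq_bigl (fun c : 'I_N * 'I_N => true && (c.2 < rho c.1))); last first.
  by move=> c; rewrite inE.
rewrite -(pair_big_dep xpredT (fun (i : 'I_N) (j : 'I_N) => j < rho i) (fun _ _ => 1)) /=.
apply: eq_bigr => i _; rewrite (big_ord_narrow (rN _ (ltn_ord i))).
by rewrite sum_nat_const card_ord muln1.
Qed.

Lemma remove_box_cells N (rho : nat -> nat) (i j : 'I_N) : j = (rho i).-1 :> nat -> rho i > 0 ->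
  cells N (remove_box rho i) = cells N rho :\ (i, j).
Proof.
move=> ji r0; apply/finset.setP => -[a b]; rewrite !inE /= /remove_box xpair_eqE.
case: (eqVneq a i) => [->|ai]; first by rewrite eqxx -(inj_eq val_inj) /= ji; lia.
by rewrite (negbTE (_ : (a : nat) != i)).
Qed.

(** The maximal cells of a diagram are the last cells of the rows that are
    longer than the next one; both sides therefore satisfy the same recursion. *)
Lemma card_linexts_cells N n rho : is_shape N rho -> rho 0 <= N ->
  n <= N -> \sum_(i < N) rho i = n ->
  #|linexts (cell_lt N) N (cells N rho) n| = nsyt N n rho.
Proof.
elim: n rho => [|n IH] rho sr r0 nN sn.
  have -> : cells N rho = finset.set0.
    apply/finset.setP => c; rewrite !inE; move/eqP: sn; rewrite sum_nat_eq0.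
    by move/forallP/(_ c.1)/eqP ->.
  exact: card_linexts0.
have rN i : i < N -> rho i <= N by move=> _; apply: leq_trans r0; exact: (shape_leq sr).
rewrite card_linexts_rec ?card_cells// 1?ltnW//.
pose h (i : 'I_N) : 'I_N * 'I_N := (i, insubd i (rho i).-1).
have hE (i : 'I_N) : rho i > 0 -> (h i).2 = (rho i).-1 :> nat.
  move=> ri /=; rewrite val_insubd; have := rN i (ltn_ord i); case: ltnP => //; lia.
have maxE (i : 'I_N) : maximal_in (@cell_lt N) (cells N rho) (h i) = (rho i.+1 < rho i).
  rewrite /maximal_in inE; apply/andP/idP => [[lt /forall_inP max]|ri].
    have ri : rho i > 0 by rewrite (leq_trans _ lt).
    rewrite (hE _ ri) in lt; rewrite ltnNge; apply/negP => le.
    have iN : i.+1 < N.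
      by case: (ltnP i.+1 N) => // iN; have := shape_leq sr iN; rewrite (proj2 sr); lia.
    have /max : (Ordinal iN, (h i).2) \in cells N rho by rewrite inE (hE _ ri) /=; lia.
    by rewrite /cell_lt /= eqxx leqnn orbT.
  have r1 : rho i > 0 by lia.
  rewrite (hE _ r1)/=; split; first lia.
  apply/forall_inP => -[a b]; rewrite inE /= => ba; rewrite /cell_lt /= negb_or.
  have e2 (c e : 'I_N) : (c == e) = (c == e :> nat) by [].
  rewrite !e2 (hE i r1); apply/andP; split; apply/negP.
    by move=> /andP[/eqP ia lt]; move: ba; rewrite -ia; lia.
  move=> /andP[/eqP eb ia]; move: ba; rewrite -eb.
  by have := shape_leq sr ia; lia.
rewrite (reindex_onto h fst); last first.
  move=> [i j] /andP[]; rewrite inE /= => ji /forall_inP max; congr (_, _); apply/val_inj.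
  have ri : rho i > 0 by lia.
  rewrite [LHS]hE//=; apply/eqP; rewrite eqn_leq; apply/andP; split; last lia.
  rewrite leqNgt; apply/negP => jlt.
  have /max : h i \in cells N rho by rewrite inE hE//=; lia.
  by rewrite /cell_lt /= eqxx (hE i ri) jlt.
rewrite /=; apply: eq_big => [i|i]; rewrite maxE eqxx andbT// => ri.
have r1 : rho i > 0 by lia.
rewrite -(remove_box_cells (hE i r1) r1); apply: IH.
- exact: remove_box_shape.
- by have := rN i (ltn_ord i); rewrite /remove_box; case: eqP => _; lia.
- exact: ltnW.
apply: succn_inj; rewrite -sn (bigD1 i)//= [RHS](bigD1 i)//= {1}/remove_box eqxx.
rewrite -addSn prednK//; congr addn; apply: eq_bigr => j /negbTE.
by rewrite /remove_box -(inj_eq val_inj) /= => ->.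
Qed.

Lemma val_nth_seq n (lam : intpart n) i : part lam i.+1 = nth 0 [seq val r | r <- val lam] i.
Proof. by []. Qed.

Lemma intpart_inj n (lam mu : intpart n) :
  (forall i, part lam i.+1 = part mu i.+1) -> lam = mu.
Proof.
move=> e; apply/val_inj/val_inj; apply: (inj_map val_inj); apply: (@eq_from_nth _ 0).
  by rewrite !size_map !size_tuple.
by move=> i _; have := e i; rewrite !val_nth_seq.
Qed.

Lemma part_shape n (lam : intpart n) : is_shape n (fun i => part lam i.+1).
Proof.
have sz : size [seq val r | r <- val lam] = n by rewrite size_map size_tuple.
split => [i|]; last by rewrite val_nth_seq nth_default// sz.
rewrite !val_nth_seq; case: (ltnP i.+1 n) => [lt|ge]; last by rewrite nth_default ?sz.
have /andP[/sortedP so _] := valP lam.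
by apply: so; rewrite sz.
Qed.

Lemma part_sum n (lam : intpart n) : \sum_(i < n) part lam i.+1 = n.
Proof.
have sz : size [seq val r | r <- val lam] = n by rewrite size_map size_tuple.
have /andP[_ /eqP] := valP lam.
rewrite sumnE (big_nth 0) sz big_mkord => e; rewrite -[RHS]e.
by apply: eq_bigr => i _; rewrite val_nth_seq.
Qed.

Lemma part_le n (lam : intpart n) i : part lam i <= n.
Proof.
rewrite /part; case: (ltnP i.-1 (size [seq val r | r <- val lam])) => h; last by rewrite nth_default.
by have /mapP[r _ ->] := mem_nth 0 h; rewrite -ltnS; exact: (ltn_ord r).
Qed.

(** A tableau, which is a function on the subtype of the cells, is extended by
    0 to all pairs of indices. *)
Lemma card_syt_linexts n (lam : intpart n) :
  nb_syt lam = #|linexts (cell_lt n) n (cells n (fun i => part lam i.+1)) n|.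
Proof.
set A := young lam; have -> : cells n (fun i => part lam i.+1) = A by [].
have cA : #|{: {c | c \in A}}| = #|A| by rewrite card_sig; apply: eq_card => c; rewrite !inE.
pose F (T : {ffun {c | c \in A} -> 'I_n}) : {ffun 'I_n * 'I_n -> 'I_n.+1} :=
  [ffun c => if insub c is Some c' then widen_ord (leqnSn n) (T c') else ord0].
have FE T (c : {c | c \in A}) : F T (val c) = T c :> nat by rewrite ffunE valK.
rewrite /nb_syt -(card_in_imset (f := F)); last first.
  move=> T1 T2 _ _ e; apply/ffunP => c; apply/val_inj.
  by rewrite /= -!FE e.
apply: eq_card => T; apply/imsetP/linextsP => [[T' ]|[T0 Tn Tinj Tmono]].
  rewrite inE => /andP[/injectiveP Tinj /forallP Tm] ->; split.
  - by move=> c cA'; rewrite ffunE insubN.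
  - by move=> c cA'; rewrite -[c]/(val (exist _ c cA')) FE.
  - move=> c d cA' dA' /(congr1 val) /=.
    rewrite -[c]/(val (exist _ c cA')) -[d]/(val (exist _ d dA')) !FE.
    by move=> /val_inj /Tinj ->.
  - move=> c d cA' dA' rcd.
    rewrite -[c]/(val (exist _ c cA')) -[d]/(val (exist _ d dA')) !FE.
    by have /forallP/(_ (exist _ d dA'))/implyP := Tm (exist _ c cA'); apply.
pose T' : {ffun {c | c \in A} -> 'I_n} := [ffun c => Ordinal (Tn _ (valP c))].
have T'E c : T' c = T (val c) :> nat by rewrite ffunE.
exists T'.
  rewrite inE; apply/andP; split.
    apply/injectiveP => c d /(congr1 val) /=; rewrite !T'E => e.
    by apply/val_inj/Tinj; rewrite ?(valP c) ?(valP d)//; exact/val_inj.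
  apply/forallP => c; apply/forallP => d; apply/implyP => rcd; rewrite !T'E.
  by apply: Tmono => //; exact: valP.
apply/ffunP => c; apply/val_inj; have [cA'|cA'] := boolP (c \in A).
  by have := FE T' (exist _ c cA'); rewrite T'E /= => ->.
by rewrite T0// ffunE insubN.
Qed.

Lemma nb_sytE n (lam : intpart n) : nb_syt lam = nsyt n n (fun i => part lam i.+1).
Proof.
rewrite card_syt_linexts card_linexts_cells//.
- exact: part_shape.
- exact: part_le.
- exact: part_sum.
Qed.

End Tableaux.

(** * An interpolation identity *)

Section PolyCoefs.
Variable F : fieldType.
Implicit Types s : seq F.

(** The factor ['X^2] shifts the coefficients, so that those of index [N.-1]
    and [N.-2] of a product of [N] factors are available even when [N < 2]. *)
Lemma coef_prod_XsubC s (p := 'X^2 * \prod_(b <- s) ('X - b%:P)) :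
  [/\ p`_(size s).+3 = 0, p`_(size s).+2 = 1, p`_(size s).+1 = - \sum_(b <- s) b &
     2%:R * p`_(size s) = (\sum_(b <- s) b) ^+ 2 - \sum_(b <- s) b ^+ 2].
Proof.
rewrite {}/p; elim: s => [|b s [h3 h2 h1 h0]].
  by rewrite !big_nil mulr1 !coefXn /=; split => //; ring.
rewrite !big_cons mulrCA mulrBl; set q := 'X^2 * _ in h0 h1 h2 h3 *.
rewrite !coefB !coefXM !coefCM /= h3 h2 h1; split => //.
- have sz : (size q <= (size s).+3)%N.
    rewrite /q; apply: leq_trans (size_polyMleq _ _) _; rewrite size_polyXn size_prod_XsubC; lia.
  by rewrite nth_default ?mulr0 ?subrr// (leq_trans sz).
- by rewrite mulr0 subr0.
- by rewrite mulr1 opprD addrC.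
- by rewrite mulrBr h0; ring.
Qed.

End PolyCoefs.

Section Interpolation.
Variable F : fieldType.

(** Let P be the product of the [X - a j], let [Q i] be P without its factor
    of index [i], and let [u i] be the product in the sum. The polynomial
    P(X - 1) - P(X) has degree less than [N] and takes at [a i] the value
    [- u i * (Q i).[a i]]; by Lagrange interpolation it is
    [- \sum_i u i *: Q i]. The coefficients of degree [N - 1] give
    [\sum_i u i = N], and those of degree [N - 2] give the claim. *)
Lemma sum_interp (N : nat) (a : 'I_N -> F) : injective a -> (2%:R : F) != 0 ->
  \sum_i a i * \prod_(j | j != i) ((a i - 1 - a j) / (a i - a j)) =
  \sum_i a i - N%:R * (N%:R - 1) / 2%:R.
Proof.
move=> ainj two_neq0.
pose u i := \prod_(j | j != i) ((a i - 1 - a j) / (a i - a j)).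
have a_neq i j : j != i -> a i - a j != 0.
  by move=> ji; rewrite subr_eq0; apply: contra ji => /eqP /ainj ->.
pose P : {poly F} := \prod_j ('X - (a j)%:P).
pose P1 : {poly F} := \prod_j ('X - (a j + 1)%:P).
pose Q i : {poly F} := \prod_(j | j != i) ('X - (a j)%:P).
have sQ i : size (Q i) = N.
  rewrite /Q -big_filter -(big_map a xpredT (fun b => 'X - b%:P)) size_prod_XsubC size_map.
  have -> : size [seq j <- index_enum 'I_N | j != i] = N.-1.
    rewrite -sum1_size big_filter sum1_card.
    by rewrite (eq_card (B := predC1 i)) ?cardC1 ?card_ord// => x; rewrite !inE.
  by rewrite prednK// (leq_ltn_trans _ (ltn_ord i)).
have key : P1 - P = - \sum_i u i *: Q i.
  apply/eqP; rewrite -subr_eq0 opprK; apply: contraTT isT => nz.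
  have hev (p : 'I_N) : (P1 - P + \sum_i u i *: Q i).[a p] = 0.
    rewrite !hornerE horner_sum (bigD1 p)//= big1 ?addr0; last first.
      move=> i ip; rewrite hornerZ /Q horner_prod (bigD1 p) 1?eq_sym//= hornerXsubC subrr.
      by rewrite mul0r mulr0.
    rewrite hornerZ /Q /P /P1 !horner_prod (bigD1 p)//= [X in _ - X](bigD1 p)//=.
    rewrite !hornerXsubC subrr mul0r subr0.
    rewrite -[X in _ + X]big_split/=; set A := \prod_(i | i != p) _; set B := \prod_(i | i != p) _.
    have -> : A = B.
      apply: eq_bigr => j jp; rewrite !hornerXsubC divfK ?a_neq//.
      by ring.
    by ring.
  have : all (root (P1 - P + \sum_i u i *: Q i)) (map a (enum 'I_N)).
    by apply/allP => _ /mapP[p _ ->]; rewrite rootE hev.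
  move=> /(max_poly_roots nz); rewrite map_inj_uniq ?enum_uniq// size_map size_enum_ord => /(_ isT).
  suff sz : (size (P1 - P + \sum_i u i *: Q i)%R <= N)%N by move=> /leq_trans/(_ sz); rewrite ltnn.
  apply: (leq_trans (size_polyD _ _)); rewrite geq_max; apply/andP; split; last first.
    apply: (leq_trans (size_sum _ _ _)); apply/bigmax_leqP => i _.
    by rewrite (leq_trans (size_scale_leq _ _))// sQ.
  have mono (b : 'I_N -> F) (p := \prod_j ('X - (b j)%:P)) : p`_N = 1 /\ size p = N.+1.
    have sp : size p = N.+1.
      rewrite /p -(big_map b xpredT (fun c => 'X - c%:P)) size_prod_XsubC size_map.
      by rewrite -sum1_size sum1_card card_ord.
    split=> //; have : p \is monic by apply: monic_prod => j _; exact: monicXsubC.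
    by move/monicP; rewrite lead_coefE sp.
  have [c1 s1] := mono (fun j => a j + 1); have [c0 s0] := mono a.
  apply/leq_sizeP => j; rewrite leq_eqVlt coefB => /orP[/eqP <-|jN].
    by rewrite c1 c0 subrr.
  by rewrite !nth_default ?subrr// ?s1 ?s0.
have toseq (b : 'I_N -> F) : \prod_j ('X - (b j)%:P) =
    \prod_(c <- [seq b j | j <- index_enum 'I_N]) ('X - c%:P) by rewrite big_map.
have szN (b : 'I_N -> F) : size [seq b j | j <- index_enum 'I_N] = N.
  by rewrite size_map -sum1_size sum1_card card_ord.
have toseqQ i : Q i = \prod_(c <- [seq a j | j <- [seq j <- index_enum 'I_N | j != i]]) ('X - c%:P).
  by rewrite big_map big_filter.
have szQ i : (size [seq a j | j <- [seq j <- index_enum 'I_N | j != i]]).+1 = N.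
  by have := sQ i; rewrite toseqQ size_prod_XsubC.
have {}key : 'X^2 * P1 - 'X^2 * P = - \sum_i u i *: ('X^2 * Q i).
  rewrite -mulrBr key mulrN mulr_sumr; congr (- _); apply: eq_bigr => i _.
  by rewrite scalerAr.
have cQ1 i : ('X^2 * Q i)`_N.+1 = 1.
  by have [_ + _ _] := coef_prod_XsubC [seq a j | j <- [seq j <- index_enum 'I_N | j != i]]; rewrite szQ toseqQ.
have cQ0 i : ('X^2 * Q i)`_N = a i - \sum_j a j.
  have [_ _ + _] := coef_prod_XsubC [seq a j | j <- [seq j <- index_enum 'I_N | j != i]].
  rewrite szQ toseqQ => ->.
  by rewrite big_map big_filter [in RHS](bigD1 i)//=; ring.
have coefR k : (- \sum_i u i *: ('X^2 * Q i))`_k = - \sum_i u i * ('X^2 * Q i)`_k.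
  by rewrite coefN coef_sum; congr (- _); apply: eq_bigr => i _; rewrite coefZ.
have [_ _ p1 p0] := coef_prod_XsubC [seq a j | j <- index_enum 'I_N].
have [_ _ q1 q0] := coef_prod_XsubC [seq a j + 1 | j <- index_enum 'I_N].
rewrite -toseq szN !big_map in p1 p0; rewrite -(toseq (fun j => a j + 1)) szN !big_map in q1 q0.
have S1 : \sum_i u i = N%:R.
  have := congr1 (fun p : {poly F} => p`_N.+1) key; rewrite coefB coefR.
  rewrite (eq_bigr u); last by move=> i _; rewrite cQ1 mulr1.
  rewrite p1 q1 big_split /= sumr_const card_ord => e.
  by apply: oppr_inj; rewrite -e; ring.
have := congr1 (fun p : {poly F} => 2%:R * p`_N) key; rewrite coefB coefR mulrBr p0 q0.
have -> : \sum_i u i * ('X^2 * Q i)`_N = \sum_i a i * u i - (\sum_j a j) * N%:R.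
  by rewrite -S1 mulr_sumr -sumrB; apply: eq_bigr => i _; rewrite cQ0; ring.
have -> : \sum_i (a i + 1) ^+ 2 = \sum_i a i ^+ 2 + (2%:R * \sum_i a i + N%:R).
  rewrite (eq_bigr (fun i => a i ^+ 2 + (2%:R * a i + 1))); last by move=> i _; ring.
  by rewrite !big_split/= sumr_const card_ord -mulr_sumr.
rewrite big_split /= sumr_const card_ord.
set A := \sum_i a i; set B := \sum_i a i ^+ 2; set U := \sum_i a i * u i => e.
have {}e : 2%:R * U = 2%:R * (A - N%:R * (N%:R - 1) / 2%:R).
  transitivity (2%:R * (A * N%:R) - (2%:R * - (U - A * N%:R)) ); first by ring.
  rewrite -e mulrBr [X in _ = _ - X]mulrC divfK//; ring.
exact: (mulfI two_neq0).
Qed.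
End Interpolation.

(** * The Frobenius formula *)

Section Frobenius.
Variable R : realType.

Lemma vdm_split r (x : 'I_r -> R) (i : 'I_r) :
  vdm x = (\prod_(b < r | (i < b)%N) (x i - x b)) * (\prod_(a < r | (a < i)%N) (x a - x i)) *
    \prod_(a < r | a != i) \prod_(b < r | (a < b)%N && (b != i)) (x a - x b).
Proof.
rewrite /vdm (bigD1 i)//= -mulrA; congr (_ * _).
have -> : \prod_(a < r | (a < i)%N) (x a - x i) =
    \prod_(a < r | a != i) (if (a < i)%N then x a - x i else 1).
  rewrite -big_mkcondr; apply: eq_bigl => a; rewrite -(inj_eq val_inj) /=.
  by case: ltngtP.
rewrite -big_split; apply: eq_bigr => a ai /=.
case: ifPn => ltai.
  by rewrite (bigD1 i)//=.
rewrite mul1r; apply: eq_bigl => b; case: (eqVneq b i) => [->|]; last by rewrite andbT.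
by rewrite (negbTE ltai).
Qed.

Lemma prod_neq_split r (i : 'I_r) (f : 'I_r -> R) :
  \prod_(j | j != i) f j = (\prod_(b < r | (i < b)%N) f b) * (\prod_(a < r | (a < i)%N) f a).
Proof.
rewrite (bigID (fun j : 'I_r => (i < j)%N))/=; congr (_ * _); apply: eq_bigl => j;
  rewrite -(inj_eq val_inj) /=; case: ltngtP => //.
Qed.

(** Moving one variable changes only the factors that contain it. The identity
    is stated without division because [x' i] may coincide with another
    variable. *)
Lemma vdm_change r (x x' : 'I_r -> R) (i : 'I_r) : (forall j, j != i -> x' j = x j) ->
  vdm x' * \prod_(j | j != i) (x i - x j) = vdm x * \prod_(j | j != i) (x' i - x j).
Proof.
move=> xx'; rewrite (prod_neq_split i (fun j => x i - x j)) (prod_neq_split i (fun j => x' i - x j)) !(vdm_split _ i).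
have neq (b : 'I_r) : (i < b)%N || (b < i)%N -> b != i.
  by rewrite -(inj_eq val_inj) /=; case: ltngtP.
have swap (y y' : 'I_r -> R) : (forall j, j != i -> y j = y' j) ->
    \prod_(a < r | (a < i)%N) (y a - y i) =
    \prod_(a < r | (a < i)%N) (-1) * \prod_(a < r | (a < i)%N) (y i - y' a).
  by move=> yy; rewrite -big_split; apply: eq_bigr => a ai /=; rewrite yy ?neq ?ai ?orbT//; ring.
rewrite (swap x x)// (swap x' x)//.
have -> : \prod_(b < r | (i < b)%N) (x' i - x' b) = \prod_(b < r | (i < b)%N) (x' i - x b).
  by apply: eq_bigr => b ib; rewrite (xx' b)// neq ?ib.
have -> : \prod_(a < r | a != i) \prod_(b < r | (a < b)%N && (b != i)) (x' a - x' b) =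
    \prod_(a < r | a != i) \prod_(b < r | (a < b)%N && (b != i)) (x a - x b).
  by apply: eq_bigr => a ai; apply: eq_bigr => b /andP[_ bi]; rewrite !xx'.
ring.
Qed.

Lemma sum_rev_ord N : (\sum_(i < N) (N.-1 - i))%N = 'C(N, 2).
Proof.
rewrite -triangular_sum big_mkord (reindex_inj rev_ord_inj) /=.
by apply: eq_bigr => i _; have := ltn_ord i; lia.
Qed.

Lemma natr_bin2 N : 'C(N, 2)%:R = N%:R * (N%:R - 1) / 2%:R :> R.
Proof.
case: N => [|N]; first by rewrite bin0n !mul0r.
have /(congr1 (fun k => k%:R : R)) := mul_bin_diag N.+1 1.
by rewrite bin1 !natrM /= -(natr1 N) => e; lra.
Qed.

Lemma vdm_staircase N : vdm (fun i : 'I_N => (N.-1 - i)%:R : R) = \prod_(i < N) (N.-1 - i)`!%:R.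
Proof.
apply: eq_bigr => i _; rewrite (eq_bigr (fun j : 'I_N => (j - i)%:R)); last first.
  by move=> j ij; rewrite -natrB; [congr (_%:R); have := ltn_ord j; lia|lia].
rewrite -natr_prod -(big_geq_mkord i.+1 N xpredT (fun j => (j - i)%N)) -(add1n i) big_addn fact_prod.
have -> : (N - i = (N.-1 - i).+1)%N by have := ltn_ord i; lia.
by congr (_%:R); apply: eq_bigr => j _; rewrite addnK.
Qed.

(** The staircase makes the sequence strictly decreasing. When [N] is the
    number of parts, these are the hook lengths of the first column. *)
Definition beta_number N (rho : nat -> nat) (i : nat) : nat := (rho i + (N.-1 - i))%N.

Lemma beta_number_lt N rho i j : is_shape N rho -> (i < j < N)%N ->
  (beta_number N rho j < beta_number N rho i)%N.
Proof.
move=> sr /andP[ij jN]; have := shape_leq sr (ltnW ij); rewrite /beta_number; lia.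
Qed.

Lemma beta_number_inj N rho : is_shape N rho ->
  injective (fun i : 'I_N => (beta_number N rho i)%:R : R).
Proof.
move=> sr i j /eqP; rewrite eqr_nat => /eqP e; apply/val_inj => /=.
case: (ltngtP i j) => // h.
  by have := beta_number_lt sr (_ : (i < j < N)%N); rewrite h ltn_ord e ltnn => /(_ isT).
by have := beta_number_lt sr (_ : (j < i < N)%N); rewrite h ltn_ord e ltnn => /(_ isT).
Qed.

(** Induction on the number of boxes. Removing the last box of row [i] lowers
    the [i]-th beta-number [a i] by one, which multiplies the quotient by
    [a i * \prod_(j | j != i) ((a i - 1 - a j) / (a i - a j))]. This factor
    vanishes when the row has no removable box, hence the recursion becomes a
    sum over all rows, computed by [sum_interp]. *)
Lemma frobenius_formula N n (rho : nat -> nat) : is_shape N rho -> (\sum_(i < N) rho i)%N = n ->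
  (nsyt N n rho)%:R = n`!%:R * vdm (fun i : 'I_N => (beta_number N rho i)%:R : R) /
     \prod_(i < N) (beta_number N rho i)`!%:R.
Proof.
elim: n rho => [|n IH] rho sr sn.
  have b0 i : (i < N)%N -> rho i = 0%N.
    move=> iN; move/eqP: sn; rewrite sum_nat_eq0.
    by move/forallP/(_ (Ordinal iN))/eqP.
  have bE (i : 'I_N) : beta_number N rho i = (N.-1 - i)%N by rewrite /beta_number b0.
  rewrite /= fact0 mul1r (_ : vdm _ = vdm (fun i : 'I_N => (N.-1 - i)%:R : R)); last first.
    by apply: eq_bigr => i _; apply: eq_bigr => j _; rewrite !bE.
  rewrite vdm_staircase [X in _ / X](eq_bigr (fun i : 'I_N => (N.-1 - i)`!%:R)); last first.
    by move=> i _; rewrite bE.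
  by rewrite divff//; apply/prodf_neq0 => j _; rewrite pnatr_eq0 -lt0n fact_gt0.
rewrite /= natr_sum.
pose a (i : 'I_N) : R := (beta_number N rho i)%:R.
pose W := vdm a / \prod_(i < N) (beta_number N rho i)`!%:R.
have ainj : injective a := beta_number_inj sr.
have a_neq (i j : 'I_N) : j != i -> a i - a j != 0.
  by move=> ji; rewrite subr_eq0; apply: contra ji => /eqP /ainj ->.
rewrite big_mkcond /= (eq_bigr (fun i => n`!%:R * W *
  (a i * \prod_(j | j != i) ((a i - 1 - a j) / (a i - a j))))); last first.
  move=> i _; case: ifPn => [corner|ncorner]; last first.
    have re : rho i.+1 = rho i by have := proj1 sr i; lia.
    case: (ltnP i.+1 N) => iN.
      rewrite (bigD1 (Ordinal iN))/=; last by rewrite -(inj_eq val_inj) /= neq_ltn ltnSn orbT.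
      have -> : a i - 1 - a (Ordinal iN) = 0.
        rewrite /a /beta_number /= re -[1]/(1%:R) -addrA -opprD -natrD.
        by apply/eqP; rewrite subr_eq0 eqr_nat; apply/eqP; lia.
      by rewrite !mul0r !mulr0.
    have r0 : rho i = 0%N.
      by apply/eqP; have := shape_leq sr iN; rewrite (proj2 sr) re leqn0.
    have i0 : (N.-1 - i = 0)%N by apply/eqP; rewrite subn_eq0 -subn1 leq_subLR add1n.
    have -> : a i = 0 by rewrite /a /beta_number r0 i0.
    by rewrite mul0r mulr0.
  rewrite IH; last 2 first.
  - exact: remove_box_shape.
  - apply: succn_inj; rewrite -sn (bigD1 i)//= [RHS](bigD1 i)//= {1}/remove_box eqxx.
    rewrite -addSn prednK//; last lia.
    congr addn; apply: eq_bigr => j /negbTE.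
    by rewrite /remove_box -(inj_eq val_inj) /= => ->.
  pose a' (j : 'I_N) : R := (beta_number N (remove_box rho i) j)%:R.
  have a'i : a' i = a i - 1.
    rewrite /a' /a /beta_number /remove_box eqxx; apply/eqP; rewrite eq_sym subr_eq natr1; apply/eqP.
    by congr (_%:R); lia.
  have a'j j : j != i -> a' j = a j.
    by rewrite /a' /a /beta_number /remove_box -(inj_eq val_inj) /= => /negbTE ->.
  rewrite -!mulrA; congr (_ * _).
  have D0 : \prod_(j | j != i) (a i - a j) != 0 by apply/prodf_neq0 => j; exact: a_neq.
  have fE : a i * \prod_(j < N) (beta_number N (remove_box rho i) j)`!%:R =
      \prod_(j < N) (beta_number N rho j)`!%:R :> R.
    rewrite (bigD1 i)//= [RHS](bigD1 i)//= mulrA; congr (_ * _).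
      rewrite /a /beta_number /remove_box eqxx -natrM.
      have -> : (rho i + (N.-1 - i) = ((rho i).-1 + (N.-1 - i)).+1)%N by lia.
      by rewrite factS.
    apply: eq_bigr => j; rewrite -(inj_eq val_inj) /= => /negbTE ji.
    by rewrite /beta_number /remove_box ji.
  rewrite prodf_div /W -a'i.
  have ai0 : a i != 0 by rewrite /a /beta_number pnatr_eq0; lia.
  have fn0 : \prod_(j < N) (beta_number N (remove_box rho i) j)`!%:R != 0 :> R.
    by apply/prodf_neq0 => j _; rewrite pnatr_eq0 -lt0n fact_gt0.
  have -> : vdm a' = vdm a * \prod_(j | j != i) (a' i - a j) / \prod_(j | j != i) (a i - a j).
    by rewrite -vdm_change// mulfK.
  by rewrite -fE; field; rewrite D0 ai0 fn0.
rewrite -mulr_sumr sum_interp ?pnatr_eq0//.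
have -> : \sum_i a i = n.+1%:R + (N%:R * (N%:R - 1) / 2%:R).
  by rewrite -natr_sum big_split /= sn sum_rev_ord natrD natr_bin2.
by rewrite addrK factS natrM /W; ring.
Qed.
End Frobenius.

(** * The formula read off at a point of the boundary *)

Section Conj.
Local Open Scope nat_scope.

Definition conj_part N (rho : nat -> nat) j : nat := \sum_(i < N) (j < rho i).

Lemma conj_part_gt N rho i j : is_shape N rho -> (i < conj_part N rho j) = (j < rho i).
Proof.
move=> sr; apply/idP/idP.
  apply: contraTT; rewrite -!leqNgt => le.
  rewrite /conj_part (bigID (fun i' : 'I_N => i' < i)) /= [X in _ + X <= _]big1 ?addn0; last first.
    move=> i' /=; rewrite -leqNgt => ii'; apply/eqP; rewrite eqb0 -leqNgt.
    exact: leq_trans (shape_leq sr ii') le.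
  apply: (@leq_trans (\sum_(i' < N | i' < i) 1)); first by apply: leq_sum => i' _; case: (j < _).
  case: (leqP i N) => iN; first by rewrite -(big_ord_widen N (fun _ => 1) iN) sum_nat_const card_ord muln1.
  by rewrite sum1_card (leq_trans (max_card _))// card_ord ltnW.
move=> lt; have iN : i < N.
  by rewrite ltnNge; apply/negP => Ni; have := shape_leq sr Ni; rewrite (proj2 sr); lia.
apply: (@leq_trans (\sum_(i' < N | i' < i.+1) 1)).
  by rewrite -(big_ord_widen N (fun _ => 1) iN) sum_nat_const card_ord muln1.
rewrite big_mkcond; apply: leq_sum => i' _; case: ifP => //= h.
by rewrite (leq_trans lt)// (shape_leq sr).
Qed.

Lemma conj_part_ge N rho i j : is_shape N rho -> (forall i', i' < i -> j < rho i') -> i <= conj_part N rho j.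
Proof. by case: i => // i sr h; rewrite conj_part_gt// h. Qed.

Lemma conj_part_le N rho i j : is_shape N rho -> rho i <= j -> conj_part N rho j <= i.
Proof. by move=> sr h; rewrite leqNgt conj_part_gt// -leqNgt. Qed.

(** The corner ([k], [l]) lies on the lower right border of the diagram: the
    rectangle of [k] rows and [l] columns is inside, the next cell on the
    diagonal is outside. *)
Definition on_boundary (rho : nat -> nat) k l := (forall i, i < k -> l <= rho i) /\ rho k <= l.

(** Arms and legs start at the corner ([k], [l]) and are staggered, so that
    each of the two sequences is strictly decreasing; for [l = 0] the arms are
    the beta-numbers. *)
Definition arm k l (rho : nat -> nat) i := rho i + (k.-1 - i) - l.
Definition leg N k l rho j := conj_part N rho j + (l.-1 - j) - k.

End Conj.

Section HookWeight.
Variable R : realType.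

Lemma vdm_recr r (x : nat -> R) :
  vdm (fun i : 'I_r.+1 => x i) = vdm (fun i : 'I_r => x i) * \prod_(i < r) (x i - x r).
Proof.
rewrite /vdm big_ord_recr /= [X in _ * X]big1 ?mulr1; last by move=> j; have := ltn_ord j; lia.
rewrite -big_split; apply: eq_bigr => i _ /=.
by rewrite big_mkcond big_ord_recr /= ltn_ord -big_mkcond.
Qed.

Lemma eq_vdm r (x y : 'I_r -> R) : x =1 y -> vdm x = vdm y.
Proof. by move=> xy; apply: eq_bigr => i _; apply: eq_bigr => j _; rewrite !xy. Qed.

Lemma vdm_shift r (x : 'I_r -> R) c : vdm (fun i => x i + c) = vdm x.
Proof. by apply: eq_bigr => i _; apply: eq_bigr => j _; ring. Qed.

Definition hook_weight k (a : nat -> nat) l (b : nat -> nat) : R :=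
  vdm (fun i : 'I_k => (a i)%:R : R) * vdm (fun j : 'I_l => (b j)%:R : R) /
  ((\prod_(i < k) (a i)`!%:R) * (\prod_(j < l) (b j)`!%:R) *
   \prod_(i < k) \prod_(j < l) (a i + b j).+1%:R).

Lemma eq_hook_weight k a a' l b b' : (forall i, (i < k)%N -> a i = a' i) ->
  (forall j, (j < l)%N -> b j = b' j) -> hook_weight k a l b = hook_weight k a' l b'.
Proof.
move=> aa bb; rewrite /hook_weight.
congr (_ * _ / (_ * _ * _)).
- by apply: eq_vdm => i; rewrite aa.
- by apply: eq_vdm => j; rewrite bb.
- by apply: eq_bigr => i _; rewrite aa.
- by apply: eq_bigr => j _; rewrite bb.
- by apply: eq_bigr => i _; apply: eq_bigr => j _; rewrite aa// bb.
Qed.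

Lemma hook_weightC k a l b : hook_weight k a l b = hook_weight l b k a.
Proof.
rewrite /hook_weight exchange_big [vdm _ * _]mulrC /=.
rewrite [X in _ / (X * _)]mulrC; congr (_ / (_ * _)).
by apply: eq_bigr => i _; apply: eq_bigr => j _; rewrite addnC.
Qed.

Lemma prod_fact_neq0 k (a : nat -> nat) : \prod_(i < k) (a i)`!%:R != 0 :> R.
Proof. by apply/prodf_neq0 => j _; rewrite pnatr_eq0 -lt0n fact_gt0. Qed.

Lemma prod_hook_neq0 k l (a b : nat -> nat) : \prod_(i < k) \prod_(j < l) (a i + b j).+1%:R != 0 :> R.
Proof. by apply/prodf_neq0 => i _; apply/prodf_neq0 => j _; rewrite pnatr_eq0. Qed.

(** A vanishing arm can be dropped, provided the other arms are lowered and
    the legs raised by one: its Vandermonde factors are the arms, and its hook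
    factors are the raised legs, which are the amounts by which the factorials
    change. *)
Lemma hook_weight_step k a l b : a k = 0%N -> (forall i, (i < k)%N -> (0 < a i)%N) ->
  hook_weight k.+1 a l b = hook_weight k (fun i => (a i).-1) l (fun j => (b j).+1).
Proof.
move=> ak ai; rewrite /hook_weight (vdm_recr _ (fun i => (a i)%:R)) !(big_ord_recr k) /= ak fact0 mulr1.
have -> : vdm (fun i : 'I_k => (a i).-1%:R : R) = vdm (fun i : 'I_k => (a i)%:R : R).
  rewrite -[RHS](vdm_shift _ (-1)); apply: eq_vdm => i.
  by rewrite -subn1 natrB ?ai.
have -> : vdm (fun j : 'I_l => (b j).+1%:R : R) = vdm (fun j : 'I_l => (b j)%:R : R).
  by rewrite -[RHS](vdm_shift _ 1); apply: eq_vdm => i; rewrite natr1.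
have -> : \prod_(i < k) (a i)`!%:R = \prod_(i < k) (a i)%:R * \prod_(i < k) ((a i).-1)`!%:R :> R.
  rewrite -big_split; apply: eq_bigr => i _ /=; rewrite -natrM.
  by case: (a i) (ai i (ltn_ord i)) => // c _; rewrite factS.
have -> : \prod_(j < l) ((b j).+1)`!%:R = \prod_(j < l) (b j).+1%:R * \prod_(j < l) (b j)`!%:R :> R.
  by rewrite -big_split; apply: eq_bigr => j _ /=; rewrite -natrM factS.
have -> : \prod_(i < k) \prod_(j < l) ((a i).-1 + (b j).+1).+1%:R =
   \prod_(i < k) \prod_(j < l) (a i + b j).+1%:R :> R.
  apply: eq_bigr => i _; apply: eq_bigr => j _; congr (_%:R).
  by have := ai i (ltn_ord i); lia.
rewrite (eq_bigr (fun i : 'I_k => (a i)%:R)); last by move=> i _; rewrite subr0.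
rewrite [\prod_(j < l) (0 + b j).+1%:R](eq_bigr (fun j : 'I_l => (b j).+1%:R)); last by [].
have n1 := prod_fact_neq0 k (fun i => (a i).-1); have n2 := prod_fact_neq0 l b.
have n3 := prod_hook_neq0 k l a b.
have n4 : \prod_(i < k) (a i)%:R != 0 :> R.
  by apply/prodf_neq0 => i _; rewrite pnatr_eq0 -lt0n ai.
have n5 : \prod_(j < l) (b j).+1%:R != 0 :> R by apply/prodf_neq0 => i _; rewrite pnatr_eq0.
field; by rewrite n1 n2 n3 n4 n5.
Qed.

Section Path.
Variables (N : nat) (rho : nat -> nat).
Hypothesis sr : is_shape N rho.

Definition path_weight k l := hook_weight k (arm k l rho) l (leg N k l rho).

Lemma path_up k l : on_boundary rho k.+1 l -> on_boundary rho k l ->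
  path_weight k.+1 l = path_weight k l.
Proof.
move=> [h1 h2] [h3 h4]; have rk : rho k = l by apply/eqP; rewrite eqn_leq h4 h1.
rewrite /path_weight hook_weight_step.
- apply: eq_hook_weight => [i ik|j jl]; rewrite /arm /leg.
    by have := h3 _ ik; lia.
  suff : (k < conj_part N rho j)%N by lia.
  by rewrite conj_part_gt// rk.
- by rewrite /arm rk; lia.
- by move=> i ik; rewrite /arm; have := h3 _ ik; lia.
Qed.

Lemma path_right k l : on_boundary rho k l -> on_boundary rho k l.+1 ->
  path_weight k l.+1 = path_weight k l.
Proof.
move=> [h1 h2] [h3 h4].
have cl : conj_part N rho l = k.
  by apply/eqP; rewrite eqn_leq conj_part_le//= conj_part_ge.
have cj j : (j < l)%N -> (k <= conj_part N rho j)%N.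
  by move=> jl; apply: conj_part_ge => // i ik; rewrite (leq_trans jl)// h1.
rewrite /path_weight hook_weightC hook_weight_step.
- rewrite hook_weightC; apply: eq_hook_weight => [i ik|j jl]; rewrite /arm /leg.
    by have := h3 _ ik; lia.
  by have := cj _ jl; lia.
- by rewrite /leg cl; lia.
- by move=> j jl; rewrite /leg; have := cj _ jl; lia.
Qed.

Lemma path_column k k' l : (k <= k')%N -> on_boundary rho k l -> on_boundary rho k' l ->
  path_weight k' l = path_weight k l.
Proof.
elim: k' => [|k' IH]; first by rewrite leqn0 => /eqP ->.
rewrite leq_eqVlt => /orP[/eqP->//|kk'] b1 b2.
have b3 : on_boundary rho k' l.
  split=> [i ik|]; first by apply: (proj1 b2); exact: leqW.
  exact: leq_trans (shape_leq sr (_ : (k <= k')%N)) (proj2 b1).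
by rewrite path_up// IH.
Qed.

(** The border of the diagram is a path of unit steps that joins ([k], [l]) to
    ([N], 0), and no step changes the weight. *)
Lemma path_weight_invariant k l : (k <= N)%N -> on_boundary rho k l ->
  path_weight k l = path_weight N 0.
Proof.
elim: l k => [|l IH] k kN bk.
  rewrite -(path_column kN)//; split=> // ; last by rewrite (proj2 sr).
(* From (k, l.+1) the border goes down to row K and then turns left to (K, l). *)
set K := conj_part N rho l.
have kK : (k <= K)%N by apply: conj_part_ge => // i ik; exact: (proj1 bk).
have KN : (K <= N)%N by apply: conj_part_le => //; rewrite (proj2 sr).
have bK1 : on_boundary rho K l.+1.
  split=> [i iK|]; first by rewrite -(conj_part_gt _ _ sr).
  exact: leq_trans (shape_leq sr kK) (proj2 bk).
have bK : on_boundary rho K l.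
  split=> [i iK|]; first by rewrite ltnW// -(conj_part_gt _ _ sr).
  by rewrite leqNgt -(conj_part_gt _ _ sr) ltnn.
by rewrite -(path_column kK)// path_right// IH.
Qed.

(** At the corner ([N], 0) of the border the weight is the formula of
    Frobenius. *)
Lemma nsyt_hook n k l : (\sum_(i < N) rho i)%N = n -> (k <= N)%N -> on_boundary rho k l ->
  (nsyt N n rho)%:R = n`!%:R * hook_weight k (arm k l rho) l (leg N k l rho).
Proof.
move=> sn kN bk; rewrite -[hook_weight _ _ _ _]/(path_weight k l) path_weight_invariant//.
rewrite (frobenius_formula R sr sn) -mulrA; congr (_ * _).
rewrite /path_weight (@eq_hook_weight _ _ (beta_number N rho) _ _ (fun=> 0%N))//; last first.
  by move=> i _; rewrite /arm subn0.
rewrite /hook_weight [vdm (fun j : 'I_0 => _)]/vdm !big_ord0 !mulr1.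
by rewrite [X in _ / (_ * X)]big1 ?mulr1// => i _; rewrite big_ord0.
Qed.

End Path.
End HookWeight.

(** * Partitions from arms and legs *)

Local Notation rows lam := (fun i => part lam i.+1).

Section ArmLeg.
Local Open Scope nat_scope.

Lemma cpartE n (lam : intpart n) j : cpart lam j.+1 = conj_part n (rows lam) j.
Proof.
have sz : size [seq val r | r <- val lam] = n by rewrite size_map size_tuple.
rewrite /cpart -sum1_count big_mkcond /= (big_nth 0) sz big_mkord.
by apply: eq_bigr => i _; rewrite val_nth_seq; case: (j < _).
Qed.

Lemma ltn_ext x y : (forall i, (i < x) = (i < y)) -> x = y.
Proof.
move=> h; apply/eqP; rewrite eqn_leq; apply/andP; split; rewrite leqNgt.
  by rewrite h ltnn.
by rewrite -h ltnn.
Qed.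

Lemma sum_conj_part N rho l : \sum_(j < l) conj_part N rho j = \sum_(i < N) minn l (rho i).
Proof.
rewrite exchange_big /=; apply: eq_bigr => i _.
have -> : \sum_(j < l) (j < rho i) = \sum_(j < l | j < rho i) 1.
  by rewrite [RHS]big_mkcond; apply: eq_bigr => j _; case: (j < _).
case: (leqP l (rho i)) => h.
  rewrite (eq_bigl xpredT) ?sum1_card ?card_ord// => j; exact: leq_trans h.
by rewrite (big_ord_narrow (ltnW h)) sum1_card card_ord.
Qed.

(** The first [k] rows and the first [l] columns cover the diagram, and they
    share the rectangle; the binomials count the two staircases. *)
Lemma sum_arm_leg N rho k l : is_shape N rho -> k <= N -> on_boundary rho k l ->
  \sum_(i < k) arm k l rho i + \sum_(j < l) leg N k l rho j + k * l =
  \sum_(i < N) rho i + 'C(k, 2) + 'C(l, 2).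
Proof.
move=> sr kN [h1 h2].
have e1 : \sum_(i < k) arm k l rho i + k * l = \sum_(i < k) rho i + 'C(k, 2).
  rewrite -sum_rev_ord -big_split /= -[k in k * l]card_ord -sum_nat_const -big_split /=.
  by apply: eq_bigr => i _; rewrite /arm; have := h1 _ (ltn_ord i); lia.
have e2 : \sum_(j < l) leg N k l rho j + k * l = \sum_(j < l) conj_part N rho j + 'C(l, 2).
  rewrite -sum_rev_ord -big_split /= mulnC -[l in l * k]card_ord -sum_nat_const -big_split /=.
  apply: eq_bigr => j _; rewrite /leg.
  have : k <= conj_part N rho j; last by lia.
  by apply: conj_part_ge => // i ik; rewrite (leq_trans (ltn_ord j))// h1.
have e3 : \sum_(j < l) conj_part N rho j + \sum_(i < k) rho i = \sum_(i < N) rho i + k * l.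
  have -> : k * l = \sum_(i < N) (if i < k then l else 0).
    by rewrite -big_mkcond -(big_ord_widen N (fun=> l) kN) sum_nat_const card_ord.
  have -> : \sum_(i < k) rho i = \sum_(i < N) (if i < k then rho i else 0).
    by rewrite (big_ord_widen N _ kN) big_mkcond.
  rewrite sum_conj_part.
  rewrite -!big_split /=; apply: eq_bigr => i _; case: ltnP => ik.
    by have := h1 _ ik; lia.
  by have := leq_trans (shape_leq sr ik) h2; lia.
lia.
Qed.

Lemma intpart_of_shape N rho n : is_shape N rho -> \sum_(i < N) rho i = n ->
  exists lam : intpart n, forall i, part lam i.+1 = rho i.
Proof.
move=> sr sn.
have rN i : N <= i -> rho i = 0 by move=> Ni; have := shape_leq sr Ni; rewrite (proj2 sr); lia.
have pos i : 0 < rho i -> i < n.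
  move=> ri; have iN : i < N by rewrite ltnNge; apply/negP => /rN r0; rewrite r0 in ri.
  rewrite -sn; apply: (@leq_trans (\sum_(i' < N | i' < i.+1) 1)).
    by rewrite -(big_ord_widen N (fun _ => 1) iN) sum_nat_const card_ord muln1.
  rewrite big_mkcond; apply: leq_sum => i' _; case: ifP => // h.
  by rewrite (leq_trans ri)// (shape_leq sr).
have rn i : n <= i -> rho i = 0 by move=> ni; case: (posnP (rho i)) => // /pos; rewrite ltnNge ni.
have le i : rho i <= n.
  case: (ltnP i N) => [iN|/rN -> //]; rewrite -sn (bigD1 (Ordinal iN))//=; exact: leq_addr.
have sumE K : (forall i, K <= i -> rho i = 0) -> \sum_(i < K) rho i = n.
  move=> h; rewrite -sn (big_ord_widen (maxn K N) _ (leq_maxl _ _)) [RHS](big_ord_widen (maxn K N) _ (leq_maxr _ _)).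
  rewrite big_mkcond [RHS]big_mkcond; apply: eq_bigr => i _.
  by case: (ltnP i K) => [_|/h r1]; case: (ltnP i N) => [_|/rN r2]; rewrite ?r1 ?r2.
pose s : n.-tuple 'I_n.+1 := [tuple inord (rho i) | i < n].
have sE : [seq val r | r <- s] = mkseq rho n.
  apply: (@eq_from_nth _ 0); rewrite size_map size_tuple ?size_mkseq// => i iN.
  rewrite (nth_map ord0) ?size_tuple// nth_mkseq//.
  rewrite -(tnth_nth ord0 s (Ordinal iN)) tnth_mktuple /= inordK//.
  by rewrite ltnS le.
have sp : is_intpart s.
  rewrite /is_intpart sE; apply/andP; split.
    apply/(sortedP 0) => i; rewrite size_mkseq => lt; rewrite !nth_mkseq ?(ltnW lt)//.
    exact: (proj1 sr).
  by rewrite sumnE (big_nth 0) size_mkseq big_mkord -[X in _ == X](sumE n)//; apply/eqP/eq_bigr => i _; rewrite nth_mkseq.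
exists (exist _ s sp) => i; rewrite val_nth_seq /= sE.
case: (ltnP i n) => iN; first by rewrite nth_mkseq.
by rewrite nth_default ?size_mkseq// rn.
Qed.

(** The legs, without their staircase, are the columns below the rectangle, so
    the rows below it form the conjugate shape [conj_part l nu]. *)
Lemma intpart_of_arm_leg k l n (a b : nat -> nat) : k <= n ->
  (forall i j, i < j < k -> a j < a i) -> (forall i j, i < j < l -> b j < b i) ->
  \sum_(i < k) a i + \sum_(j < l) b j + k * l = n + 'C(k, 2) + 'C(l, 2) ->
  exists lam : intpart n, [/\ on_boundary (rows lam) k l,
    forall i, i < k -> arm k l (rows lam) i = a i &
    forall j, j < l -> leg n k l (rows lam) j = b j].
Proof.
move=> kn aS bS e.
(* A strictly decreasing sequence dominates the staircase, so the differences
   below do not truncate. *)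
have low r (c : nat -> nat) : (forall i j, i < j < r -> c j < c i) -> forall i, i < r -> r.-1 - i <= c i.
  move=> cS i; case: r cS => // r cS; rewrite ltnS /= => ir; rewrite -(subKn ir).
  move: (r - i) (leq_subr i r) => d; elim: d => [|d IH] dr; first by lia.
  by have := IH (ltnW dr); have := cS (r - d.+1) (r - d); lia.
have aL := low _ _ aS; have bL := low _ _ bS.
pose nu j := if j < l then b j - (l.-1 - j) else 0.
have sn : is_shape l nu.
  split=> [j|]; rewrite /nu ?ltnn//; case: ltnP => // jl; rewrite (ltnW jl).
  by have := bS j j.+1; lia.
pose rho i := if i < k then a i + l - (k.-1 - i) else conj_part l nu (i - k).
have cl i : conj_part l nu i <= l by apply: conj_part_le => //; rewrite (proj2 sn).
pose N := k + nu 0.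
have sr : is_shape N rho.
  split=> [i|]; last first.
    rewrite /rho /N ltnNge leq_addr /= addKn; apply/eqP; rewrite -leqn0.
    by apply: conj_part_le.
  rewrite /rho; case: ltnP => ik; first by rewrite (ltnW ik); have := aS i i.+1; lia.
  case: ltnP => ik2; first by have := aL _ ik2; have := cl (i.+1 - k); lia.
  by apply: leq_sum => j _; rewrite subSn//; case: (ltnP (i - k).+1 (nu j)) => [h|//]; rewrite (ltnW h).
have kN : k <= N by exact: leq_addr.
have bnd : on_boundary rho k l.
  split=> [i ik|]; rewrite /rho ?ik ?ltnn//.
  by have := aL _ ik; lia.
have armE i : i < k -> arm k l rho i = a i.
  by move=> ik; rewrite /arm /rho ik; have := aL _ ik; lia.
have cE j : j < l -> conj_part N rho j = k + nu j.
  move=> jl; apply: ltn_ext => i; rewrite conj_part_gt// /rho; case: (ltnP i k) => ik.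
    by have := aL _ ik; lia.
  by rewrite conj_part_gt//; lia.
have legE j : j < l -> leg N k l rho j = b j.
  by move=> jl; rewrite /leg cE// /nu jl; have := bL _ jl; lia.
have sN : \sum_(i < N) rho i = n.
  have := sum_arm_leg sr kN bnd.
  rewrite (eq_bigr (fun i : 'I_k => a i)); last by move=> i _; rewrite armE.
  rewrite [X in _ + X + _](eq_bigr (fun j : 'I_l => b j)); last by move=> j _; rewrite legE.
  by rewrite e; lia.
have [lam lamE] := intpart_of_shape sr sN; exists lam; split.
- split=> [i ik|]; rewrite lamE; last exact: (proj2 bnd).
  exact: (proj1 bnd).
- by move=> i ik; rewrite /arm lamE -armE.
- move=> j jl; rewrite -legE// /leg; congr (_ + _ - _); apply: ltn_ext => i.
  by rewrite !conj_part_gt ?lamE//; exact: part_shape.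
Qed.

Lemma arm_leg_inj k l n (lam mu : intpart n) :
  on_boundary (rows lam) k l -> on_boundary (rows mu) k l ->
  (forall i, i < k -> arm k l (rows lam) i = arm k l (rows mu) i) ->
  (forall j, j < l -> leg n k l (rows lam) j = leg n k l (rows mu) j) -> lam = mu.
Proof.
move=> b1 b2 ea el.
have s1 := part_shape lam; have s2 := part_shape mu.
apply: intpart_inj => i; case: (ltnP i k) => ik.
    by have := ea i ik; rewrite /arm; have := proj1 b1 _ ik; have := proj1 b2 _ ik; rewrite /=; lia.
  apply: ltn_ext => j.
  case: (ltnP j l) => jl; last first.
    have := leq_trans (shape_leq s1 ik) (proj2 b1); have := leq_trans (shape_leq s2 ik) (proj2 b2).
    by rewrite /=; lia.
  rewrite -(conj_part_gt i j s1) -(conj_part_gt i j s2).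
  have c1 : k <= conj_part n (rows lam) j.
    by apply: conj_part_ge => // i' ik'; rewrite (leq_trans jl)// (proj1 b1).
  have c2 : k <= conj_part n (rows mu) j.
    by apply: conj_part_ge => // i' ik'; rewrite (leq_trans jl)// (proj1 b2).
  by have := el j jl; rewrite /leg; lia.
Qed.

End ArmLeg.

(** * Limits of sequences *)

Section Sequences.
Variable R : realType.

Lemma near_cvgn (f g : nat -> R) (a : R) :
  (\forall n \near \oo, f n = g n) -> f @ \oo --> a -> g @ \oo --> a.
Proof. by move=> fg fa; apply: cvg_trans fa; apply: near_eq_cvg; exact: fg. Qed.

Lemma cvgn_prod (I : Type) (r : seq I) (P : pred I) (f : I -> nat -> R) (a : I -> R) :
  (forall i, P i -> f i @ \oo --> a i) ->
  (fun n => \prod_(i <- r | P i) f i n) @ \oo --> \prod_(i <- r | P i) a i.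
Proof.
move=> h; elim: r => [|i r IH].
  rewrite big_nil (_ : (fun n => _) = fun=> 1); first exact: cvg_cst.
  by apply/funext => n; rewrite big_nil.
rewrite big_cons (_ : (fun n => _) = fun n => if P i then f i n * \prod_(i <- r | P i) f i n
   else \prod_(i <- r | P i) f i n); last by apply/funext => n; rewrite big_cons.
by case: ifP => Pi //; apply: cvgM => //; exact: h.
Qed.

Lemma cvgn_sum (I : Type) (r : seq I) (f : I -> nat -> R) (a : I -> R) :
  (forall i, f i @ \oo --> a i) ->
  (fun n => \sum_(i <- r) f i n) @ \oo --> \sum_(i <- r) a i.
Proof.
move=> h; elim: r => [|i r IH].
  rewrite big_nil (_ : (fun n => _) = fun=> 0); first exact: cvg_cst.
  by apply/funext => n; rewrite big_nil.
rewrite big_cons (_ : (fun n => _) = fun n => f i n + \sum_(i <- r) f i n).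
  by apply: cvgD => //; exact: h.
by apply/funext => n; rewrite big_cons.
Qed.

Lemma cvgn_sqrtV : (fun n => (Num.sqrt n%:R)^-1 : R) @ \oo --> (0 : R).
Proof.
rewrite (_ : (fun n => _) = fun n => Num.sqrt (n%:R^-1)); last first.
  by apply/funext => n; rewrite sqrtrV.
have h : (fun n => n%:R^-1 : R) @ \oo --> (0 : R).
  rewrite -(cvg_shiftn 1); apply: cvg_trans (@cvg_harmonic R).
  by apply: near_eq_cvg; near=> n; rewrite /harmonic /= addn1.
rewrite -[X in _ --> X](@sqrtr0 R).
exact: (continuous_cvg _ (@sqrt_continuous R 0) h).
Unshelve. all: by end_near.
Qed.

(** At a limit 0, where [powR] is not given by the logarithm, the claim holds
    by monotonicity. *)
Lemma cvgn_powR (b : R) (f : nat -> R) (a : R) : 0 < b -> 0 <= a ->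
  (\forall n \near \oo, 0 <= f n) -> f @ \oo --> a -> (fun n => f n `^ b) @ \oo --> a `^ b.
Proof.
move=> b0; rewrite le_eqVlt => /orP[/eqP <-|a0] f0 fa.
  rewrite powR0 ?gt_eqF//; apply/cvgr0Pnorm_le => e e0.
  move/cvgr0Pnorm_le : fa => /(_ (e `^ b^-1) (powR_gt0 _ e0)) h.
  near=> n; rewrite ger0_norm ?powR_ge0//.
  have -> : e = (e `^ b^-1) `^ b by rewrite -powRrM mulVf ?gt_eqF// powRr1// ltW.
  have fn0 : 0 <= f n by near: n.
  apply: ge0_ler_powR; rewrite ?nnegrE ?powR_ge0 ?(ltW b0)//.
  by rewrite -[leLHS]ger0_norm//; near: n.
have h : (fun n => expR (b * ln (f n))) @ \oo --> expR (b * ln a).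
  apply: continuous_cvg; first exact: continuous_expR.
  by apply: cvgMr; apply: continuous_cvg => //; exact: continuous_ln.
rewrite {2}/powR gt_eqF//; apply: (near_cvgn _ h); near=> n.
have fn : 0 < f n by near: n; exact: cvgr_gt fa _ a0.
by rewrite /powR gt_eqF.
Unshelve. all: by end_near.
Qed.

End Sequences.

(** * Ratios of Poisson weights: exponential decay *)

Section Poisson.
Variable R : realType.

(** The weights of the Poisson law of mean [m], divided by the weight at its
    mode [m]. *)
Definition poisson_ratio m v : R := m`!%:R * m%:R ^+ v / (v`!%:R * m%:R ^+ m).

Lemma poisson_ratio_refl m : (0 < m)%N -> poisson_ratio m m = 1.
Proof. by move=> m0; rewrite /poisson_ratio divff// mulf_neq0 ?expf_neq0 ?pnatr_eq0 -?lt0n ?fact_gt0. Qed.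

Lemma poisson_ratioS m v : (0 < m)%N -> poisson_ratio m v.+1 = poisson_ratio m v * (m%:R / v.+1%:R).
Proof.
move=> m0; rewrite /poisson_ratio factS natrM exprS.
have h1 : m%:R != 0 :> R by rewrite pnatr_eq0 -lt0n.
have h2 : v.+1%:R != 0 :> R by rewrite pnatr_eq0.
have h3 : v`!%:R != 0 :> R by rewrite pnatr_eq0 -lt0n fact_gt0.
have h4 : m%:R ^+ m != 0 :> R by rewrite expf_neq0.
move: (v.+1%:R) (v`!%:R) (m`!%:R) h2 h3 => q p r h2 h3; by field; rewrite h2 h3 h4.
Qed.

Lemma poisson_ratio_pred m v : (0 < m)%N -> poisson_ratio m v = poisson_ratio m v.+1 * (v.+1%:R / m%:R).
Proof.
move=> m0; rewrite poisson_ratioS// -mulrA [X in _ * X](_ : _ = 1) ?mulr1//.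
have h1 : m%:R != 0 :> R by rewrite pnatr_eq0 -lt0n.
have h2 : v.+1%:R != 0 :> R by rewrite pnatr_eq0.
move: (v.+1%:R) h2 => q h2; by field; rewrite h1 h2.
Qed.

Lemma poisson_ratio_gt0 m v : (0 < m)%N -> 0 < poisson_ratio m v.
Proof.
by move=> m0; rewrite /poisson_ratio divr_gt0// mulr_gt0 ?exprn_gt0// ltr0n ?fact_gt0.
Qed.

Lemma poisson_ratio_le1_up m s : (0 < m)%N -> poisson_ratio m (m + s) <= 1.
Proof.
move=> m0; elim: s => [|s IH]; first by rewrite addn0 poisson_ratio_refl.
rewrite addnS poisson_ratioS//; apply: mulr_ile1 => //.
- by rewrite ltW// poisson_ratio_gt0.
- by rewrite ler_pdivrMr ?ltr0n// mul1r ler_nat; lia.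
Qed.

Lemma poisson_ratio_le1_down m s : (s < m)%N -> poisson_ratio m (m - s) <= 1.
Proof.
elim: s => [|s IH] sm; first by rewrite subn0 poisson_ratio_refl.
have m0 : (0 < m)%N by apply: leq_trans sm.
rewrite poisson_ratio_pred// subnSK ?(ltnW sm)//; apply: mulr_ile1 => //.
- by rewrite ltW// poisson_ratio_gt0.
- by apply: IH; exact: ltnW.
- by rewrite ler_pdivrMr ?ltr0n// mul1r ler_nat leq_subr.
Qed.

Lemma expR_half_le (x : R) : 0 <= x <= 1 -> (1 + x)^-1 <= expR (- (x / 2%:R)).
Proof.
move=> /andP[x0 x1]; apply: le_trans (expR_ge1Dx (- (x / 2%:R))).
have h : 0 < 1 + x by lra.
by rewrite -(ler_pM2l h) mulfV ?gt_eqF//; nra.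
Qed.

(** Up to [m + sqrt m] the ratio is at most 1; from there on, every step
    multiplies it by at most [1 / (1 + 1 / sqrt m)], hence by at most
    [expR (- 1 / (2 sqrt m))]. *)
Lemma decay_up m s : (0 < m)%N ->
  poisson_ratio m (m + s) <= expR (1 - s%:R / (2%:R * Num.sqrt m%:R)).
Proof.
move=> m0; set h := Num.sqrt m%:R.
have h2 : h * h = m%:R by rewrite -expr2 sqr_sqrtr.
have h1 : 1 <= h by rewrite -sqrtr1 ler_sqrt ?ler1n.
have mp : 0 < m%:R :> R by rewrite ltr0n.
elim: s => [|s IH].
  by rewrite mul0r subr0 addn0 poisson_ratio_refl// -[X in X <= _]expR0 ler_expR.
case: (leP s.+1%:R h) => hs.
  apply: le_trans (poisson_ratio_le1_up _ m0) _; rewrite -[X in X <= _]expR0 ler_expR subr_ge0.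
  by rewrite ler_pdivrMr; lra.
rewrite addnS poisson_ratioS//.
have e : 1 - s.+1%:R / (2%:R * h) = (1 - s%:R / (2%:R * h)) + - (h^-1 / 2%:R).
  by rewrite -natr1; field; apply/eqP => h0; rewrite h0 in h1; lra.
rewrite e expRD; apply: ler_pM => //.
- by rewrite ltW// poisson_ratio_gt0.
apply: le_trans (expR_half_le _); last first.
  by rewrite invr_ge0 invf_le1; lra.
rewrite -[leLHS]invrK lef_pV2 ?posrE ?invr_gt0 ?divr_gt0 ?ltr0n//; last first.
  by rewrite addr_gt0// invr_gt0; lra.
rewrite invf_div ler_pdivlMr// -h2 mulrDl mul1r mulrA mulVf ?mul1r; last by rewrite gt_eqF//; lra.
by rewrite h2 -addnS natrD; lra.
Qed.

Lemma decay_down m s : (s <= m)%N -> (0 < m)%N ->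
  poisson_ratio m (m - s) <= expR (1 - s%:R / (2%:R * Num.sqrt m%:R)).
Proof.
move=> + m0; set h := Num.sqrt m%:R.
have h2 : h * h = m%:R by rewrite -expr2 sqr_sqrtr.
have h1 : 1 <= h by rewrite -sqrtr1 ler_sqrt ?ler1n.
have mp : 0 < m%:R :> R by rewrite ltr0n.
elim: s => [|s IH] sm.
  by rewrite mul0r subr0 subn0 poisson_ratio_refl// -[X in X <= _]expR0 ler_expR.
have rE : poisson_ratio m (m - s.+1) = poisson_ratio m (m - s) * (1 - s%:R / m%:R).
  rewrite poisson_ratio_pred// subnSK ?(ltnW sm)//; congr (_ * _).
  by rewrite natrB ?(ltnW sm)// mulrBl divff ?gt_eqF.
have r0 : 0 <= 1 - s%:R / m%:R :> R by rewrite subr_ge0 ler_pdivrMr// mul1r ler_nat ltnW.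
case: (leP s%:R h) => hs.
  apply: (@le_trans _ _ 1).
    rewrite rE; apply: mulr_ile1 => //; first by rewrite ltW// poisson_ratio_gt0.
      exact: poisson_ratio_le1_down.
  rewrite -[X in X <= _]expR0 ler_expR subr_ge0 -natr1.
  by rewrite ler_pdivrMr; lra.
have e : 1 - s.+1%:R / (2%:R * h) = (1 - s%:R / (2%:R * h)) + - (h^-1 / 2%:R).
  by rewrite -natr1; field; apply/eqP => h0; rewrite h0 in h1; lra.
rewrite rE e expRD; apply: ler_pM => //.
- by rewrite ltW// poisson_ratio_gt0.
- by apply: IH; exact: ltnW.
have hm : h^-1 <= s%:R / m%:R.
  by rewrite -h2 invfM mulrA ler_pdivlMr ?mulVf ?ler_pdivlMr ?mul1r ?gt_eqF; lra.
have hi : 0 < h^-1 by rewrite invr_gt0; lra.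
by apply: le_trans (expR_ge1Dx _); lra.
Qed.

Lemma poisson_ratio_decay m v : (0 < m)%N ->
  poisson_ratio m v <= expR (1 - `|v%:R - m%:R| / (2%:R * Num.sqrt m%:R)).
Proof.
move=> m0; case: (leqP m v) => h.
  have -> : `|v%:R - m%:R| = (v - m)%:R :> R by rewrite -natrB ?normr_nat.
  by rewrite -{1}(subnKC h); exact: decay_up.
have -> : `|v%:R - m%:R| = (m - v)%:R :> R by rewrite distrC -natrB ?(ltnW h)// normr_nat.
by rewrite -{1}(subKn (ltnW h)); apply: decay_down => //; exact: leq_subr.
Qed.

End Poisson.

(** * Ratios of Poisson weights: the Gaussian limit *)

Section PoissonLimit.
Variable R : realType.

Lemma inv1D_ge_expR (u : R) : 0 <= u -> expR (- u) <= (1 + u)^-1.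
Proof.
move=> u0; rewrite expRN lef_pV2 ?posrE ?expR_gt0//; last lra.
exact: expR_ge1Dx.
Qed.

Lemma inv1D_le_expR (u : R) : 0 <= u -> (1 + u)^-1 <= expR (- u + u ^+ 2).
Proof.
move=> u0; apply: le_trans (expR_ge1Dx _).
have h : 0 < 1 + u by lra.
rewrite -(ler_pM2l h) mulfV ?gt_eqF//.
have -> : (1 + u) * (1 + (- u + u ^+ 2)) = 1 + u ^+ 3 by ring.
by rewrite lerDl exprn_ge0.
Qed.

Lemma oneB_le_expR (u : R) : 1 - u <= expR (- u).
Proof. exact: expR_ge1Dx. Qed.

Lemma oneB_ge_expR (u : R) : 0 <= u <= 2%:R^-1 -> expR (- u - 2%:R * u ^+ 2) <= 1 - u.
Proof.
move=> /andP[u0 u1]; have h : 0 < 1 - u by lra.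
have e := expR_ge1Dx (u + 2%:R * u ^+ 2).
have -> : - u - 2%:R * u ^+ 2 = - (u + 2%:R * u ^+ 2) by ring.
rewrite expRN -[leRHS]invrK lef_pV2 ?posrE ?expR_gt0 ?invr_gt0//.
apply: le_trans e; rewrite -(ler_pM2l h) mulfV ?gt_eqF//.
have -> : (1 - u) * (1 + (u + 2%:R * u ^+ 2)) = 1 + u ^+ 2 * (1 - 2%:R * u) by ring.
by rewrite lerDl mulr_ge0 ?exprn_ge0//; lra.
Qed.

Lemma ler_expRM (a b c d : R) : 0 <= a -> 0 <= b -> a <= expR c -> b <= expR d -> a * b <= expR (c + d).
Proof. by move=> a0 b0 h1 h2; rewrite expRD ler_pM. Qed.

(** The ratio is a product of factors [1 / (1 + i / m)] with [i] at most [s];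
    each is [expR (- i / m)] up to [expR ((i / m)^2)]. *)
Lemma poisson_ratio_up m s : (0 < m)%N ->
  expR (- (s%:R * (s%:R + 1) / (2%:R * m%:R))) <= poisson_ratio R m (m + s) <=
  expR (- (s%:R * (s%:R + 1) / (2%:R * m%:R)) + 2%:R * s%:R ^+ 3 / m%:R ^+ 2).
Proof.
move=> m0; have mp : 0 < m%:R :> R by rewrite ltr0n.
have mn := gt_eqF mp.
elim: s => [|s /andP[lo hi]].
  by rewrite addn0 poisson_ratio_refl// expr0n /= mulr0 !mul0r oppr0 addr0 expR0 lexx.
set u : R := s.+1%:R / m%:R.
have u0 : 0 <= u by rewrite divr_ge0.
have re : m%:R / (m + s).+1%:R = (1 + u)^-1 :> R.
  rewrite -[LHS]invf_div -addnS natrD; congr (_^-1).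
  by rewrite mulrDl divff ?mn.
rewrite addnS poisson_ratioS// re; apply/andP; split.
  have -> : - (s.+1%:R * (s.+1%:R + 1) / (2%:R * m%:R)) =
     - (s%:R * (s%:R + 1) / (2%:R * m%:R)) + - u :> R.
    by rewrite /u -natr1; field; rewrite mn.
  by rewrite expRD ler_pM ?expR_ge0// inv1D_ge_expR.
apply: le_trans (ler_expRM _ _ hi (inv1D_le_expR u0)) _.
- by rewrite ltW// poisson_ratio_gt0.
- by rewrite invr_ge0; lra.
rewrite ler_expR -subr_ge0.
have -> : - (s.+1%:R * (s.+1%:R + 1) / (2%:R * m%:R)) + 2%:R * s.+1%:R ^+ 3 / m%:R ^+ 2 -
  (- (s%:R * (s%:R + 1) / (2%:R * m%:R)) + 2%:R * s%:R ^+ 3 / m%:R ^+ 2 + (- u + u ^+ 2)) =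
  (5%:R * s%:R ^+ 2 + 4%:R * s%:R + 1) / m%:R ^+ 2 :> R.
  by rewrite /u -natr1; field; rewrite mn.
by rewrite divr_ge0 ?exprn_ge0// !addr_ge0// mulr_ge0// exprn_ge0.
Qed.

Lemma poisson_ratio_down m s : (0 < m)%N -> (s.*2 <= m)%N ->
  expR (- (s%:R * (s%:R - 1) / (2%:R * m%:R)) - 2%:R * s%:R ^+ 3 / m%:R ^+ 2)
    <= poisson_ratio R m (m - s) <=
  expR (- (s%:R * (s%:R - 1) / (2%:R * m%:R))).
Proof.
move=> m0; have mp : 0 < m%:R :> R by rewrite ltr0n.
have mn := gt_eqF mp.
elim: s => [|s IH] sm.
  by rewrite subn0 poisson_ratio_refl// expr0n /= mulr0 !mul0r oppr0 addr0 expR0 lexx.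
have s2 : (s.*2 <= m)%N by lia.
have /andP[lo hi] := IH s2; set u : R := s%:R / m%:R.
have u0 : 0 <= u by rewrite divr_ge0.
have u1 : u <= 2%:R^-1.
  rewrite ler_pdivrMr// mulrC ler_pdivlMr// -natrM ler_nat; lia.
have rE : poisson_ratio R m (m - s.+1) = poisson_ratio R m (m - s) * (1 - u).
  have sm' : (s < m)%N by lia.
  rewrite poisson_ratio_pred// subnSK//; congr (_ * _).
  by rewrite natrB ?(ltnW sm')// mulrBl divff ?mn.
rewrite rE; apply/andP; split; last first.
  have -> : - (s.+1%:R * (s.+1%:R - 1) / (2%:R * m%:R)) =
     - (s%:R * (s%:R - 1) / (2%:R * m%:R)) + - u :> R.
    by rewrite /u -natr1; field; rewrite mn.
  apply: ler_expRM => //; last exact: oneB_le_expR.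
  - by rewrite ltW// poisson_ratio_gt0.
  - by lra.
have h : expR (- u - 2%:R * u ^+ 2) <= 1 - u by apply: oneB_ge_expR; rewrite u0.
apply: le_trans (ler_pM (expR_ge0 _) (expR_ge0 _) lo h).
rewrite -expRD ler_expR -subr_ge0.
have -> : - (s%:R * (s%:R - 1) / (2%:R * m%:R)) - 2%:R * s%:R ^+ 3 / m%:R ^+ 2 + (- u - 2%:R * u ^+ 2) -
  (- (s.+1%:R * (s.+1%:R - 1) / (2%:R * m%:R)) - 2%:R * s.+1%:R ^+ 3 / m%:R ^+ 2) =
  (4%:R * s%:R ^+ 2 + 6%:R * s%:R + 2%:R) / m%:R ^+ 2 :> R.
  by rewrite /u -natr1; field; rewrite mn.
by rewrite divr_ge0 ?exprn_ge0// !addr_ge0// mulr_ge0// exprn_ge0.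
Qed.

(** The relative error is the exponential of a quantity that is O(1 / sqrt m)
    when [t] is of order [sqrt m]. *)
Lemma poisson_ratio_gauss m v (t : R := v%:R - m%:R) : (0 < m)%N -> 2%:R * `|t| <= m%:R ->
  expR (- (t ^+ 2 / (2%:R * m%:R)) - (`|t| / (2%:R * m%:R) + 2%:R * `|t| ^+ 3 / m%:R ^+ 2))
  <= poisson_ratio R m v <=
  expR (- (t ^+ 2 / (2%:R * m%:R)) + (`|t| / (2%:R * m%:R) + 2%:R * `|t| ^+ 3 / m%:R ^+ 2)).
Proof.
move=> m0; have mp : 0 < m%:R :> R by rewrite ltr0n.
have mn := gt_eqF mp.
case: (leqP m v) => h.
  pose s := (v - m)%N.
  have -> : `|t| = s%:R by rewrite /t -natrB// normr_nat.
  have -> : t = s%:R by rewrite /t -natrB.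
  rewrite -(subnKC h) -/s => _.
  have /andP[lo hi] := poisson_ratio_up s m0.
  have p0 : 0 <= 2%:R * s%:R ^+ 3 / m%:R ^+ 2 :> R by rewrite divr_ge0 ?mulr_ge0 ?exprn_ge0.
  have p1 : 0 <= s%:R / (2%:R * m%:R) :> R by rewrite divr_ge0 ?mulr_ge0.
  have e : s%:R * (s%:R + 1) / (2%:R * m%:R) = s%:R ^+ 2 / (2%:R * m%:R) + s%:R / (2%:R * m%:R) :> R.
    by field; rewrite mn.
  rewrite e in lo hi; apply/andP; split.
    by apply: le_trans lo; rewrite ler_expR; lra.
  by apply: le_trans hi _; rewrite ler_expR; lra.
pose s := (m - v)%N.
have te : t = - s%:R by rewrite /t /s natrB ?(ltnW h)// opprB.
rewrite te normrN normr_nat sqrrN -natrM ler_nat => s2.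
have s2' : (s.*2 <= m)%N by lia.
have /andP[lo hi] := poisson_ratio_down m0 s2'.
rewrite -(subKn (ltnW h)) -/s.
have p0 : 0 <= 2%:R * s%:R ^+ 3 / m%:R ^+ 2 :> R by rewrite divr_ge0 ?mulr_ge0 ?exprn_ge0.
have p1 : 0 <= s%:R / (2%:R * m%:R) :> R by rewrite divr_ge0 ?mulr_ge0.
have e : s%:R * (s%:R - 1) / (2%:R * m%:R) = s%:R ^+ 2 / (2%:R * m%:R) - s%:R / (2%:R * m%:R) :> R.
  by field; rewrite mn.
rewrite e in lo hi; apply/andP; split.
  by apply: le_trans lo; rewrite ler_expR; lra.
by apply: le_trans hi _; rewrite ler_expR; lra.
Qed.

Lemma poisson_ratio_cvg (m v : nat -> nat) (y : R) :
  (fun n => (Num.sqrt (m n)%:R)^-1 : R) @ \oo --> (0 : R) ->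
  (\forall n \near \oo, (0 < m n)%N) ->
  (fun n => ((v n)%:R - (m n)%:R) / Num.sqrt (m n)%:R : R) @ \oo --> y ->
  (fun n => poisson_ratio R (m n) (v n)) @ \oo --> expR (- (y ^+ 2 / 2%:R)).
Proof.
move=> ch m0 cy.
pose h n : R := (Num.sqrt (m n)%:R)^-1.
pose t n : R := ((v n)%:R - (m n)%:R) / Num.sqrt (m n)%:R.
pose e n : R := `|t n| * h n / 2%:R + 2%:R * `|t n| ^+ 3 * h n.
pose g n : R := - (t n ^+ 2 / 2%:R).
have ct2 : (fun n => `|t n|) @ \oo --> `|y| by apply: cvg_norm.
have ce : e @ \oo --> (0 : R).
  rewrite (_ : 0 = `|y| * 0 / 2%:R + 2%:R * `|y| ^+ 3 * 0); last by ring.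
  apply: cvgD; first by apply: cvgMl; apply: cvgM.
  apply: cvgM => //; apply: cvgMr; rewrite !exprS expr0.
  rewrite (_ : (fun n => `|t n| ^+ 3) = (fun n => `|t n| * (`|t n| * (`|t n| * 1)))); last first.
    by apply/funext => n; rewrite !exprS expr0.
  by do 3! apply: cvgM => //; exact: cvg_cst.
have cg : g @ \oo --> - (y ^+ 2 / 2%:R).
  by apply: cvgN; apply: cvgMl; rewrite expr2; apply: cvgM.
apply: (@squeeze_cvgr _ _ _ _ (fun n => expR (g n - e n)) (fun n => expR (g n + e n))).
- near=> n.
  have mn : (0 < m n)%N by near: n.
  have mp : 0 < (m n)%:R :> R by rewrite ltr0n.
  set q := Num.sqrt (m n)%:R : R.
  have q2 : (m n)%:R = q ^+ 2 :> R by rewrite sqr_sqrtr// ltW.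
  have qp : 0 < q by rewrite sqrtr_gt0.
  have qn := gt_eqF qp.
  have tE : (v n)%:R - (m n)%:R = t n * q by rewrite /t divfK ?qn.
  have nE : `|(v n)%:R - (m n)%:R| = `|t n| * q by rewrite tE normrM (gtr0_norm qp).
  have := @poisson_ratio_gauss (m n) (v n) mn.
  rewrite nE tE q2.
  have -> : (t n * q) ^+ 2 / (2%:R * q ^+ 2) = t n ^+ 2 / 2%:R by field; rewrite qn.
  have -> : `|t n| * q / (2%:R * q ^+ 2) + 2%:R * (`|t n| * q) ^+ 3 / q ^+ 2 ^+ 2 = e n.
    by rewrite /e /h -/q; field; rewrite qn.
  apply.
  have : `|t n| * h n <= 2%:R^-1.
    near: n; apply: (@cvgr_le R nat \oo _ (fun n => `|t n| * h n) (`|y| * 0)).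
      by apply: cvgM.
    by rewrite mulr0 invr_gt0.
  by rewrite /h -/q ler_pdivrMr// expr2 => hh; nra.
- rewrite (_ : - (y ^+ 2 / 2%:R) = - (y ^+ 2 / 2%:R) - 0); last by rewrite subr0.
  by apply: (cvg_comp _ _ (cvgB cg ce)); exact: continuous_expR.
- rewrite (_ : - (y ^+ 2 / 2%:R) = - (y ^+ 2 / 2%:R) + 0); last by rewrite addr0.
  by apply: (cvg_comp _ _ (cvgD cg ce)); exact: continuous_expR.
Unshelve. all: by end_near.
Qed.

End PoissonLimit.

(** * Lebesgue measure of boxes *)

Lemma measurable_forall d (T : measurableType d) (I : finType) (Q : I -> set T) :
  (forall i, measurable (Q i)) -> measurable [set t | forall i, Q i t].
Proof.
move=> mQ; have -> : [set t | forall i, Q i t] = \big[setI/setT]_i Q i.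
  apply/seteqP; split => [t h|t].
    by elim/big_ind: _ => //= i _; exact: h.
  by move=> h i; move: h; rewrite (bigD1 i)//= => -[].
exact: bigsetI_measurable.
Qed.

Section LebesgueRn.
Variable R : realType.

Definition box m (J : nat -> set (measurableTypeR R)) : set (Rn R m) :=
  [set w | forall i : 'I_m, J i (tnth w i)].
Arguments box : clear implicits.

Lemma measurable_box m J : (forall i, measurable (J i)) -> measurable (box m J).
Proof.
move=> mJ; apply: measurable_forall => i; rewrite -[X in measurable X]setTI.
exact: (measurable_tnth i).
Qed.

Lemma box_cons m J : @consRn R m @^-1` box m.+1 J = J 0%N `*` box m (fun i => J i.+1).
Proof.
apply/seteqP; split => -[x w] /=.
  move=> h; split; first by have := h ord0; rewrite (tnth_nth x).
  move=> i; have := h (lift ord0 i); rewrite !(tnth_nth x) /=.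
  by rewrite -tnth_nth.
move=> [h0 h] i; case: (unliftP ord0 i) => [j|] ->; rewrite (tnth_nth x) //=.
by rewrite -tnth_nth; exact: h.
Qed.

Lemma lebesgueRn_box m J : (forall i, measurable (J i)) ->
  lebesgueRn R m (box m J) = (\prod_(i < m) lebesgue_measure (J i))%E.
Proof.
elim: m J => [|m IH] J mJ.
  rewrite big_ord0 /= diracE mem_set//.
  by move=> [].
rewrite big_ord_recl -[X in (_ * X)%E](IH (fun i => J i.+1))//.
rewrite /= /pushforward box_cons product_measure2E//.
by apply: measurable_box => i; exact: mJ.
Qed.

Lemma sigma_finite_lebesgueRn m : sigma_finite setT (lebesgueRn R m).
Proof.
exists (fun n => box m (fun _ => `[- n%:R, n%:R]%classic)).
  apply/seteqP; split => // w _.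
  pose B := \sum_(i < m) `|tnth w i : R|.
  exists (Num.truncn B).+1 => // i; rewrite /= in_itv /= -ler_norml.
  apply: le_trans (ltW (truncnS_gt B)); rewrite /B (bigD1 i)//= lerDl.
  by apply: sumr_ge0.
move=> n; split; first by apply: measurable_box.
rewrite lebesgueRn_box//.
pose I : set (measurableTypeR R) := `[- n%:R, n%:R]%classic.
suff /andP[] : (0 <= \prod_(i < m) lebesgue_measure I < +oo)%E by [].
elim/big_ind: _ => [|x y /andP[x0 xo] /andP[y0 yo]|i _].
- by rewrite lee01 ltry.
- by rewrite mule_ge0// lte_mul_pinfty// ge0_fin_numE.
- rewrite measure_ge0/= lebesgue_measure_itv /=; case: ifP => _; last by rewrite ltry.
  by rewrite -EFinB ltry.
Qed.

(** A name for the measure to which the sigma-finite structure required by the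
    theorem of Tonelli is attached. *)
Definition sigma_finite_Rn m : set (Rn R m) -> \bar R := lebesgueRn R m.
Arguments sigma_finite_Rn m : clear implicits.

HB.instance Definition _ m := Measure.copy (sigma_finite_Rn m) (lebesgueRn R m).

HB.instance Definition _ m := Measure_isSigmaFinite.Build _ _ _ (sigma_finite_Rn m)
  (@sigma_finite_lebesgueRn m).

Lemma lebesgueRn_prod m (g : R -> R) (G : R) : measurable_fun setT g -> (forall x, 0 <= g x) ->
  (\int[lebesgue_measure]_x (g x)%:E)%E = G%:E ->
  (\int[lebesgueRn R m]_w (\prod_(i < m) g (tnth w i))%:E)%E = (G ^+ m)%:E.
Proof.
move=> mg g0 gG; elim: m => [|m IH].
  rewrite expr0 /= (eq_integral (fun=> 1%:E)); last by move=> w _; rewrite big_ord0.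
  by rewrite integral_cst//= diracE mem_set// mul1e.
have mprod k : measurable_fun [set: Rn R k] (fun w : Rn R k => \prod_(i < k) g (tnth w i)).
  apply: measurable_prod => i _.
  by apply: (measurableT_comp mg); exact: measurable_tnth.
have p0 k (w : Rn R k) : (0 <= (\prod_(i < k) g (tnth w i))%:E)%E.
  by rewrite lee_fin prodr_ge0.
pose mu : {sigma_finite_measure set (Rn R m) -> \bar R} := sigma_finite_Rn m.
pose P (w : Rn R m) : R := \prod_(i < m) g (tnth w i).
have P0 w : 0 <= P w by apply: prodr_ge0.
have consE (x : measurableTypeR R * Rn R m) : \prod_(i < m.+1) g (tnth (consRn x) i) = g x.1 * P x.2.
  by rewrite big_ord_recl; congr (_ * _); apply: eq_bigr => i _; rewrite tnthS.
have mP : measurable_fun setT (fun x : measurableTypeR R * Rn R m => g x.1 * P x.2).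
  apply: measurable_funM; first exact: (measurableT_comp mg).
  by apply: (measurableT_comp (mprod m)).
rewrite /= (ge0_integral_pushforward (@measurable_consRn R m))//=; last 2 first.
- by apply/measurable_EFinP; exact: (mprod m.+1).
- by move=> y _; exact: (p0 m.+1).
rewrite preimage_setT; under eq_integral do rewrite consE.
transitivity (\int[(@lebesgue_measure R \x mu)%E]_x (g x.1 * P x.2)%:E)%E.
  apply: eq_measure_integral => A mA _.
  by apply/esym/(product_measure_unique (m2 := mu)) => // B C mB mC; exact: product_measure2E.
rewrite fubini_tonelli2//=; last 2 first.
- by apply/measurable_EFinP.
- by move=> x; rewrite lee_fin mulr_ge0.
rewrite /fubini_G /= (eq_integral (fun y => (G%:E * (P y)%:E))%E); last first.
  move=> y _; rewrite -gG -ge0_integralZr ?lee_fin//=; last 2 first.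
  - exact/measurable_EFinP.
  - by move=> x _; rewrite lee_fin.
rewrite ge0_integralZl//.
- by rewrite [X in (_ * X)%E]IH exprS EFinM.
- by apply/measurable_EFinP; exact: mprod.
- by move=> x _; rewrite lee_fin.
- by rewrite -gG integral_ge0// => x _; rewrite lee_fin.
Qed.

End LebesgueRn.
Arguments box {R} m J.

(** * Integrable majorants and null hyperplanes *)

Section Exponential.
Variable R : realType.

Lemma measurable_expabs (a : R) : measurable_fun setT (fun x : R => expR (- (a * `|x|))).
Proof.
apply: measurableT_comp => //; apply: measurableT_comp => //.
apply: measurable_funM => //; exact: measurable_normr.
Qed.

Lemma integral_expabs (a : R) : 0 < a ->
  (\int[lebesgue_measure]_x (expR (- (a * `|x|)))%:E = (2%:R / a)%:E)%E.
Proof.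
move=> a0; rewrite ge0_symfun_integralT; last 3 first.
- by move=> x; exact: expR_ge0.
- move=> x; apply: continuous_comp; last exact: continuous_expR.
  apply: (@continuousN _ R^o); apply: (@continuousM _ R^o); first exact: cst_continuous.
  exact: (@norm_continuous _ R^o).
- by move=> x /=; rewrite normrN.
rewrite [X in (_ * X)%E](_ : _ = (a^-1)%:E) ?EFinM//.
have := integral_exponential_pdf a0; rewrite /exponential_pdf => e.
have -> : [set x : R | 0 <= x] = `[0, +oo[%classic.
  by apply/seteqP; split => x /=; rewrite in_itv /= andbT.
transitivity ((a^-1)%:E * \int[lebesgue_measure]_(x in `[0%R, +oo[) (a * expR (- a * x))%:E)%E.
  rewrite -ge0_integralZl//; last 3 first.
  - apply/measurable_EFinP; apply: measurable_funTS; apply: measurable_funM => //.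
    by apply: measurableT_comp => //; apply: measurable_funM.
  - by move=> x _; rewrite lee_fin mulr_ge0 ?expR_ge0 ?ltW.
  - by rewrite lee_fin invr_ge0 ltW.
  apply: eq_integral => x; rewrite inE /= in_itv /= andbT => x0.
  by rewrite -EFinM mulrA mulVf ?gt_eqF// mul1r ger0_norm// mulNr.
rewrite integral_mkcond [X in (_ * X)%E](_ : _ = 1%E) ?mule1// -[RHS]e.
by apply: eq_integral => x _; rewrite !patchE; case: ifP.
Qed.

(** If the first coefficient is not 0, the equation determines the first
    coordinate, and points of the line have measure zero; otherwise the set is
    a product with a set of lower dimension. *)
Lemma null_affine m (a : nat -> R) (c : R) (i : 'I_m) : a i != 0 ->
  lebesgueRn R m [set w | \sum_(j < m) a j * (tnth w j : R) = c] = 0%E.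
Proof.
elim: m a i => [|m IH] a i ai; first by case: i ai.
rewrite /= /pushforward.
have E : @consRn R m @^-1` [set w | \sum_(j < m.+1) a j * (tnth w j : R) = c] =
    [set z | a 0%N * z.1 + \sum_(j < m) a j.+1 * (tnth z.2 j : R) = c].
  by apply/seteqP; split => z /=; rewrite big_ord_recl /= => <-;
    congr (_ + _); apply: eq_bigr => j _; rewrite tnthS.
rewrite E; have [a0|a0] := eqVneq (a 0%N) 0; last first.
  rewrite /product_measure2 integral0_eq// => w _ /=.
  set q := \sum_(j < m) a j.+1 * (tnth w j : R).
  rewrite (_ : ysection _ w = [set (c - q) / a 0%N]); first exact: lebesgue_measure_set1.
  apply/seteqP; split => x; rewrite /ysection /= inE /= -/q.
    by move=> <-; rewrite addrK mulrC mulKf.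
  by move=> ->; rewrite mulrCA divff// mulr1 subrK.
have -> : [set z : measurableTypeR R * Rn R m | a 0%N * z.1 + \sum_(j < m) a j.+1 * (tnth z.2 j : R) = c] =
   setT `*` [set w | \sum_(j < m) a j.+1 * (tnth w j : R) = c].
  by apply/seteqP; split => z /=; rewrite a0 mul0r add0r; [|case].
rewrite product_measure2E//; last first.
  rewrite -[X in measurable X]setTI.
  have mf : measurable_fun [set: Rn R m] (fun w : Rn R m => \sum_(j < m) a j.+1 * (tnth w j : R)).
    apply: measurable_sum => j; apply: measurable_funM => //; exact: measurable_tnth.
  by apply: (mf measurableT [set c]).
case: (unliftP ord0 i) ai => [j|] ->; last by rewrite a0 eqxx.
by move=> aj; rewrite (IH (fun j => a j.+1) j)// mule0.
Qed.

End Exponential.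

(** * Convergence of Riemann sums *)

Section StepFunction.
Variables (R : realType) (m : nat) (U : finType) (P : pred U) (v : U -> nat -> nat).
Variables (G : U -> R) (c s : R).
Hypothesis s0 : 0 < s.

(** The coordinate of index 0 of [u] is dropped, since the sum of the
    coordinates determines it. *)
Definition lattice_cube (u : nat -> nat) : set (Rn R m) :=
  box m (fun i => `[((u i.+1)%:R - c) / s, ((u i.+1).+1%:R - c) / s[%classic).

Definition step_function (w : Rn R m) : R :=
  \sum_(x | P x) G x * \1_(lattice_cube (v x)) w.

Lemma measurable_lattice_cube u : measurable (lattice_cube u).
Proof. exact: measurable_box. Qed.

Lemma lebesgue_lattice_cube u : lebesgueRn R m (lattice_cube u) = ((s ^- m)%:E)%E.
Proof.
rewrite lebesgueRn_box// (eq_bigr (fun=> (s^-1)%:E)).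
  rewrite -exprVn; elim: (m) => [|k IH]; first by rewrite big_ord0 expr0.
  by rewrite big_ord_recl IH exprS EFinM.
move=> i _; rewrite lebesgue_measure_itv /= lte_fin ltr_pM2r ?invr_gt0//.
rewrite ltrD2r ltr_nat ltnSn -EFinB; congr (_%:E).
by rewrite -mulrBl opprB addrACA -natr1; field; rewrite gt_eqF.
Qed.

Lemma measurable_step_function : measurable_fun setT step_function.
Proof.
rewrite (_ : step_function = fun w => \sum_(x <- [seq x <- index_enum U | P x]) G x * \1_(lattice_cube (v x)) w).
  apply: measurable_sum => x; apply: measurable_funM => //.
  exact: measurable_indic (measurable_lattice_cube _).
by apply/funext => w; rewrite big_filter.
Qed.

Lemma integral_step_function :
  (\int[lebesgueRn R m]_w (step_function w)%:E)%E = ((\sum_(x | P x) G x) * s ^- m)%:E.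
Proof.
have ii x : (lebesgueRn R m).-integrable setT (fun w => (\1_(lattice_cube (v x)) w)%:E).
  apply/integrableP; split.
    by apply/measurable_EFinP; exact: measurable_indic (measurable_lattice_cube _).
  rewrite (eq_integral (fun w => (\1_(lattice_cube (v x)) w)%:E)).
    rewrite integral_indic ?setIT ?lebesgue_lattice_cube ?ltry//.
    exact: measurable_lattice_cube.
  by move=> w _; rewrite gee0_abs// lee_fin.
transitivity (\int[lebesgueRn R m]_w (\sum_(x <- index_enum U | P x) (G x)%:E * (\1_(lattice_cube (v x)) w)%:E))%E.
  apply: eq_integral => w _; rewrite /step_function -sumEFin.
  by apply: eq_bigr => x _; rewrite EFinM.
rewrite integral_sum//; last by move=> x; exact: integrableZl.
rewrite mulr_suml -sumEFin; apply: eq_bigr => x _.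
rewrite integralZl// integral_indic ?setIT ?lebesgue_lattice_cube ?EFinM//.
exact: measurable_lattice_cube.
Qed.

Lemma lattice_cube_inj (u u' : nat -> nat) w : lattice_cube u w -> lattice_cube u' w ->
  forall i, (i < m)%N -> u i.+1 = u' i.+1.
Proof.
move=> h h' i im.
have := h (Ordinal im); have := h' (Ordinal im); rewrite /= !in_itv /=.
rewrite !ler_pdivrMr// !ltr_pdivlMr// => /andP[a b] /andP[a' b'].
have : (u' i.+1)%:R < (u i.+1).+1%:R :> R by lra.
have : (u i.+1)%:R < (u' i.+1).+1%:R :> R by lra.
by rewrite !ltr_nat; lia.
Qed.

Hypothesis v_inj : forall x y, P x -> P y -> (forall i, (i < m)%N -> v x i.+1 = v y i.+1) -> x = y.

Lemma step_function_in x w : P x -> lattice_cube (v x) w -> step_function w = G x.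
Proof.
move=> Px xw; rewrite /step_function (bigD1 x)//= indicE mem_set// mulr1 big1 ?addr0// => y /andP[Py yx].
rewrite indicE memNset ?mulr0// => yw; move/eqP: yx; apply; apply: v_inj => //.
exact: lattice_cube_inj yw xw.
Qed.

Lemma step_function_out w : (forall x, P x -> ~ lattice_cube (v x) w) -> step_function w = 0.
Proof.
by move=> h; rewrite /step_function big1// => y Py; rewrite indicE memNset ?mulr0//; exact: h.
Qed.

Lemma lattice_cube_close u w (i : 'I_m) : lattice_cube u w ->
  `|((u i.+1)%:R - c) / s - tnth w i| <= s^-1.
Proof.
move=> /(_ i); rewrite /= in_itv /= => /andP[a b].
rewrite ler_norml; apply/andP; split; last first.
  by rewrite lerBlDr (le_trans a)// lerDr invr_ge0 ltW.
have e : ((u i.+1).+1%:R - c) / s = ((u i.+1)%:R - c) / s + s^-1.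
  by rewrite -natr1; field; rewrite gt_eqF.
by rewrite e in b; move: b; lra.
Qed.

(** Moving [w] within a cube of side [s^-1 <= 1] changes each coordinate by at
    most 1, which costs a factor [expR a] for each coordinate. *)
Lemma step_function_dominated (C a : R) w : 0 <= C -> 0 < a -> 1 <= s ->
  (forall x, P x -> `|G x| <= C * \prod_(i < m) expR (- (a * `|((v x i.+1)%:R - c) / s|))) ->
  `|step_function w| <= C * expR (a * m%:R) * \prod_(i < m) expR (- (a * `|tnth w i|)).
Proof.
move=> C0 a0 s1 dom.
have [[x [Px xw]]|h] := pselect (exists x, P x /\ lattice_cube (v x) w); last first.
  rewrite step_function_out.
    by rewrite normr0 !mulr_ge0 ?expR_ge0// prodr_ge0// => i _; exact: expR_ge0.
  by move=> x Px xw; apply: h; exists x.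
rewrite (step_function_in Px xw); apply: le_trans (dom _ Px) _.
rewrite -mulrA ler_wpM2l//.
have -> : expR (a * m%:R) = \prod_(i < m) expR a.
  by rewrite prodr_const card_ord -expRM_natr.
rewrite -big_split /=; apply: ler_prod => i _; rewrite expR_ge0/= -expRD ler_expR.
have h1 := lattice_cube_close i xw.
have h2 : s^-1 <= 1 by rewrite invf_le1.
have h3 : `|tnth w i : R| <= `|((v x i.+1)%:R - c) / s| + 1.
  rewrite -[X in `|X|](subrK (((v x i.+1)%:R - c) / s)) addrC.
  apply: (le_trans (ler_normD _ _)); rewrite lerD2l distrC.
  exact: le_trans h1 h2.
by rewrite -subr_ge0; nra.
Qed.
End StepFunction.

Section RiemannSum.
Variables (R : realType) (m : nat) (U : nat -> finType) (P : forall n, pred (U n)).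
Variables (v : forall n, U n -> nat -> nat) (G : forall n, U n -> R) (c s : nat -> R).
Variables (phi : Rn R m -> R) (C a : R) (n0 : nat).
Hypothesis s1 : forall n, (n0 <= n)%N -> 1 <= s n.
Hypothesis v_inj : forall n, (n0 <= n)%N -> forall x y, P x -> P y ->
  (forall i, (i < m)%N -> @v n x i.+1 = v y i.+1) -> x = y.
Hypothesis C0 : 0 <= C.
Hypothesis a0 : 0 < a.
Hypothesis dom : forall n, (n0 <= n)%N -> forall x : U n, P x ->
  `|G x| <= C * \prod_(i < m) expR (- (a * `|((v x i.+1)%:R - c n) / s n|)).
Hypothesis mphi : measurable_fun setT phi.
Hypothesis cvg_phi : {ae lebesgueRn R m, forall w,
  (fun n => step_function (@P n) (@v n) (@G n) (c n) (s n) w) @ \oo --> phi w}.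

(** The sums are the integrals of the step functions, which have a common
    integrable majorant, a product of exponentials of [- a * |x|]. *)
Theorem riemann_sum : (lebesgueRn R m).-integrable setT (EFin \o phi) /\
  (fun n => (\sum_(x | P x) @G n x) * s n ^- m) @ \oo --> \int[lebesgueRn R m]_w phi w.
Proof.
pose f (n : nat) (w : Rn R m) := (step_function (@P (n + n0)%N) (@v _) (@G _) (c (n + n0)%N) (s (n + n0)%N) w)%:E.
pose g (w : Rn R m) := (C * expR (a * m%:R) * \prod_(i < m) expR (- (a * `|tnth w i|)))%:E.
have ig : (lebesgueRn R m).-integrable setT g.
  rewrite /g; under eq_fun do rewrite EFinM.
  apply: integrableZl => //; apply/integrableP; split.
    apply/measurable_EFinP; apply: measurable_prod => i _.
    by apply: (measurableT_comp (measurable_expabs a)); exact: measurable_tnth.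
  rewrite (eq_integral (fun w : Rn R m => (\prod_(i < m) expR (- (a * `|tnth w i|)))%:E)).
    rewrite (lebesgueRn_prod m (measurable_expabs a) _ (integral_expabs a0)) ?ltry//.
  by move=> w _; rewrite gee0_abs// lee_fin prodr_ge0// => i _; exact: expR_ge0.
have [] := @dominated_convergence _ _ _ (lebesgueRn R m) setT measurableT f (EFin \o phi) g.
- move=> n; apply/measurable_EFinP; exact: measurable_step_function.
- exact/measurable_EFinP.
- apply: filterS cvg_phi => w cw _; apply/cvg_EFin; first by near=> n.
  have := cw; rewrite -(cvg_shiftn n0); exact.
- exact: ig.
- apply/aeW => w n _; rewrite /f /g abse_EFin lee_fin.
  apply: step_function_dominated => //.
  + by rewrite (lt_le_trans ltr01)// s1// leq_addl.
  + by move=> x y; apply: v_inj; rewrite leq_addl.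
  + by rewrite s1// leq_addl.
  + by move=> x; apply: dom; rewrite leq_addl.
move=> iphi _ cv; split=> //.
rewrite -(cvg_shiftn n0).
have -> : (fun n => (\sum_(x | P x) @G (n + n0)%N x) * s (n + n0)%N ^- m) =
    (fun n => fine (\int[lebesgueRn R m]_w f n w)%E).
  apply/funext => n; rewrite integral_step_function//.
  by rewrite (lt_le_trans ltr01)// s1// leq_addl.
apply: fine_cvg; rewrite fineK//.
exact: integrable_fin_num.
Unshelve. all: by end_near.
Qed.

End RiemannSum.

(** * Coordinates of a partition in the hook *)

Section HookCoord.
Local Open Scope nat_scope.
Variables (k l n : nat).
Implicit Types lam mu : intpart n.

Definition hook_coord lam i : nat :=
  if i < k then arm k l (rows lam) i else leg n k l (rows lam) (i - k).

(** The diagram contains the rectangle of [k] rows and [l] columns. *)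
Definition hook_rect lam : bool :=
  (lam \in hook_parts k l n) && ((k == 0) || (l <= part lam k)).

Lemma hook_rectP lam : reflect (on_boundary (rows lam) k l) (hook_rect lam).
Proof.
rewrite /hook_rect inE; apply: (iffP andP) => [[h1 h2]|[h1 h2]]; split=> //.
- move=> i ik; case/orP: h2 => [/eqP k0|]; first by rewrite k0 in ik.
  move=> /leq_trans; apply; have := shape_leq (part_shape lam) (_ : i <= k.-1).
  by rewrite prednK; [apply; lia|lia].
- by case: (posnP k) => //= k0; have := h1 k.-1; rewrite prednK//; apply.
Qed.

Lemma sum_hook_coord lam : k <= n -> hook_rect lam ->
  \sum_(i < k + l) hook_coord lam i + k * l = n + 'C(k, 2) + 'C(l, 2).
Proof.
move=> kn /hook_rectP b; rewrite big_split_ord /= -[n in RHS](part_sum lam).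
rewrite -(sum_arm_leg (part_shape lam) kn b); congr (_ + _ + _); apply: eq_bigr => i _.
  by rewrite /hook_coord /= ltn_ord.
by rewrite /hook_coord /= ltnNge leq_addr /= addKn.
Qed.

Lemma hook_coord_inj lam mu : hook_rect lam -> hook_rect mu ->
  (forall i, i < k + l -> hook_coord lam i = hook_coord mu i) -> lam = mu.
Proof.
move=> /hook_rectP b1 /hook_rectP b2 e; apply: (arm_leg_inj b1 b2) => [i ik|j jl].
  by have := e i (ltn_addr _ ik); rewrite /hook_coord ik.
have := e (k + j); rewrite /hook_coord ltn_add2l => /(_ jl).
by rewrite ltnNge leq_addr /= addKn.
Qed.

Lemma exists_hook_coord (u : nat -> nat) : k <= n ->
  (forall i j, i < j < k -> u j < u i) -> (forall i j, i < j < l -> u (k + j) < u (k + i)) ->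
  \sum_(i < k + l) u i + k * l = n + 'C(k, 2) + 'C(l, 2) ->
  exists2 lam, hook_rect lam & forall i, i < k + l -> hook_coord lam i = u i.
Proof.
move=> kn h1 h2; rewrite big_split_ord /= => e.
have [lam [b ea el]] := intpart_of_arm_leg (b := fun j => u (k + j)) kn h1 h2 e.
exists lam; first exact/hook_rectP.
move=> i ikl; rewrite /hook_coord; case: ltnP => ik; first exact: ea.
by rewrite el ?subnKC//; lia.
Qed.

Lemma hook_coord_row lam i : hook_rect lam -> i < k ->
  hook_coord lam i + l = part lam i.+1 + (k.-1 - i).
Proof. by move=> /hook_rectP[b _] ik; rewrite /hook_coord ik /arm; have := b _ ik; lia. Qed.

Lemma hook_coord_col lam j : hook_rect lam -> j < l ->
  hook_coord lam (k + j) + k = cpart lam j.+1 + (l.-1 - j).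
Proof.
move=> /hook_rectP[b _] jl; rewrite /hook_coord ltnNge leq_addr /= addKn /leg cpartE.
have : k <= conj_part n (rows lam) j; last lia.
by apply: conj_part_ge => [|i ik]; [exact: part_shape|exact: leq_trans jl (b _ ik)].
Qed.

End HookCoord.

Section Profile.
Variables (R : realType) (k l : nat).

Definition pair_prod r (q : R) : R := \prod_(i < r) \prod_(j < r | (i < j)%N) q.

Lemma vdm_affine r (x : 'I_r -> R) c q : vdm (fun i => (x i - c) / q) = vdm x / pair_prod r q.
Proof.
rewrite /vdm /pair_prod -prodf_div; apply: eq_bigr => i _.
by rewrite -prodf_div; apply: eq_bigr => j _; rewrite -mulrBl; congr (_ / _); ring.
Qed.

Lemma pair_prod_gt0 r q : 0 < q -> 0 < pair_prod r q.
Proof. by move=> q0; rewrite prodr_gt0// => i _; rewrite prodr_gt0. Qed.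

Definition mean_part n : nat := (n %/ (k + l))%N.
Definition center n : R := n%:R / (k + l)%:R.
Definition coord_sum n : nat := (n + 'C(k, 2) + 'C(l, 2) - k * l)%N.

(** The factor of the number of tableaux that depends on [n] only. The power
    of [mean_part n] comes from the product of all [m ^ u i], because the
    coordinates have sum [coord_sum n]. *)
Definition hook_scale n : R :=
  n`!%:R * ((mean_part n)%:R ^+ mean_part n / (mean_part n)`!%:R) ^+ (k + l) /
  (mean_part n)%:R ^+ coord_sum n *
  (pair_prod k (Num.sqrt n%:R) * pair_prod l (Num.sqrt n%:R)) /
  \prod_(i < k) \prod_(j < l) (2%:R * center n).

(** The factor that depends on the partition, with each coordinate compared to
    [center n] on the scale of [sqrt n]; it has a limit there. *)
Definition hook_profile n (u : nat -> nat) : R :=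
  \prod_(i < k + l) poisson_ratio R (mean_part n) (u i) *
  (vdm (fun i : 'I_k => ((u i)%:R - center n) / Num.sqrt n%:R) *
   vdm (fun j : 'I_l => ((u (k + j)%N)%:R - center n) / Num.sqrt n%:R)) *
  \prod_(i < k) \prod_(j < l) (2%:R * center n / (u i + u (k + j)).+1%:R).

Lemma mean_part_gt0 n : (0 < k + l <= n)%N -> (0 < mean_part n)%N.
Proof. by move=> /andP[d0 dn]; rewrite divn_gt0. Qed.

Lemma hook_scale_gt0 n : (0 < k + l <= n)%N -> 0 < hook_scale n.
Proof.
move=> dn; have m0 := mean_part_gt0 dn; have /andP[d0 nd] := dn.
have n0 : (0 < n)%N by apply: leq_trans nd.
have s0 : 0 < Num.sqrt n%:R :> R by rewrite sqrtr_gt0 ltr0n.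
rewrite /hook_scale !mulr_gt0 ?invr_gt0 ?exprn_gt0 ?pair_prod_gt0 ?divr_gt0 ?exprn_gt0 ?ltr0n ?fact_gt0//.
rewrite prodr_gt0// => i _; rewrite prodr_gt0// => j _.
by rewrite mulr_gt0// divr_gt0// ltr0n.
Qed.

Lemma prod_poisson_ratio r m (u : nat -> nat) : (0 < m)%N ->
  \prod_(i < r) poisson_ratio R m (u i) =
  (m`!%:R / m%:R ^+ m) ^+ r * m%:R ^+ (\sum_(i < r) u i)%N / \prod_(i < r) (u i)`!%:R.
Proof.
move=> m0; rewrite -[r in _ ^+ r]card_ord -prodr_const -prodrXr -big_split -prodf_div.
apply: eq_bigr => i _; rewrite /poisson_ratio /=.
have h3 : (u i)`!%:R != 0 :> R by rewrite pnatr_eq0 -lt0n fact_gt0.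
have h4 : m%:R ^+ m != 0 :> R by rewrite expf_neq0// pnatr_eq0 -lt0n.
move: (m%:R ^+ m) (m`!%:R) (_ ^+ u i) ((u i)`!%:R) h3 h4 => a b c e h3 h4.
by field; rewrite h3 h4.
Qed.

Lemma nb_syt_profile n (lam : intpart n) : (0 < k + l <= n)%N -> hook_rect k l lam ->
  (nb_syt lam)%:R = hook_scale n * hook_profile n (hook_coord k l lam).
Proof.
move=> dn rect; have m0 := mean_part_gt0 dn; have /andP[d0 nd] := dn.
have n0 : (0 < n)%N by apply: leq_trans nd.
have kn : (k <= n)%N by apply: leq_trans nd; exact: leq_addr.
have b := elimT (hook_rectP _ _ _) rect.
rewrite nb_sytE (nsyt_hook R (part_shape lam) (part_sum lam) kn b).
rewrite (@eq_hook_weight _ _ _ (hook_coord k l lam) _ _ (fun j => hook_coord k l lam (k + j))); last 2 first.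
- by move=> i ik; rewrite /hook_coord ik.
- by move=> j jl; rewrite /hook_coord ltnNge leq_addr /= addKn.
set u := hook_coord k l lam.
have eT : (\sum_(i < k + l) u i = coord_sum n)%N.
  by rewrite /coord_sum -(sum_hook_coord kn rect) addnK.
rewrite /hook_profile prod_poisson_ratio// eT /hook_scale /hook_weight.
rewrite (vdm_affine (fun i : 'I_k => (u i)%:R)) (vdm_affine (fun j : 'I_l => (u (k + j)%N)%:R)).
set m := mean_part n in m0 *; set q := Num.sqrt n%:R.
have q0 : 0 < q by rewrite sqrtr_gt0 ltr0n.
have p1 := gt_eqF (pair_prod_gt0 k q0); have p2 := gt_eqF (pair_prod_gt0 l q0).
have -> : \prod_(i < k) \prod_(j < l) (2%:R * center n / (u i + u (k + j)).+1%:R) =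
   \prod_(i < k) \prod_(j < l) (2%:R * center n) / \prod_(i < k) \prod_(j < l) (u i + u (k + j)).+1%:R.
  by rewrite -prodf_div; apply: eq_bigr => i _; rewrite -prodf_div.
rewrite [in RHS]big_split_ord /=.
have n1 := prod_fact_neq0 R k u; have n2 := prod_fact_neq0 R l (fun j => u (k + j)%N).
have n3 := prod_hook_neq0 R k l u (fun j => u (k + j)%N).
have n4 : \prod_(i < k) \prod_(j < l) (2%:R * center n) != 0.
  apply/prodf_neq0 => i _; apply/prodf_neq0 => j _.
  by rewrite gt_eqF// mulr_gt0// divr_gt0 ?ltr0n.
have -> : (m`!%:R / m%:R ^+ m) ^+ (k + l) = ((m%:R ^+ m / m`!%:R) ^+ (k + l))^-1 :> R.
  by rewrite -[RHS]exprVn invf_div.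
have n5 : (m%:R ^+ m / m`!%:R) ^+ (k + l) != 0 :> R.
  by rewrite expf_neq0// gt_eqF// divr_gt0 ?exprn_gt0 ?ltr0n ?fact_gt0.
have n6 : m%:R ^+ coord_sum n != 0 :> R by rewrite expf_neq0// gt_eqF ?ltr0n.
move: (\prod_(i < k) _) (\prod_(i < l) _) (\prod_(i < k) \prod_(j < l) (u i + _).+1%:R) n1 n2 n3 => P1 P2 P3 n1 n2 n3.
move: (\prod_(i < k) \prod_(j < l) _) (_ ^+ (k + l)) (_ ^+ coord_sum n) n4 n5 n6 => P4 P5 P6 n4 n5 n6.
move: (pair_prod k q) (pair_prod l q) (negbT p1) (negbT p2) (vdm _) (vdm _) (n`!%:R) => P7 P8 n7 n8 V W f.
by field; rewrite n1 n2 n3 n4 n5 n6 n7 n8.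
Qed.
End Profile.

(** * Uniform domination of the profile *)

Lemma prod_ord_const (R : realType) r (z : R) : \prod_(i < r) z = z ^+ r.
Proof. by rewrite prodr_const card_ord. Qed.

Lemma norm_vdm_le (R : realType) r (x : 'I_r -> R) (B : R) : 1 <= B -> (forall i j, `|x i - x j| <= B) ->
  `|vdm x| <= B ^+ (r * r).
Proof.
move=> B1 xB; rewrite /vdm normr_prod exprM -(prod_ord_const r (B ^+ r)); apply: ler_prod => i _.
rewrite normr_ge0/= normr_prod -(prod_ord_const r B) big_mkcond.
by apply: ler_prod => j _; case: ifP => ij; rewrite ?normr_ge0 ?ler01 //= ?B1// xB.
Qed.

Section Domination.
Variables (R : realType) (k l : nat).
Local Notation d := (k + l)%N.
Local Notation c n := (center R k l n).
Local Notation m n := (mean_part k l n).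

Lemma center_mean_part n : (0 < d)%N -> (m n)%:R <= c n < (m n)%:R + 1.
Proof.
move=> d0; rewrite /center natr1 ler_pdivlMr ?ltr0n// ltr_pdivrMr ?ltr0n//.
by rewrite -!natrM ler_nat ltr_nat leq_divM /mean_part ltn_ceil.
Qed.

(** The constant comes from [expR (y / (4 K.+1)) >= 1 + y / (4 K.+1)], raised
    to the power [K.+1]. *)
Lemma poly_le_expR K (y : R) : 0 <= y -> (1 + y) ^+ K.+1 <= (4%:R * K.+1%:R) ^+ K.+1 * expR (y / 4%:R).
Proof.
move=> y0; have h := expR_ge1Dx (y / (4%:R * K.+1%:R)).
have K0 : 1 <= K.+1%:R :> R by rewrite ler1n.
have -> : expR (y / 4%:R) = expR (y / (4%:R * K.+1%:R)) ^+ K.+1.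
  rewrite -expRM_natr; congr expR; move: (K.+1%:R) K0 => q q1.
  by field; apply/eqP; lra.
rewrite -exprMn lerXn2r ?nnegrE ?mulr_ge0 ?expR_ge0//; first lra.
apply: (@le_trans _ _ (4%:R * K.+1%:R * (1 + y / (4%:R * K.+1%:R)))).
  rewrite mulrDr mulr1 mulrCA divff ?mulr1 ?lerD2r; first lra.
  by rewrite mulf_neq0// gt_eqF//; lra.
by rewrite ler_pM2l//; lra.
Qed.

Variable n : nat.
Hypothesis dn : (0 < d <= n)%N.
Let s : R := Num.sqrt n%:R.
Let n0 : (0 < n)%N. Proof. by have /andP[d0 h] := dn; apply: leq_trans h. Qed.
Let s1 : 1 <= s. Proof. by rewrite -sqrtr1 ler_sqrt ?ler1n. Qed.
Let s2 : s * s = n%:R. Proof. by rewrite -expr2 sqr_sqrtr. Qed.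

Variable u : nat -> nat.
Let x i : R := ((u i)%:R - c n) / s.
Let Q : R := \prod_(i < d) (1 + `|x i|).

Lemma poisson_dominated i : poisson_ratio R (m n) (u i) <= expR (3%:R / 2%:R - `|x i| / 2%:R).
Proof.
have m0 := mean_part_gt0 dn; have /andP[d0 _] := dn.
apply: le_trans (poisson_ratio_decay _ _ m0) _; rewrite ler_expR.
have /andP[c1 c2] := center_mean_part n d0.
set r := Num.sqrt (m n)%:R.
have r0 : 0 < r by rewrite sqrtr_gt0 ltr0n.
have rs : r <= s by rewrite ler_sqrt ?ler_nat ?leq_div// ler0n.
suff : `|x i| <= `|(u i)%:R - (m n)%:R| / r + 1.
  rewrite invfM mulrCA [in X in _ -> X]mulrC; lra.
rewrite /x normrM (ger0_norm (_ : 0 <= s^-1)) ?invr_ge0 ?sqrtr_ge0//.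
apply: (@le_trans _ _ ((`|(u i)%:R - (m n)%:R| + 1) / s)).
  rewrite ler_pM2r ?invr_gt0//; last lra.
  have -> : (u i)%:R - c n = ((u i)%:R - (m n)%:R) + ((m n)%:R - c n) by ring.
  apply: le_trans (ler_normD _ _) _; rewrite lerD2l ler_norml; lra.
rewrite mulrDl mul1r lerD//; last by rewrite invf_le1//; lra.
by rewrite ler_wpM2l// lef_pV2 ?posrE//; lra.
Qed.

Lemma Q_ge1 : 1 <= Q.
Proof.
rewrite /Q; elim/big_ind: _ => // [a b a1 b1|i _]; first by nra.
by rewrite lerDl.
Qed.

Lemma normx_le_Q i : (i < d)%N -> 1 + `|x i| <= Q.
Proof.
move=> id; rewrite /Q (bigD1 (Ordinal id))//= ler_peMr//.
elim/big_ind: _ => // [a b a1 b1|j _]; first by nra.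
by rewrite lerDl.
Qed.

Lemma normxB_le_Q i j : (i < d)%N -> (j < d)%N -> `|x i - x j| <= Q.
Proof.
move=> id jd; case: (eqVneq i j) => [->|ij].
  by rewrite subrr normr0 (le_trans ler01 Q_ge1).
apply: le_trans (ler_normB _ _) _.
rewrite /Q (bigD1 (Ordinal id))//= (bigD1 (Ordinal jd))/=; last by rewrite -(inj_eq val_inj) eq_sym.
rewrite mulrA; apply: (@le_trans _ _ ((1 + `|x i|) * (1 + `|x j|))).
  by have := normr_ge0 (x i); have := normr_ge0 (x j); nra.
rewrite ler_peMr ?mulr_ge0 ?addr_ge0//.
elim/big_ind: _ => // [a b a1 b1|h _]; first by nra.
by rewrite lerDl.
Qed.

(** If [u i] is at least half of [center n], the factor is at most 4.
    Otherwise the deviation [|x i| * sqrt n] is at least half of [center n],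
    which makes [center n] itself at most a multiple of [|x i|^2]. *)
Lemma hook_factor_dominated i b : (i < d)%N ->
  0 <= 2%:R * c n / (u i + b).+1%:R <= 8%:R * d%:R * Q ^+ 2.
Proof.
move=> id; have /andP[d0 _] := dn.
have d1 : 1 <= d%:R :> R by rewrite ler1n.
have cn : c n * d%:R = n%:R by rewrite /center divfK// pnatr_eq0 -lt0n.
have c0 : 0 <= c n by rewrite divr_ge0.
rewrite divr_ge0 ?mulr_ge0//=.
have xQ := normx_le_Q id; have q1 := Q_ge1.
apply: (@le_trans _ _ (8%:R * d%:R * (1 + `|x i|) ^+ 2)); last first.
  rewrite ler_pM2l ?mulr_gt0 ?ltr0n// lerXn2r ?nnegrE//.
  by lra.
set a : R := (u i)%:R.
have a0 : 0 <= a by rewrite ler0n.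
have den : a + 1 <= (u i + b).+1%:R by rewrite natr1 ler_nat; lia.
have dp : 0 < (u i + b).+1%:R :> R by rewrite ltr0n.
rewrite ler_pdivrMr//.
have x0 := normr_ge0 (x i).
case: (leP (c n / 2%:R) a) => ha.
  apply: (@le_trans _ _ (4%:R * (u i + b).+1%:R)); first lra.
  by rewrite ler_pM2r//; nra.
have hx : c n / 2%:R <= `|x i| * s.
  have -> : `|x i| * s = `|a - c n|.
    rewrite /x normrM normfV (ger0_norm (_ : 0 <= s)) ?sqrtr_ge0// divfK// gt_eqF// (lt_le_trans ltr01 s1)//.
  by rewrite ler0_norm; lra.
have h2 : (c n / 2%:R) ^+ 2 <= `|x i| ^+ 2 * (c n * d%:R).
  by rewrite cn -s2 -expr2 -exprMn lerXn2r ?nnegrE ?mulr_ge0 ?invr_ge0 ?(ltW (lt_le_trans ltr01 s1))//.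
have h3 : c n <= 4%:R * d%:R * `|x i| ^+ 2.
  case: (leP (c n) 0) => c0'; first by rewrite (le_trans c0')// !mulr_ge0// ?exprn_ge0//; lra.
  by rewrite -(ler_pM2l c0'); nra.
have h4 : 2%:R * c n <= 8%:R * d%:R * (1 + `|x i|) ^+ 2 by nra.
apply: le_trans h4 _; rewrite ler_peMr//; last lra.
Qed.

(** Bounds the degree of the polynomial factors of the profile; it is
    positive, as [poly_le_expR] requires. *)
Definition profile_exponent : nat := (k * k + l * l + 2 * (k * l)).+1.
Definition profile_bound : R :=
  expR (3%:R / 2%:R) ^+ d * (8%:R * d%:R) ^+ (k * l) *
  ((4%:R * profile_exponent%:R) ^+ profile_exponent) ^+ d.

(** The Poisson ratios decay like [expR (- |x i| / 2)], the other factors are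
    at most powers of the product of the [1 + |x i|], and half of the decay
    absorbs them. *)
Lemma profile_dominated :
  `|hook_profile R k l n u| <= profile_bound * \prod_(i < d) expR (- (4%:R^-1 * `|x i|)).
Proof.
have q1 := Q_ge1; have q0 : 0 <= Q by lra.
have /andP[d0 _] := dn.
have d1 : 1 <= d%:R :> R by rewrite ler1n.
rewrite /hook_profile !normrM.
have b1 : `|\prod_(i < d) poisson_ratio R (m n) (u i)| <=
    \prod_(i < d) expR (3%:R / 2%:R - `|x i| / 2%:R).
  rewrite normr_prod; apply: ler_prod => i _; rewrite normr_ge0/= ger0_norm.
    exact: poisson_dominated.
  by rewrite ltW// poisson_ratio_gt0// mean_part_gt0.
have b2 : `|vdm (fun i : 'I_k => x i)| <= Q ^+ (k * k).
  by apply: norm_vdm_le => // i j; apply: normxB_le_Q; exact: ltn_addr.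
have b3 : `|vdm (fun j : 'I_l => x (k + j)%N)| <= Q ^+ (l * l).
  by apply: norm_vdm_le => // i j; apply: normxB_le_Q; rewrite ltn_add2l.
have b4 : `|\prod_(i < k) \prod_(j < l) (2%:R * c n / (u i + u (k + j)).+1%:R)| <=
    (8%:R * d%:R * Q ^+ 2) ^+ (k * l).
  rewrite mulnC exprM -(prod_ord_const k) normr_prod; apply: ler_prod => i _.
  rewrite normr_ge0/= normr_prod -(prod_ord_const l); apply: ler_prod => j _.
  have /andP[h1 h2] := hook_factor_dominated (u (k + j)) (ltn_addr l (ltn_ord i)).
  by rewrite normr_ge0/= ger0_norm.
have b5 : Q ^+ profile_exponent <= ((4%:R * profile_exponent%:R) ^+ profile_exponent) ^+ d *
    \prod_(i < d) expR (`|x i| / 4%:R).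
  rewrite -(prod_ord_const d) -big_split /= -prodrXl.
  apply: ler_prod => i _; rewrite exprn_ge0 ?addr_ge0//=.
  exact: poly_le_expR.
have b6 : Q ^+ (k * k) * Q ^+ (l * l) * (Q ^+ 2) ^+ (k * l) <= Q ^+ profile_exponent.
  by rewrite -exprM -!exprD ler_weXn2l// /profile_exponent; lia.
apply: (@le_trans _ _ (\prod_(i < d) expR (3%:R / 2%:R - `|x i| / 2%:R) *
  (Q ^+ (k * k) * Q ^+ (l * l)) * (8%:R * d%:R * Q ^+ 2) ^+ (k * l))).
  by rewrite !ler_pM// ?mulr_ge0.
rewrite exprMn.
set A := \prod_(i < d) expR _; set B := (8%:R * d%:R) ^+ (k * l).
have A0 : 0 <= A by rewrite prodr_ge0// => i _; exact: expR_ge0.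
have B0 : 0 <= B by rewrite exprn_ge0// mulr_ge0//; lra.
rewrite (_ : _ * _ = A * B * (Q ^+ (k * k) * Q ^+ (l * l) * (Q ^+ 2) ^+ (k * l))); last by ring.
apply: (@le_trans _ _ (A * B * (((4%:R * profile_exponent%:R) ^+ profile_exponent) ^+ d *
    \prod_(i < d) expR (`|x i| / 4%:R)))).
  by rewrite ler_wpM2l ?mulr_ge0//; apply: le_trans b6 b5.
have -> : A = expR (3%:R / 2%:R) ^+ d * \prod_(i < d) expR (- (`|x i| / 2%:R)).
  rewrite -(prod_ord_const d) -big_split /=; apply: eq_bigr => i _.
  by rewrite -expRD.
have -> : \prod_(i < d) expR (- (4%:R^-1 * `|x i|)) =
    \prod_(i < d) expR (- (`|x i| / 2%:R)) * \prod_(i < d) expR (`|x i| / 4%:R).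
  by rewrite -big_split /=; apply: eq_bigr => i _; rewrite -expRD; congr expR; field.
by rewrite /profile_bound -/B le_eqVlt; apply/orP; left; apply/eqP; ring.
Qed.

End Domination.

(** * Partitions that miss the rectangle *)

Section Count.
Local Open Scope nat_scope.
Variables (k l n : nat).

(** The first [k] rows and the first [l] columns determine a partition in the
    hook. *)
Lemma card_hook_parts : #|hook_parts k l n| <= n.+1 ^ (k + l).
Proof.
pose f (lam : intpart n) : {ffun 'I_(k + l) -> 'I_n.+1} :=
  [ffun i : 'I_(k + l) => inord (if (i < k) then part lam i.+1 else cpart lam (i - k).+1)].
have cn (lam : intpart n) j : cpart lam j.+1 <= n.
  by rewrite cpartE; apply: conj_part_le; [exact: part_shape|rewrite (proj2 (part_shape lam))].
rewrite -(card_in_imset (f := f)).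
  by apply: leq_trans (max_card _) _; rewrite card_ffun !card_ord.
move=> lam mu; rewrite !inE => h1 h2 /ffunP e.
have s1 := part_shape lam; have s2 := part_shape mu.
apply: intpart_inj => i; case: (ltnP i k) => ik.
    have := e (lshift l (Ordinal ik)); rewrite !ffunE /= ik => /(congr1 val) /=.
    by rewrite !inordK// ltnS part_le.
  apply: ltn_ext => j; case: (ltnP j l) => jl; last first.
    have := leq_trans (shape_leq s1 ik) h1; have := leq_trans (shape_leq s2 ik) h2.
    by rewrite /=; lia.
  rewrite -(conj_part_gt i j s1) -(conj_part_gt i j s2) -!cpartE.
  have := e (rshift k (Ordinal jl)); rewrite !ffunE /= ltnNge leq_addr /= addKn => /(congr1 val) /=.
  by rewrite !inordK ?ltnS ?cn// => ->.
Qed.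
End Count.

Section NonRect.
Variables (R : realType) (k l : nat).
Local Notation d := (k + l)%N.
Local Notation m n := (mean_part k l n).

(** Large enough to bound the Vandermonde products ([k * k + l * l]), the
    change in the power of the mean part ([k * k]) and the hook factors
    ([k * l]). *)
Definition nonrect_exponent : nat := (2 * (k * k) + l * l + k * l)%N.

Lemma hook_weight_le r (a b : nat -> nat) (B : nat) : (0 < B)%N ->
  (forall i, (i < r)%N -> (a i <= B)%N) -> (forall j, (j < l)%N -> (b j <= B)%N) ->
  hook_weight R r a l b <= B%:R ^+ (r * r + l * l) /
    ((\prod_(i < r) (a i)`!%:R) * (\prod_(j < l) (b j)`!%:R)).
Proof.
move=> B0 aB bB; rewrite /hook_weight.
have B1 : 1 <= B%:R :> R by rewrite ler1n.
have dist (x y : nat) : (x <= B)%N -> (y <= B)%N -> `|x%:R - y%:R| <= B%:R :> R.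
  rewrite -!(ler_nat R) => xB yB; rewrite ler_norml.
  by have := ler0n R x; have := ler0n R y; lra.
have v1 := @norm_vdm_le R r (fun i => (a i)%:R) _ B1 (fun i j => dist _ _ (aB i (ltn_ord i)) (aB j (ltn_ord j))).
have v2 := @norm_vdm_le R l (fun i => (b i)%:R) _ B1 (fun i j => dist _ _ (bB i (ltn_ord i)) (bB j (ltn_ord j))).
apply: le_trans (ler_norm _) _; rewrite !normrM exprD.
set F1 := \prod_(i < r) _; set F2 := \prod_(j < l) _.
have f0 N (c : nat -> nat) : 0 < \prod_(i < N) (c i)`!%:R :> R.
  by rewrite prodr_gt0// => i _; rewrite ltr0n fact_gt0.
have F10 : 0 < F1 by exact: f0.
have F20 : 0 < F2 by exact: f0.
apply: ler_pM; rewrite ?mulr_ge0 ?invr_ge0 ?normr_ge0//.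
  exact: ler_pM.
rewrite normfV lef_pV2 ?posrE ?normr_gt0 ?mulf_neq0 ?mulr_gt0 ?gt_eqF//; last first.
  by rewrite prodr_gt0// => i _; rewrite prodr_gt0// => j _; rewrite ltr0n.
rewrite ger0_norm.
  rewrite ler_peMr ?mulr_ge0 ?(ltW F10) ?(ltW F20)//.
  elim/big_ind: _ => // [x y x1 y1|i _]; first by nra.
  by elim/big_ind: _ => // [x y x1 y1|j _]; [nra|rewrite ler1n].
rewrite !mulr_ge0 ?(ltW F10) ?(ltW F20)// prodr_ge0// => i _.
by rewrite prodr_ge0.
Qed.

(** The [l]-th column has a length [r] smaller than [k], and ([r], [l]) is a
    corner on the border, at which the formula for the number of tableaux
    holds. Completing the [r] arms by [k - r] zeros, one compares with
    [hook_scale] up to polynomial factors, while a zero coordinate has a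
    Poisson ratio of order [expR (- sqrt m / 2)]. *)
Lemma nonrect_bound n (lam : intpart n) : (0 < d <= n)%N ->
  lam \in hook_parts k l n -> ~~ hook_rect k l lam ->
  (nb_syt lam)%:R <= hook_scale R k l n *
   (expR 1 ^+ d * (4%:R * n%:R) ^+ nonrect_exponent * expR (- (Num.sqrt (m n)%:R / 2%:R))).
Proof.
move=> dn lamH nrect; have m0 := mean_part_gt0 dn; have /andP[d0 nd] := dn.
have n0 : (0 < n)%N by apply: leq_trans nd.
have sr := part_shape lam.
move: nrect; rewrite /hook_rect lamH /= negb_or -ltnNge => /andP[kN0 kl].
have k0 : (0 < k)%N by rewrite lt0n.
set r := conj_part n (rows lam) l.-1.
have rk : (r < k)%N.
  rewrite -(prednK k0) ltnS; apply: conj_part_le => //; rewrite prednK//; lia.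
have bnd : on_boundary (rows lam) r l.
  split=> [i ir|].
    by have := ir; rewrite conj_part_gt//; lia.
  by rewrite (leq_trans _ (leq_pred l))// leqNgt -(conj_part_gt r l.-1 sr) -/r ltnn.
have kn : (k <= n)%N by apply: leq_trans nd; exact: leq_addr.
have rn : (r <= n)%N by apply: leq_trans kn; exact: ltnW.
rewrite nb_sytE (nsyt_hook R sr (part_sum lam) rn bnd).
set a := arm r l _; set b := leg n r l _.
have aB i : (i < r)%N -> (a i <= n + d)%N.
  by move=> ir; rewrite /a /arm; have := part_le lam i.+1; lia.
have bB j : (j < l)%N -> (b j <= n + d)%N.
  move=> jl; rewrite /b /leg; have : (conj_part n (rows lam) j <= n)%N; last lia.
  by apply: conj_part_le => //; rewrite (proj2 sr).
have hw := @hook_weight_le r a b (n + d) _ aB bB.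
(* The r arms, completed by zeros to k coordinates, and then the l legs. *)
pose u i := if (i < r)%N then a i else if (i < k)%N then 0%N else b (i - k)%N.
have uE1 (F : nat -> R) : F 0%N = 1 ->
    \prod_(i < d) F (u i) = \prod_(i < r) F (a i) * \prod_(j < l) F (b j).
  move=> F0; rewrite big_split_ord /=; congr (_ * _).
    rewrite [RHS](big_ord_widen _ (fun i => F (a i)) (ltnW rk)) [RHS]big_mkcond.
    by apply: eq_bigr => i _; rewrite /u ltn_ord; case: ifP.
  apply: eq_bigr => j _; rewrite /u addKn ltnNge (leq_trans (ltnW rk)) ?leq_addr//=.
  by rewrite ltnNge leq_addr.
have uS : (\sum_(i < d) u i = \sum_(i < r) a i + \sum_(j < l) b j)%N.
  rewrite big_split_ord /=; congr (_ + _)%N.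
    rewrite [RHS](big_ord_widen _ _ (ltnW rk)) [RHS]big_mkcond.
    by apply: eq_bigr => i _; rewrite /u ltn_ord; case: ifP.
  apply: eq_bigr => j _; rewrite /u addKn ltnNge (leq_trans (ltnW rk)) ?leq_addr//=.
  by rewrite ltnNge leq_addr.
have sE := sum_arm_leg sr rn bnd; rewrite (part_sum lam) -/a -/b -uS in sE.
set T := (\sum_(i < d) u i)%N in sE uS *.
have TT : (coord_sum k l n <= T + k * k)%N.
  have : ('C(k, 2) <= k * k)%N by rewrite bin2 leq_half_double; nia.
  have : (r * l <= k * l)%N by rewrite leq_mul2r ltnW ?orbT.
  by rewrite /coord_sum; lia.
set s := Num.sqrt n%:R : R.
set q : R := 4%:R * n%:R.
set E := expR _ ^+ d; set Ex := expR (- _).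
have n1 : 1 <= n%:R :> R by rewrite ler1n.
have s1 : 1 <= s by rewrite -sqrtr1 ler_sqrt ?ler1n.
have q1 : 1 <= q by rewrite /q; lra.
have q0 : 0 < q by lra.
have mR : 1 <= (m n)%:R :> R by rewrite ler1n.
have mn : (m n)%:R <= q by rewrite /q -natrM ler_nat; have := leq_div n d; rewrite /mean_part; lia.
have ndq : (n + d)%:R <= q by rewrite /q -natrM ler_nat; clear -nd; lia.
have pois : \prod_(i < d) poisson_ratio R (m n) (u i) <= E * Ex.
  have rd : (r < d)%N by apply: leq_trans rk (leq_addr _ _).
  rewrite /E -(prod_ord_const d) (_ : Ex = \prod_(i < d) (if i == Ordinal rd then Ex else 1)); last first.
    by rewrite (bigD1 (Ordinal rd))//= eqxx big1 ?mulr1// => i /negbTE ->.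
  rewrite -big_split /=; apply: ler_prod => i _.
  rewrite ltW ?poisson_ratio_gt0//=; apply: le_trans (poisson_ratio_decay _ _ m0) _.
  case: eqVneq => [->|_]; last by rewrite mulr1 ler_expR lerBlDr lerDl divr_ge0 ?mulr_ge0 ?sqrtr_ge0.
  rewrite -expRD ler_expR /u /= ltnn rk sub0r normrN ger0_norm ?ler0n// lerD2l lerN2.
  set t := Num.sqrt (m n)%:R.
  have t0 : 0 < t by rewrite sqrtr_gt0 ltr0n.
  have -> : (m n)%:R = t ^+ 2 :> R by rewrite sqr_sqrtr// ler0n.
  by rewrite le_eqVlt; apply/orP; left; apply/eqP; field; rewrite gt_eqF.
have pE := @prod_poisson_ratio R d (m n) u m0.
rewrite (uE1 (fun v => v`!%:R)) // -/T in pE.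
have hw' := hw (ltn_addr _ n0).
rewrite /hook_scale -/s -!mulrA ler_pM2l ?ltr0n ?fact_gt0//.
apply: le_trans hw' _.
set F := (\prod_(i < r) _) * _ in pE *.
have F0 : F != 0 by rewrite mulf_neq0// prod_fact_neq0.
set X := (_ / _) ^+ d.
have X0 : 0 < X by rewrite exprn_gt0// divr_gt0 ?exprn_gt0 ?ltr0n ?fact_gt0.
have XE : ((m n)`!%:R / (m n)%:R ^+ m n) ^+ d = X^-1 :> R by rewrite /X -[RHS]exprVn invf_div.
rewrite XE in pE.
set M := (m n)%:R ^+ T in pE.
have M0 : 0 < M by rewrite exprn_gt0 ?ltr0n.
have FE : F^-1 = (\prod_(i < d) poisson_ratio R (m n) (u i)) * X / M.
  by rewrite pE; field; rewrite F0 gt_eqF//= gt_eqF.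
rewrite FE.
set Mn := (m n)%:R ^+ coord_sum k l n.
have Mn0 : 0 < Mn by rewrite exprn_gt0 ?ltr0n.
set pk := pair_prod k s; set pl := pair_prod l s.
have pp1 N : 1 <= pair_prod N s.
  rewrite /pair_prod; elim/big_ind: _ => // [x y x1 y1|i _]; first by nra.
  by elim/big_ind: _ => // [x y x1 y1]; first by nra.
set P4 := \prod_(i < k) _.
have c0 : 0 < 2%:R * center R k l n by rewrite mulr_gt0 ?divr_gt0 ?ltr0n.
have P40 : 0 < P4 by rewrite prodr_gt0// => i _; rewrite prodr_gt0.
have P4q : P4 <= q ^+ (k * l).
  rewrite mulnC exprM -(prod_ord_const k); apply: ler_prod => i _.
  rewrite ltW ?prodr_gt0//= -(prod_ord_const l); apply: ler_prod => j _.
  rewrite ltW//= /q /center; apply: (@le_trans _ _ (2%:R * n%:R)); last lra.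
  by rewrite ler_pM2l// ler_pdivrMr ?ltr0n// ler_peMr// ler1n.
have MnM : Mn <= M * q ^+ (k * k).
  apply: (@le_trans _ _ ((m n)%:R ^+ (T + k * k))); first by rewrite ler_weXn2l.
  by rewrite exprD ler_pM2l// lerXn2r ?nnegrE ?(ltW q0).
have Bq : (n + d)%:R ^+ (r * r + l * l) <= q ^+ (k * k + l * l).
  apply: (@le_trans _ _ (q ^+ (r * r + l * l))).
    by rewrite lerXn2r ?nnegrE ?(ltW q0) ?ler0n.
  by rewrite ler_weXn2l// leq_add2r leq_mul// ltnW.
(* All polynomial factors together cost a power of q, where q = 4 n. *)
have main : (n + d)%:R ^+ (r * r + l * l) * (Mn * P4) <= M * q ^+ nonrect_exponent.
  have -> : M * q ^+ nonrect_exponent = q ^+ (k * k + l * l) * (M * q ^+ (k * k) * q ^+ (k * l)).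
    rewrite (_ : nonrect_exponent = (k * k + l * l + (k * k + k * l))%N) ?exprD; first by ring.
    by rewrite /nonrect_exponent; clear; lia.
  by rewrite !ler_pM ?mulr_ge0 ?exprn_ge0 ?ler0n ?(ltW Mn0) ?(ltW P40).
have pois0 : 0 <= \prod_(i < d) poisson_ratio R (m n) (u i).
  by rewrite prodr_ge0// => i _; rewrite ltW// poisson_ratio_gt0.
set Po := \prod_(i < d) _ in pois pois0 *.
set B := _ ^+ (r * r + l * l) in Bq main *.
have B0 : 0 <= B by rewrite exprn_ge0 ?ler0n.
have EE0 : 0 <= E * Ex by apply: le_trans pois.
have X1 := mulr_ge0 (ltW X0) EE0.
apply: (@le_trans _ _ (X * (E * Ex) * (B / M))).
  rewrite (_ : B * (Po * X / M) = X * Po * (B / M)); last by ring.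
  by apply: ler_wpM2r; [rewrite divr_ge0// ltW|rewrite ler_pM2l].
apply: (@le_trans _ _ (X * (E * Ex) * (q ^+ nonrect_exponent / (Mn * P4)))).
  rewrite ler_wpM2l// ler_pdivrMr// mulrAC ler_pdivlMr ?mulr_gt0//.
  by rewrite [leRHS]mulrC.
set qK := q ^+ _.
have -> : X * (Mn^-1 * (pk * (pl * (P4^-1 * (E * (qK * Ex)))))) =
   X * (E * Ex) * (qK / (Mn * P4)) * (pk * pl).
  by field; rewrite !gt_eqF.
rewrite ler_peMr//; last by have := pp1 k; have := pp1 l; rewrite -/pk -/pl; nra.
by rewrite mulr_ge0// divr_ge0 ?exprn_ge0 ?mulr_ge0// ltW.
Qed.
End NonRect.

(** * Negligible partitions *)

Section Limits.
Variable R : realType.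

(** Half of the exponential absorbs the power, by [poly_le_expR] applied to a
    multiple of [sqrt n]. *)
Lemma poly_expR_sqrt (P : nat) (g : R) : 0 < g -> exists2 C : R, 0 < C &
  forall n : nat, (4%:R * n%:R) ^+ P * expR (- (g * Num.sqrt n%:R)) <= C * expR (- (g / 2%:R * Num.sqrt n%:R)).
Proof.
move=> g0; exists ((4%:R * (2 * P).+1%:R) ^+ (2 * P).+1 / g ^+ (2 * P)).
  by rewrite divr_gt0 ?exprn_gt0// mulr_gt0.
move=> n; set s := Num.sqrt n%:R.
have s0 : 0 <= s by exact: sqrtr_ge0.
have s2 : n%:R = s ^+ 2 by rewrite sqr_sqrtr.
pose y := 2%:R * g * s.
have y0 : 0 <= y by rewrite !mulr_ge0// ltW.
have -> : expR (- (g / 2%:R * s)) = expR (y / 4%:R) * expR (- (g * s)).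
  by rewrite -expRD; congr expR; rewrite /y; field.
rewrite mulrA ler_wpM2r ?expR_ge0// mulrAC.
apply: (@le_trans _ _ ((1 + y) ^+ (2 * P).+1 / g ^+ (2 * P))); last first.
  by rewrite ler_pM2r ?invr_gt0 ?exprn_gt0//; exact: poly_le_expR.
rewrite ler_pdivlMr ?exprn_gt0// s2.
have -> : (4%:R * s ^+ 2) ^+ P * g ^+ (2 * P) = y ^+ (2 * P).
  by rewrite !exprM -exprMn; congr (_ ^+ P); rewrite /y; ring.
rewrite exprS; apply: (@le_trans _ _ ((1 + y) ^+ (2 * P))).
  by rewrite lerXn2r ?nnegrE ?addr_ge0// lerDr.
by rewrite ler_peMl ?exprn_ge0 ?addr_ge0// lerDl.
Qed.

Lemma cvgn_expR_sqrt (g : R) : 0 < g -> (fun n => expR (- (g * Num.sqrt n%:R))) @ \oo --> (0 : R).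
Proof.
move=> g0; apply: (@squeeze_cvgr _ _ _ _ (fun=> 0) (fun n => g^-1 * (Num.sqrt n%:R)^-1)).
- near=> n; rewrite expR_ge0/= expRN -invfM lef_pV2 ?posrE ?expR_gt0//.
    by apply: le_trans (expR_ge1Dx _); rewrite lerDr.
  by rewrite mulr_gt0// sqrtr_gt0 ltr0n; near: n; exists 1%N.
- exact: cvg_cst.
- by rewrite -[X in _ --> X](mulr0 g^-1); apply: cvgMr; exact: cvgn_sqrtV.
Unshelve. all: by end_near.
Qed.

Lemma cvgn_poly_expR (P : nat) (g : R) : 0 < g ->
  (fun n => (4%:R * n%:R) ^+ P * expR (- (g * Num.sqrt n%:R))) @ \oo --> (0 : R).
Proof.
move=> g0; have [C C0 h] := poly_expR_sqrt P g0.
apply: (@squeeze_cvgr _ _ _ _ (fun=> 0) (fun n => C * expR (- (g / 2%:R * Num.sqrt n%:R)))).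
- by near=> n; rewrite h andbT mulr_ge0 ?expR_ge0 ?exprn_ge0 ?mulr_ge0.
- exact: cvg_cst.
- by rewrite -[X in _ --> X](mulr0 C); apply: cvgMr; apply: cvgn_expR_sqrt; rewrite divr_gt0.
Unshelve. all: by end_near.
Qed.

Section Negligible.
Variables (k l : nat).
Local Notation d := (k + l)%N.
Local Notation m n := (mean_part k l n).
Local Notation c n := (center R k l n).
Hypothesis d0 : (0 < d)%N.

Lemma mean_part_ge n : (d <= n)%N -> n%:R / (2%:R * d%:R) <= (m n)%:R :> R.
Proof.
move=> dn; rewrite ler_pdivrMr ?mulr_gt0 ?ltr0n// -!natrM ler_nat.
have := mean_part_gt0 (_ : (0 < d <= n)%N); rewrite d0 dn => /(_ isT).
rewrite /mean_part; have := ltn_ceil n d0; set q := (n %/ d)%N.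
by rewrite mulSn; nia.
Qed.

(** The mean part is at least [n / (2 d)], so its square root is at least this
    multiple of [sqrt n]. *)
Definition root_gap : R := Num.sqrt ((2%:R * d%:R)^-1).

Lemma root_gap_gt0 : 0 < root_gap.
Proof. by rewrite sqrtr_gt0 invr_gt0 mulr_gt0 ?ltr0n. Qed.

Lemma sqrt_mean_part_ge n : (d <= n)%N -> root_gap * Num.sqrt n%:R <= Num.sqrt (m n)%:R.
Proof.
move=> dn; rewrite /root_gap -sqrtrM ?invr_ge0 ?mulr_ge0// mulrC ler_sqrt ?ler0n//.
exact: mean_part_ge.
Qed.

Variable beta : R.
Hypothesis beta0 : 0 < beta.

(** There are polynomially many partitions in the hook, and each of those that
    miss the rectangle contributes an exponentially small amount. *)
Lemma nonrect_negligible (h : forall n, intpart n -> R) (B : R) : 0 <= B ->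
  (forall n (lam : intpart n), lam \in hook_parts k l n -> 0 <= h n lam <= B) ->
  (fun n => (\sum_(lam in hook_parts k l n | ~~ hook_rect k l lam)
       h n lam * (nb_syt lam)%:R `^ beta) /
     (hook_scale R k l n `^ beta * Num.sqrt n%:R ^+ d.-1)) @ \oo --> (0 : R).
Proof.
move=> B0 hB.
have g0 := root_gap_gt0; set g := root_gap in g0.
have g2 : 0 < g / 2%:R by rewrite divr_gt0.
have [C C0 hC] := poly_expR_sqrt (nonrect_exponent k l) g2.
pose Y n : R := expR 1 ^+ d * C * expR (- (g / 2%:R / 2%:R * Num.sqrt n%:R)).
have Y0 n : 0 <= Y n by rewrite !mulr_ge0 ?exprn_ge0 ?expR_ge0 ?ltW.
pose D : R := B * (expR 1 ^+ d * C) `^ beta.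
apply: (@squeeze_cvgr _ _ _ _ (fun=> 0)
   (fun n => D * ((4%:R * n%:R) ^+ d * expR (- (g / 2%:R / 2%:R * beta * Num.sqrt n%:R))))).
- near=> n.
  have dn : (d <= n)%N by near: n; exists d.
  have dn' : (0 < d <= n)%N by rewrite d0.
  have A0 := hook_scale_gt0 R dn'.
  have n0 : (0 < n)%N by apply: (leq_trans d0 dn).
  have s1 : 1 <= Num.sqrt n%:R :> R by rewrite -[X in X <= _]sqrtr1 ler_sqrt ?ler0n // ler1n.
  have Ab : 0 < hook_scale R k l n `^ beta by rewrite powR_gt0.
  have fY (lam : intpart n) : lam \in hook_parts k l n -> ~~ hook_rect k l lam ->
      (nb_syt lam)%:R `^ beta <= hook_scale R k l n `^ beta * Y n `^ beta.
    move=> lH lr; rewrite -powRM ?(ltW A0)//; apply: ge0_ler_powR; rewrite ?nnegrE ?(ltW beta0)//.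
      by rewrite mulr_ge0// ltW.
    apply: le_trans (nonrect_bound R dn' lH lr) _; rewrite ler_pM2l// /Y -[X in X <= _]mulrA -[X in _ <= X]mulrA.
    rewrite ler_pM2l ?exprn_gt0 ?expR_gt0//.
    apply: le_trans (hC n); rewrite ler_wpM2l ?exprn_ge0 ?mulr_ge0// ler_expR lerN2.
    by rewrite mulrAC ler_pM2r// sqrt_mean_part_ge.
  apply/andP; split.
    rewrite divr_ge0 ?mulr_ge0 ?powR_ge0 ?exprn_ge0 ?sqrtr_ge0// sumr_ge0// => lam /andP[lH _].
    by rewrite mulr_ge0 ?powR_ge0//; have /andP[] := hB n lam lH.
  rewrite ler_pdivrMr; last by rewrite mulr_gt0 ?exprn_gt0//; lra.
  apply: (@le_trans _ _ (\sum_(lam in hook_parts k l n) B * (hook_scale R k l n `^ beta * Y n `^ beta))).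
    rewrite big_mkcondr; apply: ler_sum => lam lH; case: ifP => lr.
      have /andP[h0 hb] := hB n lam lH.
      by rewrite ler_pM ?powR_ge0// fY.
    by rewrite !mulr_ge0 ?powR_ge0.
  rewrite sumr_const -[_ *+ _]mulr_natl.
  have cardle : #|hook_parts k l n|%:R <= (4%:R * n%:R) ^+ d :> R.
    rewrite -natrM -natrX ler_nat; apply: leq_trans (card_hook_parts k l n) _.
    by rewrite leq_exp2r//; lia.
  have YE : Y n `^ beta = (expR 1 ^+ d * C) `^ beta * expR (- (g / 2%:R / 2%:R * beta * Num.sqrt n%:R)).
    rewrite /Y powRM ?expR_ge0 ?mulr_ge0 ?exprn_ge0 ?expR_ge0 ?(ltW C0)// -expRM.
    by congr (_ * expR _); ring.
  rewrite YE /D; set Ex := expR (- _); set Ab' := hook_scale _ _ _ _ `^ _; set E := _ `^ beta.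
  have E0 : 0 <= E by exact: powR_ge0.
  have sn1 : 1 <= Num.sqrt n%:R ^+ d.-1 :> R by exact: exprn_ege1.
  have T0 : 0 <= B * (Ab' * (E * Ex)) by rewrite !mulr_ge0 ?powR_ge0 ?expR_ge0.
  apply: (@le_trans _ _ ((4%:R * n%:R) ^+ d * (B * (Ab' * (E * Ex))))).
    by rewrite ler_wpM2r.
  rewrite (_ : B * E * _ * _ = ((4%:R * n%:R) ^+ d * (B * (Ab' * (E * Ex)))) * Num.sqrt n%:R ^+ d.-1); last by ring.
  by rewrite ler_peMr// mulr_ge0// exprn_ge0// mulr_ge0.
- exact: cvg_cst.
- rewrite -[X in _ --> X](mulr0 D); apply: cvgMr; apply: cvgn_poly_expR.
  by rewrite !mulr_gt0.
Unshelve. all: by end_near.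
Qed.
End Negligible.
End Limits.

(** * Pointwise limit of the profile *)

Section ProfileLimit.
Variables (R : realType) (k l : nat).
Local Notation d := (k + l)%N.
Local Notation m n := (mean_part k l n).
Local Notation c n := (center R k l n).
Hypothesis d0 : (0 < d)%N.

Lemma cvgn_sqrt_mean_partV : (fun n => (Num.sqrt (m n)%:R)^-1 : R) @ \oo --> (0 : R).
Proof.
have g0 := root_gap_gt0 R d0.
apply: (@squeeze_cvgr _ _ _ _ (fun=> 0) (fun n => (root_gap R k l)^-1 * (Num.sqrt n%:R)^-1)).
- near=> n.
  have dn : (d <= n)%N by near: n; exists d.
  have n0 : 0 < Num.sqrt n%:R :> R by rewrite sqrtr_gt0 ltr0n (leq_trans d0 dn).
  have h := sqrt_mean_part_ge R d0 dn.
  rewrite invr_ge0 sqrtr_ge0/= -invfM lef_pV2 ?posrE ?mulr_gt0//.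
  by apply: lt_le_trans h; rewrite mulr_gt0.
- exact: cvg_cst.
- by rewrite -[X in _ --> X](mulr0 (root_gap R k l)^-1); apply: cvgMr; exact: cvgn_sqrtV.
Unshelve. all: by end_near.
Qed.

Lemma cvgn_sqrt_ratio :
  (fun n => Num.sqrt n%:R / Num.sqrt (m n)%:R : R) @ \oo --> (Num.sqrt d%:R : R).
Proof.
have h1 : (fun n => (m n)%:R^-1 : R) @ \oo --> (0 : R).
  have H : (fun n => (Num.sqrt (m n)%:R)^-1 * (Num.sqrt (m n)%:R)^-1 : R) @ \oo --> (0 * 0 : R).
    by apply: cvgM; exact: cvgn_sqrt_mean_partV.
  rewrite mulr0 in H.
  apply: (near_cvgn _ H); near=> n.
  by rewrite -invfM -expr2 sqr_sqrtr.
have h2 : (fun n => n%:R / (m n)%:R : R) @ \oo --> (d%:R : R).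
  apply: (@squeeze_cvgr _ _ _ _ (fun=> d%:R) (fun n => d%:R + d%:R * (m n)%:R^-1)).
  - near=> n.
    have dn : (0 < d <= n)%N by rewrite d0; near: n; exists d.
    have m0 := mean_part_gt0 dn.
    have /andP[c1 c2] := center_mean_part R n d0.
    have cd : n%:R = c n * d%:R by rewrite /center divfK// pnatr_eq0 -lt0n.
    have dp : 0 < d%:R :> R by rewrite ltr0n.
    have mp : 0 < (m n)%:R :> R by rewrite ltr0n.
    rewrite ler_pdivlMr// ler_pdivrMr// mulrDl divfK ?gt_eqF// cd.
    rewrite [c n * _]mulrC ler_pM2l// c1/= -[X in _ <= _ + X]mulr1 -mulrDr ler_pM2l//.
    exact: ltW.
  - exact: cvg_cst.
  - rewrite -[X in _ --> X]addr0 -[X in _ --> _ + X](mulr0 d%:R).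
    by apply: cvgD; [exact: cvg_cst|apply: cvgMr].
have H : (fun n => Num.sqrt (n%:R / (m n)%:R) : R) @ \oo --> (Num.sqrt d%:R : R).
  exact: (continuous_cvg _ (@sqrt_continuous R d%:R) h2).
apply: (near_cvgn _ H); near=> n.
by rewrite /= sqrtrM ?ler0n// sqrtrV ?ler0n.
Unshelve. all: by end_near.
Qed.

Variables (u : nat -> nat -> nat) (t : nat -> R).
Hypothesis cu : forall i, (i < d)%N ->
  (fun n => ((u n i)%:R - c n) / Num.sqrt n%:R) @ \oo --> t i.

(** The Gaussian limit of [poisson_ratio_cvg] is on the scale of the square
    root of the mean part, which is [sqrt n] divided by [sqrt d] in the limit. *)
Lemma cvgn_poisson i : (i < d)%N ->
  (fun n => poisson_ratio R (m n) (u n i)) @ \oo --> expR (- (d%:R / 2%:R * t i ^+ 2)).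
Proof.
move=> id; have -> : d%:R / 2%:R * t i ^+ 2 = (t i * Num.sqrt d%:R) ^+ 2 / 2%:R.
  by rewrite exprMn sqr_sqrtr ?ler0n//; ring.
apply: poisson_ratio_cvg; first exact: cvgn_sqrt_mean_partV.
  by near=> n; apply: (@mean_part_gt0 k l n); rewrite d0; near: n; exists d.
have h : (fun n => (((u n i)%:R - c n) / Num.sqrt n%:R + (c n - (m n)%:R) * (Num.sqrt n%:R)^-1) *
    (Num.sqrt n%:R / Num.sqrt (m n)%:R)) @ \oo --> (t i + 0) * Num.sqrt d%:R.
  apply: cvgM; last exact: cvgn_sqrt_ratio.
  apply: cvgD; first exact: cu.
  apply: (@squeeze_cvgr _ _ _ _ (fun=> 0) (fun n => (Num.sqrt n%:R)^-1)).
  - near=> n; have /andP[c1 c2] := center_mean_part R n d0.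
    have s0 : 0 <= (Num.sqrt n%:R)^-1 :> R by rewrite invr_ge0 sqrtr_ge0.
    by apply/andP; split; nra.
  - exact: cvg_cst.
  - exact: cvgn_sqrtV.
rewrite addr0 in h; apply: (near_cvgn _ h); near=> n.
have s0 : 0 < Num.sqrt n%:R :> R.
  rewrite sqrtr_gt0 ltr0n; near: n; exists 1%N => //.
by rewrite -mulrDl mulrA divfK ?gt_eqF//; congr (_ / _); ring.
Unshelve. all: by end_near.
Qed.

Lemma cvgn_vdm r (f : nat -> nat) : (forall i, (i < r)%N -> (f i < d)%N) ->
  (fun n => vdm (fun i : 'I_r => ((u n (f i))%:R - c n) / Num.sqrt n%:R)) @ \oo -->
  vdm (fun i : 'I_r => t (f i)).
Proof.
move=> fd; apply: cvgn_prod => i _; apply: cvgn_prod => j _.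
by apply: cvgB; apply: cu; exact: fd.
Qed.

Lemma cvgn_hook_factor i j : (i < d)%N -> (j < d)%N ->
  (fun n => 2%:R * c n / (u n i + u n j).+1%:R) @ \oo --> (1 : R).
Proof.
move=> id jd.
pose q n : R := (((u n i)%:R - c n) / Num.sqrt n%:R + ((u n j)%:R - c n) / Num.sqrt n%:R +
    (Num.sqrt n%:R)^-1) * (d%:R / 2%:R * (Num.sqrt n%:R)^-1) + 1.
have h : q @ \oo --> (t i + t j + 0) * (d%:R / 2%:R * 0) + 1.
  apply: cvgD; last exact: cvg_cst.
  apply: cvgM; first by apply: cvgD; [apply: cvgD; exact: cu|exact: cvgn_sqrtV].
  by apply: cvgMr; exact: cvgn_sqrtV.
rewrite !mulr0 add0r in h.
have H : (fun n => (q n)^-1) @ \oo --> (1^-1 : R) by apply: cvgV => //; exact: oner_neq0.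
rewrite invr1 in H; apply: (near_cvgn _ H); near=> n.
have n0 : (0 < n)%N by near: n; exists 1%N.
have s0 : 0 < Num.sqrt n%:R :> R by rewrite sqrtr_gt0 ltr0n.
have cE : c n = (Num.sqrt n%:R) ^+ 2 / d%:R by rewrite sqr_sqrtr ?ler0n.
have dp : d%:R != 0 :> R by rewrite pnatr_eq0 -lt0n.
rewrite -[RHS]invf_div; congr (_^-1); rewrite /q -(natr1 (u n i + u n j)) (natrD _ (u n i)) cE.
move: (d%:R) dp (Num.sqrt _) s0 => D dp S s0.
by field; rewrite dp gt_eqF.
Unshelve. all: by end_near.
Qed.

Lemma profile_cvg : (fun n => hook_profile R k l n (u n)) @ \oo -->
  expR (- (d%:R / 2%:R * \sum_(i < d) t i ^+ 2)) *
  (vdm (fun i : 'I_k => t i) * vdm (fun j : 'I_l => t (k + j)%N)).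
Proof.
rewrite -[X in _ --> X]mulr1; apply: cvgM.
  apply: cvgM; last first.
    apply: cvgM; first by apply: (@cvgn_vdm k id) => i ik; exact: ltn_addr.
    by apply: (@cvgn_vdm l (addn k)) => j jl; rewrite ltn_add2l.
  rewrite mulr_sumr -sumrN expR_sum; apply: cvgn_prod => i _; exact: cvgn_poisson.
rewrite [X in _ --> X](_ : 1 = \prod_(i < k) \prod_(j < l) (1 : R)); last first.
  by rewrite big1// => i _; rewrite big1.
apply: cvgn_prod => i _; apply: cvgn_prod => j _; apply: cvgn_hook_factor.
  exact: ltn_addr.
by rewrite ltn_add2l.
Qed.
End ProfileLimit.

(** * Lattice points next to a given vector *)

Section LatticePoint.
Variables (R : realType) (k l e : nat).
Local Notation d := (k + l)%N.
Local Notation c n := (center R k l n).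
Local Notation s n := (Num.sqrt n%:R : R).
Hypothesis de : d = e.+1.
Implicit Types w : Rn R e.

(** The coordinates of the vector with sum 0 whose last [e] entries are [w]. *)
Definition zero_sum_coord w i : R :=
  if i is j.+1 then nth 0 w j else - \sum_(j < e) nth 0 w j.

Definition lattice_tail n w j : nat := Num.truncn (c n + nth 0 w j * s n).

(** The lattice point with the sum of the coordinates of a partition whose
    cube contains [w]; its coordinates after the first one are rounded down. *)
Definition lattice_point n w i : nat :=
  if i is j.+1 then lattice_tail n w j
  else (coord_sum k l n - \sum_(j < e) lattice_tail n w j)%N.

Let d0 : (0 < d)%N. Proof. by rewrite de. Qed.
Let dp : 0 < d%:R :> R. Proof. by rewrite ltr0n. Qed.

Lemma near_sqrt_ge (a : R) : \forall n \near \oo, a <= s n.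
Proof.
have h : (fun n => `|a| * (s n)^-1) @ \oo --> (`|a| * 0 : R).
  by apply: cvgMr; exact: cvgn_sqrtV.
rewrite mulr0 in h; near=> n.
have s0 : 0 < s n by rewrite sqrtr_gt0 ltr0n; near: n; exists 1%N.
apply: le_trans (ler_norm a) _; rewrite -[leRHS]mul1r -ler_pdivrMr//.
near: n; exact: cvgr_le h _ ltr01.
Unshelve. all: by end_near.
Qed.

Lemma centerE n : c n = s n * s n / d%:R.
Proof. by rewrite -expr2 sqr_sqrtr ?ler0n. Qed.

Lemma near_lattice_ge0 w j : \forall n \near \oo, 0 <= c n + nth 0 w j * s n.
Proof.
near=> n.
have h : `|nth 0 w j| * d%:R <= s n by near: n; exact: near_sqrt_ge.
have h2 : `|nth 0 w j| <= s n / d%:R by rewrite ler_pdivlMr.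
have s0 : 0 <= s n by exact: sqrtr_ge0.
rewrite centerE (_ : _ + _ = s n * (s n / d%:R + nth 0 w j)); last by ring.
by rewrite mulr_ge0//; have := ler_norm (- nth 0 w j); rewrite normrN; lra.
Unshelve. all: by end_near.
Qed.

Lemma lattice_tail_cvg w j :
  (fun n => ((lattice_tail n w j)%:R - c n) / s n) @ \oo --> nth 0 w j.
Proof.
apply: (@squeeze_cvgr _ _ _ _ (fun n => nth 0 w j - (s n)^-1) (fun=> nth 0 w j)).
- near=> n.
  have s0 : 0 < s n by rewrite sqrtr_gt0 ltr0n; near: n; exists 1%N.
  have /truncn_itv/andP[] : 0 <= c n + nth 0 w j * s n by near: n; exact: near_lattice_ge0.
  rewrite -/(lattice_tail n w j) -natr1 => a b.
  rewrite ler_pdivlMr// ler_pdivrMr// mulrBl mulVf ?gt_eqF//.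
  by apply/andP; split; lra.
- rewrite -[X in _ --> X]subr0; apply: cvgB; first exact: cvg_cst.
  exact: cvgn_sqrtV.
- exact: cvg_cst.
Unshelve. all: by end_near.
Qed.

Let K : R := 'C(k, 2)%:R + 'C(l, 2)%:R - (k * l)%:R.

Lemma near_coord_sum : \forall n \near \oo, (coord_sum k l n)%:R = n%:R + K :> R.
Proof.
near=> n; have kln : (k * l <= n)%N by near: n; exists (k * l)%N.
rewrite /coord_sum natrB ?natrD /K; first by ring.
by rewrite -addnA (leq_trans kln)// leq_addr.
Unshelve. all: by end_near.
Qed.

Lemma lattice_sum_cvg w :
  (fun n => \sum_(j < e) (((lattice_tail n w j)%:R - c n) / s n)) @ \oo --> \sum_(j < e) nth 0 w j.
Proof. by apply: cvgn_sum => j; exact: lattice_tail_cvg. Qed.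

Lemma lattice_sumE n w : (0 < n)%N ->
  \sum_(j < e) (lattice_tail n w j)%:R =
  s n * \sum_(j < e) (((lattice_tail n w j)%:R - c n) / s n) + e%:R * c n :> R.
Proof.
move=> n0; have s0 : 0 < s n by rewrite sqrtr_gt0 ltr0n.
have -> : s n * \sum_(j < e) (((lattice_tail n w j)%:R - c n) / s n) =
    \sum_(j < e) ((lattice_tail n w j)%:R - c n).
  by rewrite mulr_sumr; apply: eq_bigr => j _; rewrite mulrC divfK ?gt_eqF.
by rewrite sumrB sumr_const card_ord mulr_natl subrK.
Qed.

Lemma near_lattice_sum_le w :
  \forall n \near \oo, (\sum_(j < e) lattice_tail n w j <= coord_sum k l n)%N.
Proof.
pose S n : R := \sum_(j < e) (((lattice_tail n w j)%:R - c n) / s n).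
have h : (fun n => S n * (s n)^-1 - K * ((s n)^-1 * (s n)^-1)) @ \oo -->
    (\sum_(j < e) nth 0 w j) * 0 - K * (0 * 0).
  apply: cvgB; first by apply: cvgM; [exact: lattice_sum_cvg|exact: cvgn_sqrtV].
  by apply: cvgMr; apply: cvgM; exact: cvgn_sqrtV.
rewrite !mulr0 subr0 in h; near=> n.
have n0 : (0 < n)%N by near: n; exists 1%N.
have s0 : 0 < s n by rewrite sqrtr_gt0 ltr0n.
rewrite -(ler_nat R) natr_sum lattice_sumE//.
have -> : (coord_sum k l n)%:R = n%:R + K :> R by near: n; exact: near_coord_sum.
have : S n * (s n)^-1 - K * ((s n)^-1 * (s n)^-1) <= d%:R^-1.
  by near: n; apply: cvgr_le h _ _; rewrite invr_gt0.
have nE : n%:R = (e%:R + 1) * c n :> R.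
  by rewrite natr1 -de /center mulrC divfK// gt_eqF.
move=> hx; have : S n * s n - K <= c n.
  have -> : S n * s n - K = (S n * (s n)^-1 - K * ((s n)^-1 * (s n)^-1)) * (s n * s n).
    by field; rewrite gt_eqF.
  by rewrite centerE [leRHS]mulrC ler_wpM2r// mulr_ge0// ltW.
by rewrite -/(S n); lra.
Unshelve. all: by end_near.
Qed.

Lemma lattice_point_cvg w i : (i < d)%N ->
  (fun n => ((lattice_point n w i)%:R - c n) / s n) @ \oo --> zero_sum_coord w i.
Proof.
case: i => [_|j _]; last exact: lattice_tail_cvg.
have h : (fun n => K * (s n)^-1 - \sum_(j < e) (((lattice_tail n w j)%:R - c n) / s n)) @ \oo -->
    K * 0 - \sum_(j < e) nth 0 w j.
  apply: cvgB; last exact: lattice_sum_cvg.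
  by apply: cvgMr; exact: cvgn_sqrtV.
rewrite mulr0 sub0r in h; apply: (near_cvgn _ h); near=> n.
have n0 : (0 < n)%N by near: n; exists 1%N.
have s0 : 0 < s n by rewrite sqrtr_gt0 ltr0n.
rewrite /lattice_point natrB; last by near: n; exact: near_lattice_sum_le.
rewrite natr_sum lattice_sumE//.
have -> : (coord_sum k l n)%:R = n%:R + K :> R by near: n; exact: near_coord_sum.
have nE : n%:R = (e%:R + 1) * c n :> R.
  by rewrite natr1 -de /center mulrC divfK// gt_eqF.
set S := \sum_(j < e) _.
rewrite (_ : n%:R + K - (s n * S + e%:R * c n) - c n = K - s n * S); last by lra.
by move: S (s n) s0 => S t t0; field; rewrite gt_eqF.
Unshelve. all: by end_near.
Qed.

Lemma sum_lattice_point w :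
  \forall n \near \oo, (\sum_(i < d) lattice_point n w i + k * l = n + 'C(k, 2) + 'C(l, 2))%N.
Proof.
near=> n; rewrite de big_ord_recl /=.
rewrite subnK; last by near: n; exact: near_lattice_sum_le.
rewrite /coord_sum subnK// -addnA (leq_trans _ (leq_addr _ _))//.
by near: n; exists (k * l)%N.
Unshelve. all: by end_near.
Qed.

Lemma lattice_cube_point w : \forall n \near \oo, forall lam : intpart n, hook_rect k l lam ->
  lattice_cube (c n) (s n) (hook_coord k l lam) w <->
  (forall i, (i < d)%N -> hook_coord k l lam i = lattice_point n w i).
Proof.
near=> n => lam rect.
have n0 : (0 < n)%N by near: n; exists 1%N.
have s0 : 0 < s n by rewrite sqrtr_gt0 ltr0n.
have kn : (k <= n)%N by near: n; exists k.
have pos (j : 'I_e) : 0 <= c n + nth 0 w j * s n.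
  move: j; near: n; apply: filter_forall => j; exact: near_lattice_ge0.
have tailE (j : 'I_e) : `[((hook_coord k l lam j.+1)%:R - c n) / s n,
    ((hook_coord k l lam j.+1).+1%:R - c n) / s n[%classic (tnth w j) <->
    hook_coord k l lam j.+1 = lattice_tail n w j.
  rewrite /= in_itv /= ler_pdivrMr// ltr_pdivlMr// lerBlDl ltrBrDl (tnth_nth 0).
  rewrite -truncn_eq//; split=> [/eqP <-//|->]; exact/eqP.
have sumE := sum_hook_coord kn rect.
split=> [h|h j]; last by apply/tailE; rewrite h//= de ltnS.
have tl (j : 'I_e) := (tailE j).1 (h j).
case=> [_|j jd]; last first.
  have je : (j < e)%N by rewrite -ltnS -de.
  exact: (tl (Ordinal je)).
rewrite /= /coord_sum -sumE addnK de big_ord_recl /=.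
rewrite (eq_bigr (fun j : 'I_e => lattice_tail n w j)) ?addnK//.
Unshelve. all: by end_near.
Qed.

End LatticePoint.

(** * Limits of weighted sums over the hook *)

Section HookSums.
Variables (R : realType) (k l e : nat).
Local Notation d := (k + l)%N.
Local Notation c n := (center R k l n).
Local Notation s n := (Num.sqrt n%:R : R).
Hypothesis de : d = e.+1.
Implicit Types w : Rn R e.

(** The density of the theorem, without the power, in the linear coordinates
    [w] of the hyperplane. *)
Definition profile_lim w : R :=
  expR (- (d%:R / 2%:R * \sum_(i < d) zero_sum_coord w i ^+ 2)) *
  (vdm (fun i : 'I_k => zero_sum_coord w i) * vdm (fun j : 'I_l => zero_sum_coord w (k + j))).

Definition descending (lt : rel R) w :=
  (forall i j, (i < j < k)%N -> lt (zero_sum_coord w j) (zero_sum_coord w i)) /\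
  (forall i j, (i < j < l)%N -> lt (zero_sum_coord w (k + j)) (zero_sum_coord w (k + i))).

Lemma measurable_zero_sum_coord i : (i < d)%N ->
  measurable_fun [set: Rn R e] (fun w => zero_sum_coord w i).
Proof.
have mn j : (j < e)%N -> measurable_fun [set: Rn R e] (fun w : Rn R e => nth 0 w j : R).
  move=> je; rewrite (_ : (fun w => _) = (fun w : Rn R e => tnth w (Ordinal je))).
    exact: measurable_tnth.
  by apply/funext => w; rewrite (tnth_nth 0).
rewrite de; case: i => [_|j]; last by rewrite ltnS; exact: mn.
by apply: measurableT_comp => //; apply: measurable_sum => j; exact: mn.
Qed.

Lemma measurable_vdm r (f : 'I_r -> Rn R e -> R) :
  (forall i, measurable_fun [set: Rn R e] (f i)) ->
  measurable_fun [set: Rn R e] (fun w => vdm (fun i => f i w)).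
Proof.
move=> mf; rewrite /vdm; apply: measurable_prod => i _.
rewrite (_ : (fun w => _) = fun w => \prod_(j < r) (if (i < j)%N then f i w - f j w else 1)).
  apply: measurable_prod => j _; case: (i < j)%N; last exact: measurable_cst.
  exact: measurable_funB.
by apply/funext => w; rewrite big_mkcond.
Qed.

Lemma measurable_profile_lim : measurable_fun [set: Rn R e] profile_lim.
Proof.
apply: measurable_funM.
  apply: measurableT_comp => //; apply: measurableT_comp => //.
  apply: measurable_funM => //; apply: measurable_sum => i; apply: measurable_funX.
  exact: measurable_zero_sum_coord.
apply: measurable_funM; apply: measurable_vdm => i; apply: measurable_zero_sum_coord.
  exact: ltn_addr.
by rewrite ltn_add2l.
Qed.

Lemma vdm_gt0 r (x : nat -> R) : (forall i j, (i < j < r)%N -> x j < x i) -> 0 < vdm (fun i : 'I_r => x i).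
Proof.
move=> h; apply: prodr_gt0 => i _; apply: prodr_gt0 => j ij.
by rewrite subr_gt0 h// ij ltn_ord.
Qed.

Lemma vdm_tie r (x : nat -> R) i j : (i < j < r)%N -> x j = x i -> vdm (fun i : 'I_r => x i) = 0.
Proof.
move=> /andP[ij jr] xij; have ir := ltn_trans ij jr.
rewrite /vdm (bigD1 (Ordinal ir))//= (bigD1 (Ordinal jr))//=.
by rewrite xij subrr !mul0r.
Qed.

Lemma profile_lim_gt0 w : descending <%R w -> 0 < profile_lim w.
Proof.
move=> [h1 h2]; rewrite /profile_lim mulr_gt0 ?expR_gt0// mulr_gt0//; first exact: vdm_gt0.
exact: (@vdm_gt0 l (fun j => zero_sum_coord w (k + j))).
Qed.

Lemma not_tie_inversion r (x : nat -> R) : vdm (fun i : 'I_r => x i) != 0 ->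
  (forall i j, (i < j < r)%N -> x j < x i) \/ exists i j, (i < j < r)%N /\ x i < x j.
Proof.
move=> v0; have [[i [j [ij lt]]]|no] := pselect (exists i j, (i < j < r)%N /\ x i < x j).
  by right; exists i, j.
left=> i j ij; rewrite lt_neqAle leNgt; apply/andP; split; last first.
  by apply/negP => lt; apply: no; exists i, j.
by apply/eqP => xij; rewrite (vdm_tie ij xij) eqxx in v0.
Qed.

(** A nonzero Vandermonde product has no ties, hence the variables are in
    decreasing order or two of them are in strictly increasing order. *)
Lemma profile_lim_cases w : [\/ profile_lim w = 0, descending <%R w |
  (exists i j, (i < j < k)%N /\ zero_sum_coord w i < zero_sum_coord w j) \/
  (exists i j, (i < j < l)%N /\ zero_sum_coord w (k + i) < zero_sum_coord w (k + j))].
Proof.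
have [/eqP p0|p0] := boolP (profile_lim w == 0); first by constructor 1.
move: p0; rewrite /profile_lim !mulf_eq0 !negb_or => /and3P[_ v1 v2].
have [h1|h1] := not_tie_inversion v1; last by constructor 3; left.
have [h2|h2] := @not_tie_inversion l (fun j => zero_sum_coord w (k + j)) v2; last by constructor 3; right.
by constructor 2.
Qed.

Let d0 : (0 < d)%N. Proof. by rewrite de. Qed.

Lemma near_lattice_lt w i j : (i < d)%N -> (j < d)%N -> zero_sum_coord w i < zero_sum_coord w j ->
  \forall n \near \oo, (lattice_point k l n w i < lattice_point k l n w j)%N.
Proof.
move=> id jd lt.
pose r n : R := ((lattice_point k l n w j)%:R - c n) / s n - ((lattice_point k l n w i)%:R - c n) / s n.
have h : r @ \oo --> zero_sum_coord w j - zero_sum_coord w i.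
  by apply: cvgB; exact: lattice_point_cvg.
near=> n.
have s0 : 0 < s n by rewrite sqrtr_gt0 ltr0n; near: n; exists 1%N.
have : 0 < r n by near: n; apply: (cvgr_gt _ h); rewrite subr_gt0.
rewrite /r -mulrBl pmulr_lgt0 ?invr_gt0// => hh; rewrite -(ltr_nat R); lra.
Unshelve. all: by end_near.
Qed.

Lemma near_lattice_descending w : descending <%R w -> \forall n \near \oo,
  (forall i j, (i < j < k)%N -> (lattice_point k l n w j < lattice_point k l n w i)%N) /\
  (forall i j, (i < j < l)%N -> (lattice_point k l n w (k + j) < lattice_point k l n w (k + i))%N).
Proof.
move=> [h1 h2]; apply: filterI.
  have h : \forall n \near \oo, forall (i j : 'I_k), (i < j)%N ->
     (lattice_point k l n w j < lattice_point k l n w i)%N.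
    apply: filter_forall => i; apply: filter_forall => j; case: (ltnP i j) => ij; last by near=> n.
    near=> n => _; near: n; apply: near_lattice_lt; rewrite ?ltn_addr//.
    by apply: h1; rewrite ij /=.
  apply: filterS h => n h i j /andP[ij jk].
  exact: (h (Ordinal (ltn_trans ij jk)) (Ordinal jk)).
have h : \forall n \near \oo, forall (i j : 'I_l), (i < j)%N ->
     (lattice_point k l n w (k + j) < lattice_point k l n w (k + i))%N.
  apply: filter_forall => i; apply: filter_forall => j; case: (ltnP i j) => ij; last by near=> n.
  near=> n => _; near: n; apply: near_lattice_lt; rewrite ?ltn_add2l//.
  by apply: h2; rewrite ij /=.
apply: filterS h => n h i j /andP[ij jk].
exact: (h (Ordinal (ltn_trans ij jk)) (Ordinal jk)).
Unshelve. all: by end_near.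
Qed.

Lemma hook_coord_desc n (lam : intpart n) : hook_rect k l lam ->
  (forall i j, (i < j < k)%N -> (hook_coord k l lam j < hook_coord k l lam i)%N) /\
  (forall i j, (i < j < l)%N -> (hook_coord k l lam (k + j) < hook_coord k l lam (k + i))%N).
Proof.
move=> rect; have sr := part_shape lam; split=> i j /andP[ij jk].
  have := hook_coord_row rect jk; have := hook_coord_row rect (ltn_trans ij jk).
  by have := shape_leq sr (ltnW ij); rewrite /=; lia.
have := hook_coord_col rect jk; have := hook_coord_col rect (ltn_trans ij jk).
suff : (cpart lam j.+1 <= cpart lam i.+1)%N by lia.
rewrite !cpartE; apply: leq_sum => a _; case: (ltnP j (part lam a.+1)) => // ja.
by rewrite (ltn_trans ij ja).
Qed.

(** The sum of the coordinates is fixed, so the first one is determined by the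
    others; hence cubes of different partitions are disjoint. *)
Lemma hook_coord_tail_inj n (lam mu : intpart n) : (d <= n)%N ->
  hook_rect k l lam -> hook_rect k l mu ->
  (forall i, (i < e)%N -> hook_coord k l lam i.+1 = hook_coord k l mu i.+1) -> lam = mu.
Proof.
move=> dn r1 r2 eq_tl; apply: (hook_coord_inj r1 r2).
have kn : (k <= n)%N by apply: leq_trans dn; exact: leq_addr.
have := sum_hook_coord kn r1; rewrite -(sum_hook_coord kn r2) de !big_ord_recl /=.
rewrite (eq_bigr (fun i : 'I_e => hook_coord k l mu i.+1)) => [/addIn /addIn e0|]; last first.
  by move=> i _; exact: eq_tl.
by case=> [//|i]; rewrite ltnS; exact: eq_tl.
Qed.

Lemma eq_hook_profile n (u u' : nat -> nat) : (forall i, (i < d)%N -> u i = u' i) ->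
  hook_profile R k l n u = hook_profile R k l n u'.
Proof.
move=> uu; have ul (i : 'I_k) : u i = u' i by apply: uu; exact: ltn_addr.
have ur (j : 'I_l) : u (k + j)%N = u' (k + j)%N by apply: uu; rewrite ltn_add2l.
rewrite /hook_profile; congr (_ * (_ * _) * _).
- by apply: eq_bigr => i _; rewrite uu.
- by apply: eq_vdm => i; rewrite ul.
- by apply: eq_vdm => i; rewrite ur.
- by apply: eq_bigr => i _; apply: eq_bigr => j _; rewrite ul ur.
Qed.

Variables (beta : R) (h : forall n, intpart n -> R) (B : R) (D : set (Rn R e)).
Hypothesis beta0 : 0 < beta.
Hypothesis B0 : 0 <= B.
Hypothesis hB : forall n (lam : intpart n), lam \in hook_parts k l n -> 0 <= h lam <= B.
Hypothesis mD : measurable D.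
Hypothesis D_desc : forall w, D w -> descending <=%R w.
Hypothesis h_lim : {ae lebesgueRn R e, forall w, descending <%R w -> forall eps, 0 < eps ->
  \forall n \near \oo, forall lam : intpart n, hook_rect k l lam ->
    lattice_cube (c n) (s n) (hook_coord k l lam) w -> `|h lam - \1_D w| <= eps}.

Let P n : pred (intpart n) := @hook_rect k l n.
Let G n (lam : intpart n) : R := h lam * ((nb_syt lam)%:R / hook_scale R k l n) `^ beta.

Let G_profile n (lam : intpart n) : (d <= n)%N -> hook_rect k l lam ->
  [/\ 0 <= hook_profile R k l n (hook_coord k l lam) &
      G lam = h lam * hook_profile R k l n (hook_coord k l lam) `^ beta].
Proof.
move=> dn rect; have dn' : (0 < d <= n)%N by rewrite d0.
have A0 := hook_scale_gt0 R dn'.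
have E : (nb_syt lam)%:R / hook_scale R k l n = hook_profile R k l n (hook_coord k l lam).
  by rewrite (nb_syt_profile R dn' rect) mulrC mulKf ?gt_eqF.
by rewrite /G E; split=> //; rewrite -E divr_ge0// ltW.
Qed.

Let rect_hook n (lam : intpart n) : hook_rect k l lam -> lam \in hook_parts k l n.
Proof. by case/andP. Qed.

(* Where the limit profile is 0, the bound on h suffices.  At a strictly
   decreasing vector the lattice point eventually belongs to a partition, and
   the step function is h times the profile there.  At a vector with an
   inversion the lattice points eventually have an inversion as well, and belong
   to no partition. *)
Let step_cvg w : (descending <%R w -> forall eps, 0 < eps ->
  \forall n \near \oo, forall lam : intpart n, hook_rect k l lam ->
    lattice_cube (c n) (s n) (hook_coord k l lam) w -> `|h lam - \1_D w| <= eps) ->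
  (fun n => step_function (@P n) (@hook_coord k l n) (@G n) (c n) (s n) w) @ \oo -->
  \1_D w * profile_lim w `^ beta.
Proof.
move=> hw.
pose u n := lattice_point k l n w.
pose a n := hook_profile R k l n (u n).
have ca : a @ \oo --> profile_lim w.
  by apply: profile_cvg => // i id; exact: lattice_point_cvg.
pose J n := step_function (@P n) (@hook_coord k l n) (@G n) (c n) (s n) w.
have JE : \forall n \near \oo, forall lam : intpart n, hook_rect k l lam ->
    lattice_cube (c n) (s n) (hook_coord k l lam) w ->
    0 <= a n /\ J n = h lam * a n `^ beta.
  near=> n => lam rect cub.
  have dn : (d <= n)%N by near: n; exists d.
  have s0 : 0 < s n by rewrite sqrtr_gt0 ltr0n (leq_trans d0 dn).
  have uE : forall i, (i < d)%N -> hook_coord k l lam i = u n i.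
    move: lam rect cub; near: n; have := lattice_cube_point de w; apply: filterS => n hn lam rect cub.
    exact/hn.
  have [p0 GE] := G_profile dn rect; rewrite (eq_hook_profile _ uE) in p0 GE.
  rewrite -GE; split=> //; apply: step_function_in => // x y rx ry; exact: hook_coord_tail_inj.
have J0 : \forall n \near \oo, (forall lam : intpart n, hook_rect k l lam ->
    ~ lattice_cube (c n) (s n) (hook_coord k l lam) w) -> J n = 0.
  by near=> n => none; exact: step_function_out.
have JB : \forall n \near \oo, 0 <= J n <= B * `|a n| `^ beta.
  near=> n.
  have [[lam [rect cub]]|none] := pselect (exists lam : intpart n, hook_rect k l lam /\
      lattice_cube (c n) (s n) (hook_coord k l lam) w).
    have [a0 ->] : 0 <= a n /\ J n = h lam * a n `^ beta.
      by move: lam rect cub; near: n.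
    have /andP[h0 h1] := hB (rect_hook rect).
    by rewrite (ger0_norm a0) mulr_ge0 ?powR_ge0//= ler_wpM2r ?powR_ge0.
  have -> : J n = 0.
    have Jn : (forall lam : intpart n, hook_rect k l lam ->
      ~ lattice_cube (c n) (s n) (hook_coord k l lam) w) -> J n = 0 by near: n.
    by apply: Jn => lam rect cub; apply: none; exists lam.
  by rewrite lexx mulr_ge0 ?powR_ge0.
have [L0|desc|inv] := profile_lim_cases w.
- rewrite L0 powR0 ?gt_eqF// mulr0.
  apply: (@squeeze_cvgr _ _ _ _ (fun=> 0) (fun n => B * `|a n| `^ beta)).
  + exact: JB.
  + exact: cvg_cst.
  + rewrite -[X in _ --> X](mulr0 B); apply: cvgMr.
    rewrite -[X in _ --> X](powR0 (lt0r_neq0 beta0)); apply: cvgn_powR => //; first by near=> n.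
    have ca' : (fun n => `|a n|) @ \oo --> `|profile_lim w| by exact: cvg_norm.
    by rewrite L0 normr0 in ca'.
- have L0 := profile_lim_gt0 desc.
  have cab : (fun n => a n `^ beta) @ \oo --> profile_lim w `^ beta.
    by apply: cvgn_powR => //; [exact: ltW|near=> n; apply: ltW; near: n; exact: (cvgr_gt _ ca)].
  apply/cvgrPdist_le => eps eps0.
  pose M := profile_lim w `^ beta + 1.
  have M0 : 0 < M by rewrite ltr_wpDl ?powR_ge0.
  have e1 : 0 < eps / 2%:R / M by rewrite !divr_gt0.
  have e2 : 0 < eps / 2%:R by rewrite divr_gt0.
  near=> n.
  have dn : (d <= n)%N by near: n; exists d.
  have kn : (k <= n)%N by apply: leq_trans dn; exact: leq_addr.
  have [d1 d2] : (forall i j, (i < j < k)%N -> (u n j < u n i)%N) /\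
     (forall i j, (i < j < l)%N -> (u n (k + j) < u n (k + i))%N).
    by near: n; exact: near_lattice_descending.
  have sn : (\sum_(i < d) u n i + k * l = n + 'C(k, 2) + 'C(l, 2))%N.
    by near: n; exact: sum_lattice_point.
  have [lam rect lamE] := exists_hook_coord kn d1 d2 sn.
  have cub : lattice_cube (c n) (s n) (hook_coord k l lam) w.
    move: lam rect lamE; near: n; have := lattice_cube_point de w; apply: filterS => n hn lam rect uE.
    exact/hn.
  have [a0 JnE] : 0 <= a n /\ J n = h lam * a n `^ beta.
    by move: lam rect cub {lamE}; near: n.
  have hl : `|h lam - \1_D w| <= eps / 2%:R / M.
    move: lam rect cub {lamE JnE}; near: n; exact: hw.
  have aM : a n `^ beta <= M.
    by near: n; apply: (cvgr_le _ cab); rewrite ltrDl.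
  have al : `|profile_lim w `^ beta - a n `^ beta| <= eps / 2%:R.
    by near: n; move/cvgrPdist_le : cab; apply.
  rewrite -/(J n) JnE.
  have -> : \1_D w * profile_lim w `^ beta - h lam * a n `^ beta =
     \1_D w * (profile_lim w `^ beta - a n `^ beta) - (h lam - \1_D w) * a n `^ beta by ring.
  apply: le_trans (ler_normB _ _) _; rewrite !normrM [leRHS]splitr; apply: lerD.
    rewrite -[leRHS]mul1r ler_pM//.
    by rewrite indicE; case: (_ \in _); rewrite ?normr1 ?normr0 ?ler01.
  rewrite (ger0_norm (powR_ge0 _ _)); apply: le_trans (ler_pM _ _ hl aM) _ => //.
    exact: powR_ge0.
  by rewrite divfK// gt_eqF.
- have -> : \1_D w = 0 :> R.
    rewrite indicE memNset// => Dw; have [i1 i2] := D_desc Dw.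
    by case: inv => -[i [j [ij lt]]]; [have := i1 i j ij|have := i2 i j ij]; rewrite leNgt lt.
  have [i [j [id jd lt ge]]] : exists i j, [/\ (i < d)%N, (j < d)%N,
      zero_sum_coord w i < zero_sum_coord w j & forall n (lam : intpart n), hook_rect k l lam ->
      (hook_coord k l lam j < hook_coord k l lam i)%N].
    case: inv => -[i [j [ij lt]]]; have /andP[lij jl] := ij.
      exists i, j; split=> //; [exact: ltn_addr (ltn_trans lij jl)|exact: ltn_addr|].
      by move=> n lam rect; have [d1 _] := hook_coord_desc rect; exact: d1.
    exists (k + i)%N, (k + j)%N; split=> //; rewrite ?ltn_add2l//; first exact: ltn_trans jl.
    by move=> n lam rect; have [_ d2] := hook_coord_desc rect; exact: d2.
  have c0 : (fun _ : nat => 0 : R) @ \oo --> (0 : R) by exact: cvg_cst.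
  rewrite mul0r; apply: (near_cvgn _ c0); near=> n; apply/esym.
  have Jn : (forall lam : intpart n, hook_rect k l lam ->
      ~ lattice_cube (c n) (s n) (hook_coord k l lam) w) -> J n = 0 by near: n.
  apply: Jn => lam rect cub.
  have uE : forall i, (i < d)%N -> hook_coord k l lam i = u n i.
    move: lam rect cub; near: n; have := lattice_cube_point de w; apply: filterS => n hn lam rect cub.
    exact/hn.
  have := ge _ _ rect; rewrite !uE// ltnNge ltnW//; near: n; exact: near_lattice_lt.
Unshelve. all: by end_near.
Qed.

Definition limit_density w : R := \1_D w * profile_lim w `^ beta.

Let G_dominated n : (d <= n)%N -> forall lam : intpart n, P lam ->
  `|G lam| <= B * profile_bound R k l `^ beta *
    \prod_(i < e) expR (- (beta / 4%:R * `|((hook_coord k l lam i.+1)%:R - c n) / s n|)).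
Proof.
move=> dn lam rect; have dn' : (0 < d <= n)%N by rewrite d0.
have [p0 ->] := G_profile dn rect; have /andP[h0 h1] := hB (rect_hook rect).
set u := hook_coord k l lam in p0 *.
rewrite ger0_norm ?mulr_ge0 ?powR_ge0// -mulrA ler_pM ?powR_ge0//.
have pb0 : 0 <= profile_bound R k l.
  by rewrite /profile_bound !mulr_ge0 ?exprn_ge0 ?expR_ge0 ?mulr_ge0 ?exprn_ge0 ?mulr_ge0.
have -> : \prod_(i < e) expR (- (beta / 4%:R * `|((u i.+1)%:R - c n) / s n|)) =
    (\prod_(i < e) expR (- (4%:R^-1 * `|((u i.+1)%:R - c n) / s n|))) `^ beta.
  rewrite -!expR_sum -expRM; congr expR; rewrite mulr_suml; apply: eq_bigr => i _; ring.
have q0 : 0 <= \prod_(i < e) expR (- (4%:R^-1 * `|((u i.+1)%:R - c n) / s n|)).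
  by rewrite prodr_ge0// => i _; exact: expR_ge0.
rewrite -powRM//; apply: ge0_ler_powR; rewrite ?nnegrE ?(ltW beta0)//; first exact: mulr_ge0.
apply: le_trans (ler_norm _) _; apply: le_trans (profile_dominated R dn' u) _.
rewrite ler_wpM2l//.
rewrite -(big_mkord xpredT (fun i => expR (- (4%:R^-1 * `|((u i)%:R - c n) / s n|)))) de big_mkord.
rewrite big_ord_recl /= ler_piMl//.
Qed.

(** Partitions that contain the rectangle form a Riemann sum, the others are
    negligible. The hypothesis on [h] is only about almost every [w], since
    the truncation has a limit only off a null set. *)
Theorem hook_sum_cvg : (lebesgueRn R e).-integrable setT (EFin \o limit_density) /\
  (fun n => (\sum_(lam in hook_parts k l n) h lam * (nb_syt lam)%:R `^ beta) /
     (hook_scale R k l n `^ beta * s n ^+ e)) @ \oo --> \int[lebesgueRn R e]_w limit_density w.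
Proof.
have [|||||||ig cv] := @riemann_sum R e intpart P (@hook_coord k l) G (fun n => c n) (fun n => s n)
  limit_density (B * profile_bound R k l `^ beta) (beta / 4%:R) d.
- by move=> n dn; rewrite -[leLHS]sqrtr1 ler_sqrt ?ler0n// ler1n (leq_trans d0).
- by move=> n dn x y rx ry; exact: hook_coord_tail_inj.
- by rewrite mulr_ge0 ?powR_ge0.
- by rewrite divr_gt0.
- exact: G_dominated.
- apply: measurable_funM; first exact: measurable_indic.
  exact: (measurableT_comp (measurable_powR beta) measurable_profile_lim).
- by apply: filterS h_lim => w; exact: step_cvg.
split=> //.
have cn := nonrect_negligible d0 beta0 B0 hB.
rewrite -[X in _ --> X]addr0; rewrite de /= in cn.
have cs : (fun n => (\sum_(lam : intpart n | P lam) G lam) * s n ^- e +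
  (\sum_(lam in hook_parts k l n | ~~ hook_rect k l lam) h lam * (nb_syt lam)%:R `^ beta) /
     (hook_scale R k l n `^ beta * s n ^+ e)) @ \oo --> (\int[lebesgueRn R e]_w limit_density w) + 0.
  apply: cvgD; [exact: cv|exact: cn].
apply: (near_cvgn _ cs); near=> n.
have dn : (0 < d <= n)%N by rewrite d0; near: n; exists d.
have A0 := hook_scale_gt0 R dn.
rewrite [in RHS](bigID (fun lam : intpart n => hook_rect k l lam))/= [RHS]mulrDl; congr (_ + _).
rewrite mulr_suml [RHS]mulr_suml; apply: eq_big => lam.
  by rewrite /P; apply/idP/andP => [rect|[]//]; split=> //; exact: rect_hook.
move=> rect; rewrite /G powRM ?ler0n ?invr_ge0 ?(ltW A0)//.
rewrite -[(hook_scale R k l n)^-1]powR_inv1 ?(ltW A0)// powRAC powR_inv1 ?powR_ge0//.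
by rewrite [(_ * s n ^+ e)^-1]invfM; ring.
Unshelve. all: by end_near.
Qed.

End HookSums.

(** * Integrals over the hyperplane *)

Section Transfer.
Variable R : realType.

(** The dimension is given by an equation because [k + l] is not a successor
    up to conversion; this is why the parametrization is only known by its
    coordinates. *)
Lemma hyperplane_Rintegral N e : N = e.+1 -> exists Z : Rn R e -> Rn R N,
  [/\ measurable_fun [set: Rn R e] Z,
      forall w i, (i < N)%N -> nth 0 (Z w) i = zero_sum_coord w i &
      forall (S : set (Rn R N)) (f : Rn R N -> R), measurable S ->
        measurable_fun [set: Rn R N] f -> (forall x, 0 <= f x) ->
        \int[hyperplane_measure R N]_(t in S) f t =
        \int[lebesgueRn R e]_w (\1_(Z @^-1` S) w * f (Z w))].
Proof.
move=> ->; exists (@zero_sum_cons R e); split.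
- exact: measurable_zero_sum_cons.
- move=> w [_|i _] //=; congr (- _); apply: eq_bigr => i _; exact: tnth_nth.
move=> S f mS mf f0; rewrite /Rintegral; congr fine => /=.
rewrite (ge0_integral_pushforward (@measurable_zero_sum_cons R e))//=; last 2 first.
- by apply/measurable_EFinP; exact: measurable_funTS.
- by move=> x _; rewrite lee_fin.
rewrite integral_mkcond; apply: eq_integral => w _.
rewrite patchE indicE; case: ifP => h; first by rewrite mul1r.
by rewrite mul0r.
Qed.

Lemma measurable_implies d (T : measurableType d) (b : bool) (A : set T) :
  measurable A -> measurable [set t | b -> A t].
Proof.
move=> mA; case: b.
  by rewrite (_ : [set _ | _] = A)//; apply/seteqP; split => t /= h //; exact: h.
by rewrite (_ : [set _ | _] = setT)//; apply/seteqP; split.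
Qed.

Lemma measurable_le_fun d (T : measurableType d) (f g : T -> R) :
  measurable_fun setT f -> measurable_fun setT g -> measurable [set t | f t <= g t].
Proof.
move=> mf mg; have mh := measurable_funB mg mf.
rewrite (_ : [set _ | _] = setT `&` (g \- f) @^-1` `[0, +oo[%classic); first exact: mh.
by rewrite setTI; apply/seteqP; split => t /=; rewrite in_itv /= andbT subr_ge0.
Qed.

Variables (k l : nat).

Lemma measurable_xcoord (i : 'I_k) : measurable_fun [set: Rn R (k + l)] (fun t => xcoord t i).
Proof. exact: measurable_tnth. Qed.

Lemma measurable_ycoord (j : 'I_l) : measurable_fun [set: Rn R (k + l)] (fun t => ycoord t j).
Proof. exact: measurable_tnth. Qed.

Lemma measurable_Omega : measurable (@Omega R k l).
Proof.
have -> : @Omega R k l =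
  [set t | forall i j : 'I_k, (i <= j)%N -> xcoord t j <= xcoord t i] `&`
  [set t | forall i j : 'I_l, (i <= j)%N -> ycoord t j <= ycoord t i] `&`
  [set t | \sum_(i < k) xcoord t i + \sum_(j < l) ycoord t j = 0].
  by apply/seteqP; split => t /= [] //; case.
apply: measurableI; first apply: measurableI.
- do 2! apply: measurable_forall => ?; apply: measurable_implies.
  by apply: measurable_le_fun; exact: measurable_xcoord.
- do 2! apply: measurable_forall => ?; apply: measurable_implies.
  by apply: measurable_le_fun; exact: measurable_ycoord.
rewrite -[X in measurable X]setTI.
have mf : measurable_fun [set: Rn R (k + l)] (fun t : Rn R (k + l) => \sum_(i < k) xcoord t i + \sum_(j < l) ycoord t j).
  by apply: measurable_funD; apply: measurable_sum => ?; [exact: measurable_xcoord|exact: measurable_ycoord].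
exact: (mf measurableT [set 0]).
Qed.

Lemma measurable_Omega_le (z : R) : measurable (@Omega_le R k l z).
Proof.
have -> : @Omega_le R k l z = @Omega R k l `&`
  [set t | forall i : 'I_k, (i == 0%N :> nat) -> xcoord t i <= z] `&`
  [set t | forall j : 'I_l, (j == 0%N :> nat) -> ycoord t j <= z].
  apply/seteqP; split => t /=.
    by move=> [h1 h2 h3]; split; [split=> // i /eqP; exact: h2|move=> j /eqP; exact: h3].
  by move=> [[h1 h2] h3]; split=> // i /eqP; [exact: h2|exact: h3].
apply: measurableI; first by apply: measurableI; [exact: measurable_Omega|];
  apply: measurable_forall => i; apply: measurable_implies; apply: measurable_le_fun => //; exact: measurable_xcoord.
apply: measurable_forall => i; apply: measurable_implies; apply: measurable_le_fun => //; exact: measurable_ycoord.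
Qed.

Lemma measurable_hook_density (beta : R) : measurable_fun [set: Rn R (k + l)] (@hook_density R k l beta).
Proof.
apply: (measurableT_comp (measurable_powR beta)).
apply: measurable_funM.
  apply: measurable_funM; apply: measurable_vdm; [exact: measurable_xcoord|exact: measurable_ycoord].
apply: measurableT_comp => //; apply: measurableT_comp => //; apply: measurable_funM => //.
apply: measurable_funD; apply: measurable_sum => i; apply: measurable_funX;
  [exact: measurable_xcoord|exact: measurable_ycoord].
Qed.

Section Coords.
Variables (e : nat).
Implicit Types w : Rn R e.
Hypothesis de : (k + l)%N = e.+1.
Variable Z : Rn R e -> Rn R (k + l).
Hypothesis Znth : forall w i, (i < k + l)%N -> nth 0 (Z w) i = zero_sum_coord w i.

Lemma xcoord_Z w (i : 'I_k) : xcoord (Z w) i = zero_sum_coord w i.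
Proof. by rewrite /xcoord (tnth_nth 0) /= Znth// ltn_addr. Qed.

Lemma ycoord_Z w (j : 'I_l) : ycoord (Z w) j = zero_sum_coord w (k + j).
Proof. by rewrite /ycoord (tnth_nth 0) /= Znth// ltn_add2l. Qed.

Lemma hook_density_Z beta w : hook_density beta (Z w) = profile_lim k l w `^ beta.
Proof.
have sq : \sum_(i < k) xcoord (Z w) i ^+ 2 + \sum_(j < l) ycoord (Z w) j ^+ 2 =
    \sum_(i < k + l) zero_sum_coord w i ^+ 2.
  rewrite big_split_ord /=; congr (_ + _); apply: eq_bigr => i _.
    by rewrite xcoord_Z.
  by rewrite ycoord_Z.
have vx : vdm (xcoord (Z w)) = vdm (fun i : 'I_k => zero_sum_coord w i).
  by apply: eq_vdm => i; rewrite xcoord_Z.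
have vy : vdm (ycoord (Z w)) = vdm (fun j : 'I_l => zero_sum_coord w (k + j)).
  by apply: eq_vdm => j; rewrite ycoord_Z.
by rewrite /hook_density /profile_lim sq vx vy mulrC.
Qed.

Lemma sum_zero_sum_coord w : \sum_(i < k + l) zero_sum_coord w i = 0.
Proof. by rewrite de big_ord_recl /= addrC subrr. Qed.

Lemma Omega_Z w : Omega (Z w) <-> descending k l <=%R w.
Proof.
split=> [[h1 h2 _]|[h1 h2]].
  split=> i j /andP[ij jk].
    by have := h1 (Ordinal (ltn_trans ij jk)) (Ordinal jk) (ltnW ij); rewrite !xcoord_Z.
  by have := h2 (Ordinal (ltn_trans ij jk)) (Ordinal jk) (ltnW ij); rewrite !ycoord_Z.
split.
- move=> i j; rewrite leq_eqVlt !xcoord_Z => /orP[/eqP -> //|ij].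
  by apply: h1; rewrite ij ltn_ord.
- move=> i j; rewrite leq_eqVlt !ycoord_Z => /orP[/eqP -> //|ij].
  by apply: h2; rewrite ij ltn_ord.
- rewrite -[RHS](sum_zero_sum_coord w) big_split_ord /=; congr (_ + _); apply: eq_bigr => i _.
    exact: xcoord_Z.
  exact: ycoord_Z.
Qed.

Lemma Omega_le_Z (z : R) w : Omega_le z (Z w) <->
  [/\ descending k l <=%R w, (0 < k)%N -> zero_sum_coord w 0 <= z &
      (0 < l)%N -> zero_sum_coord w k <= z].
Proof.
split=> [[/Omega_Z h1 h2 h3]|[h1 h2 h3]].
  split=> // [k0|l0].
    by have := h2 (Ordinal k0) erefl; rewrite xcoord_Z.
  by have := h3 (Ordinal l0) erefl; rewrite ycoord_Z /= addn0.
split; first exact/Omega_Z.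
- by move=> i i0; rewrite xcoord_Z i0 h2// (leq_ltn_trans _ (ltn_ord i)).
- by move=> j j0; rewrite ycoord_Z j0 addn0 h3// (leq_ltn_trans _ (ltn_ord j)).
Qed.
End Coords.
End Transfer.

(** * The truncation *)

Section Truncation.
Variables (R : realType) (k l e : nat) (beta z : R).
Local Notation d := (k + l)%N.
Local Notation c n := (center R k l n).
Local Notation s n := (Num.sqrt n%:R : R).
Hypothesis de : d = e.+1.
Hypothesis beta0 : 0 < beta.
Hypothesis z0 : 0 < z.
Implicit Types w : Rn R e.

Definition bounded_desc : set (Rn R e) := [set w |
  [/\ descending k l <=%R w, (0 < k)%N -> zero_sum_coord w 0 <= z &
      (0 < l)%N -> zero_sum_coord w k <= z]].

Lemma bounded_desc_weak : bounded_desc `<=` [set w | descending k l <=%R w].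
Proof. by move=> w []. Qed.

Let d0 : (0 < d)%N. Proof. by rewrite de. Qed.

Lemma descending_strict_weak w : descending k l <%R w -> descending k l <=%R w.
Proof. by move=> [h1 h2]; split=> i j ij; apply: ltW; [exact: h1|exact: h2]. Qed.

Let eps : R := z / (e.+1%:R ^+ 2).
Let eps0 : 0 < eps. Proof. by rewrite divr_gt0. Qed.
(** The entries of [w] are close to [- eps], [- 2 eps], ..., so they decrease
    strictly and are negative, while the sum of their opposites is between 0
    and [z]: all coordinates decrease strictly and are at most [z]. *)
Definition pos_box : set (Rn R e) :=
  box e (fun j => `[- (eps * j.+1%:R), - (eps * j.+1%:R) + eps / 2%:R[%classic).

Lemma pos_boxE w : pos_box w -> forall j, (j < e)%N ->
  - (eps * j.+1%:R) <= nth 0 w j < - (eps * j.+1%:R) + eps / 2%:R.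
Proof. by move=> h j je; have := h (Ordinal je); rewrite /= in_itv /= (tnth_nth 0). Qed.

Lemma pos_box_coord w : pos_box w ->
  (forall i j, (i < j < d)%N -> zero_sum_coord w j < zero_sum_coord w i) /\
  (forall i, (i < d)%N -> zero_sum_coord w i <= z).
Proof.
move=> /pos_boxE wb.
have neg j : (j < e)%N -> nth 0 w j < 0.
  move=> je; have /andP[_ h] := wb j je; apply: lt_le_trans h _.
  have : 1 <= j.+1%:R :> R by rewrite ler1n.
  by have := eps0; nra.
have x0 : 0 <= - \sum_(j < e) nth 0 w j.
  by rewrite -sumrN sumr_ge0// => j _; rewrite oppr_ge0 ltW// neg.
have x1 : - \sum_(j < e) nth 0 w j <= z.
  rewrite -sumrN; apply: (@le_trans _ _ (\sum_(j < e) eps * e.+1%:R)).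
    apply: ler_sum => j _; have /andP[h _] := wb j (ltn_ord j).
    rewrite lerNl (le_trans _ h)// lerN2 ler_pM2l// ler_nat.
    by rewrite leqW.
  rewrite sumr_const card_ord -[_ *+ e]mulr_natr /eps.
  have q0 : e.+1%:R != 0 :> R by rewrite pnatr_eq0.
  rewrite -mulrA -mulrA ler_piMr ?(ltW z0)// mulrC ler_pdivrMr ?exprn_gt0// mul1r.
  by rewrite expr2 ler_pM// ?ler_nat.
split=> [i j /andP[ij]|i]; rewrite de.
  case: j ij => // j ij; rewrite ltnS => je; case: i ij => [_|i].
    by rewrite /= (lt_le_trans (neg j je)).
  rewrite ltnS => ij; have /andP[h1 _] := wb i (ltn_trans ij je); have /andP[_ h2] := wb j je.
  apply: lt_le_trans h1; apply: lt_le_trans h2 _ => /=.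
  have : i.+2%:R <= j.+1%:R :> R by rewrite ler_nat.
  by rewrite -natr1; have := eps0; nra.
by case: i => [//|i]; rewrite ltnS => ie; rewrite /= ltW// (lt_trans (neg i ie)).
Qed.

Lemma pos_box_desc w : pos_box w -> descending k l <%R w /\ bounded_desc w.
Proof.
move=> /pos_box_coord[h1 h2].
have dsc : descending k l <%R w.
  split=> i j /andP[ij jk]; apply: h1; first by rewrite ij ltn_addr.
  by rewrite !ltn_add2l ij.
split=> //; split; first exact: descending_strict_weak.
- by move=> k0; exact: h2.
- by move=> l0; apply: h2; rewrite -[ltnLHS]addn0 ltn_add2l.
Qed.

Lemma lebesgue_pos_box : (0 < lebesgueRn R e pos_box)%E.
Proof.
rewrite lebesgueRn_box//; elim/big_ind: _ => // [x y|i _]; first exact: mule_gt0.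
have e2 : 0 < eps / 2%:R by rewrite divr_gt0 ?eps0.
by rewrite lebesgue_measure_itv /= lte_fin ltrDl e2 -EFinB lte_fin; lra.
Qed.

(** The density is positive on a box of positive measure. *)
Lemma integral_limit_density_gt0 (D : set (Rn R e)) : bounded_desc `<=` D ->
  (lebesgueRn R e).-integrable setT (EFin \o limit_density k l beta D) ->
  0 < \int[lebesgueRn R e]_w limit_density k l beta D w.
Proof.
move=> sub ig.
have g0 w : 0 <= limit_density k l beta D w by rewrite /limit_density mulr_ge0 ?powR_ge0// indicE.
rewrite lt_neqAle Rintegral_ge0// andbT eq_sym; apply/negP => /eqP i0R.
have i0 : (\int[lebesgueRn R e]_w (EFin \o limit_density k l beta D) w = 0)%E.
  rewrite -[LHS]fineK; last exact: integrable_fin_num.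
  exact: (congr1 EFin i0R).
have mf := measurable_int _ ig.
have iabs : (\int[lebesgueRn R e]_w `|(EFin \o limit_density k l beta D) w| = 0)%E.
  by rewrite -[RHS]i0; apply: eq_integral => w _; rewrite gee0_abs//= lee_fin.
have [N [mN N0 sN]] := (ae_eq_integral_abs (lebesgueRn R e) measurableT mf).1 iabs.
have : (lebesgueRn R e pos_box <= lebesgueRn R e N)%E.
  apply: le_measure; rewrite ?inE//; first exact: measurable_box.
  move=> w wb; apply: sN => /= /(_ I) [] /eqP; have [dsc bd] := pos_box_desc wb.
  rewrite /limit_density indicE mem_set ?mul1r; last exact: sub.
  by rewrite gt_eqF// powR_gt0// profile_lim_gt0.
by rewrite N0 leNgt lebesgue_pos_box.
Qed.

Lemma ae_coord_neq i : (i < d)%N ->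
  {ae lebesgueRn R e, forall w, zero_sum_coord w i != z}.
Proof.
move=> id; exists [set w | zero_sum_coord w i = z]; split.
- rewrite -[X in measurable X]setTI.
  by apply: (measurable_zero_sum_coord de id measurableT (Y := [set z])).
- case: i id => [|i] id.
    case: (posnP e) => [e0|e0]; last first.
      rewrite -[RHS](@null_affine R e (fun=> -1) z (Ordinal e0)) ?oppr_eq0 ?oner_eq0//.
      congr (lebesgueRn R e _); apply/seteqP; split => w /= <-;
        by rewrite -sumrN; apply: eq_bigr => j _; rewrite mulN1r (tnth_nth 0).
    rewrite [X in lebesgueRn _ _ X](_ : _ = set0) ?measure0//; apply/seteqP; split => w //=.
    rewrite big1 => [h|j _]; first by have := z0; rewrite -h oppr0 ltxx.
    by have := ltn_ord j; rewrite [X in (_ < X)%N]e0.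
  have ie : (i < e)%N by rewrite -ltnS -de.
  rewrite -[RHS](@null_affine R e (fun j => (j == i)%:R) z (Ordinal ie)) ?eqxx ?oner_eq0//.
  congr (lebesgueRn R e _); apply/seteqP; split => w /= <-;
  rewrite (bigD1 (Ordinal ie))//= eqxx mul1r (tnth_nth 0) big1 ?addr0// => j ji;
  by rewrite (_ : (_ == i) = false) ?mul0r//; apply: contraNF ji => /eqP ji; apply/eqP/val_inj.
- by move=> w /= /negP; rewrite negbK => /eqP.
Qed.

(** Bounded shifts disappear on the scale of [sqrt n]; equality with [z] has
    to be excluded, since there the two sides may disagree for all [n]. *)
Lemma near_threshold w i (a : R) : (i < d)%N -> zero_sum_coord w i != z ->
  \forall n \near \oo,
    ((lattice_point k l n w i)%:R + a <= c n + z * s n) = (zero_sum_coord w i <= z).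
Proof.
move=> id xz.
pose r n : R := ((lattice_point k l n w i)%:R - c n) / s n + a * (s n)^-1.
have h : r @ \oo --> zero_sum_coord w i + a * 0.
  by apply: cvgD; [exact: lattice_point_cvg|apply: cvgMr; exact: cvgn_sqrtV].
rewrite mulr0 addr0 in h.
have rE n : (0 < n)%N -> ((lattice_point k l n w i)%:R + a <= c n + z * s n) = (r n <= z).
  move=> n0; have s0 : 0 < s n by rewrite sqrtr_gt0 ltr0n.
  rewrite /r -mulrDl ler_pdivrMr// -subr_ge0 -[RHS]subr_ge0; congr (0 <= _); ring.
move: xz; case: (ltgtP (zero_sum_coord w i) z) => // xz _; near=> n.
  rewrite rE; last by near: n; exists 1%N.
  by apply/idP; apply: ltW; near: n; exact: (cvgr_lt _ h).
rewrite rE; last by near: n; exists 1%N.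
by apply: negbTE; rewrite -ltNge; near: n; exact: (cvgr_gt _ h).
Unshelve. all: by end_near.
Qed.

Lemma near_const_le (a : nat) : \forall n \near \oo, a%:R <= c n + z * s n.
Proof.
near=> n; have sa : a%:R / z <= s n by near: n; exact: near_sqrt_ge.
by rewrite ler_wpDl ?divr_ge0// mulrC -ler_pdivrMr.
Unshelve. all: by end_near.
Qed.

(** If [k = 0], the first part of a partition in the hook is at most [l], and
    the condition holds eventually. *)
Lemma near_row_le w : ((0 < k)%N -> zero_sum_coord w 0 != z) ->
  \forall n \near \oo, forall lam : intpart n, hook_rect k l lam ->
    (forall i, (i < d)%N -> hook_coord k l lam i = lattice_point k l n w i) ->
    ((part lam 1)%:R <= c n + z * s n) = ((0 < k)%N ==> (zero_sum_coord w 0 <= z)).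
Proof.
case: (posnP k) => [k0 _|k0 /(_ isT) xz].
  near=> n => lam rect _; have ln : l%:R <= c n + z * s n by near: n; exact: near_const_le.
  by apply: le_trans ln; case/andP: rect; rewrite inE k0 ler_nat.
near=> n => lam rect uE.
have nt : ((lattice_point k l n w 0)%:R + (l%:R - k.-1%:R) <= c n + z * s n) =
    (zero_sum_coord w 0 <= z).
  by near: n; exact: near_threshold.
rewrite /= -nt -uE//; congr (_ <= _).
have := hook_coord_row rect k0; rewrite subn0 => /(congr1 (fun x => x%:R : R)).
by rewrite !natrD => hh; lra.
Unshelve. all: by end_near.
Qed.

Lemma near_col_le w : ((0 < l)%N -> zero_sum_coord w k != z) ->
  \forall n \near \oo, forall lam : intpart n, hook_rect k l lam ->
    (forall i, (i < d)%N -> hook_coord k l lam i = lattice_point k l n w i) ->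
    ((cpart lam 1)%:R <= c n + z * s n) = ((0 < l)%N ==> (zero_sum_coord w k <= z)).
Proof.
case: (posnP l) => [l0 _|l0 /(_ isT) xz].
  near=> n => lam rect _; have ln : k%:R <= c n + z * s n by near: n; exact: near_const_le.
  apply: le_trans ln; case/andP: rect; rewrite inE l0 ler_nat => h _.
  by rewrite cpartE; apply: conj_part_le => //; exact: part_shape.
have kd : (k < d)%N by rewrite -[ltnLHS]addn0 ltn_add2l.
near=> n => lam rect uE.
have nt : ((lattice_point k l n w k)%:R + (k%:R - l.-1%:R) <= c n + z * s n) =
    (zero_sum_coord w k <= z).
  by near: n; exact: near_threshold.
rewrite /= -nt -uE//; congr (_ <= _).
have := hook_coord_col rect l0; rewrite subn0 addn0 => /(congr1 (fun x => x%:R : R)).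
by rewrite !natrD => hh; lra.
Unshelve. all: by end_near.
Qed.

Lemma near_hook_parts_le w : descending k l <%R w ->
  (forall i, (i < d)%N -> zero_sum_coord w i != z) ->
  \forall n \near \oo, forall lam : intpart n, hook_rect k l lam ->
    (forall i, (i < d)%N -> hook_coord k l lam i = lattice_point k l n w i) ->
    (lam \in hook_parts_le k l n z)%:R = \1_bounded_desc w :> R.
Proof.
move=> desc neq.
have dE : \1_bounded_desc w =
    (((0 < k)%N ==> (zero_sum_coord w 0 <= z)) && ((0 < l)%N ==> (zero_sum_coord w k <= z)))%:R :> R.
  rewrite indicE; congr (nat_of_bool _)%:R; apply/idP/andP.
    by rewrite inE => -[_ h1 h2]; split; apply/implyP.
  move=> [/implyP h1 /implyP h2]; rewrite inE; split=> //; exact: descending_strict_weak.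
near=> n => lam rect uE; rewrite dE; congr (nat_of_bool _)%:R.
rewrite inE; have lH : lam \in hook_parts k l n by case/andP: rect.
rewrite lH /=; congr (_ && _).
  move: lam rect uE {lH}; near: n; apply: near_row_le => k0; apply: neq; exact: ltn_addr.
move: lam rect uE {lH}; near: n; apply: near_col_le => l0; apply: neq.
by rewrite -[ltnLHS]addn0 ltn_add2l.
Unshelve. all: by end_near.
Qed.

End Truncation.

(** * Limits of the distributions *)

Section Ratio.
Variables (R : realType) (k l e : nat) (beta z : R).
Local Notation d := (k + l)%N.
Local Notation c n := (center R k l n).
Local Notation s n := (Num.sqrt n%:R : R).
Hypothesis de : d = e.+1.
Hypothesis beta0 : 0 < beta.
Hypothesis z0 : 0 < z.
Implicit Types w : Rn R e.

Let d0 : (0 < d)%N. Proof. by rewrite de. Qed.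
Let dp : 0 < d%:R :> R. Proof. by rewrite ltr0n. Qed.

(** Every row and column is [n / d] up to O(sqrt n). *)
Lemma lattice_point_scaled_cvg w i (a : R) : (i < d)%N ->
  (fun n => d%:R / n%:R * ((lattice_point k l n w i)%:R + a)) @ \oo --> (1 : R).
Proof.
move=> id.
pose r n : R := 1 + d%:R * (s n)^-1 *
  (((lattice_point k l n w i)%:R - c n) / s n + a * (s n)^-1).
have h : r @ \oo --> (1 + d%:R * 0 * (zero_sum_coord w i + a * 0) : R).
  apply: cvgD; first exact: cvg_cst.
  apply: cvgM; first by apply: cvgMr; exact: cvgn_sqrtV.
  by apply: cvgD; [exact: lattice_point_cvg|apply: cvgMr; exact: cvgn_sqrtV].
rewrite mulr0 mul0r addr0 in h; apply: (near_cvgn _ h); near=> n.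
have n0 : (0 < n)%N by near: n; exists 1%N.
have s0 : 0 < s n by rewrite sqrtr_gt0 ltr0n.
have nE : n%:R = s n * s n by rewrite -expr2 sqr_sqrtr ?ler0n.
rewrite /r /center; move: (s n) s0 nE (d%:R : R) dp => t t0 -> D D0.
by field; rewrite !gt_eqF.
Unshelve. all: by end_near.
Qed.

Section Value.
Variables (val : forall n, intpart n -> nat) (i : nat) (a : R).
Hypothesis id : (i < d)%N.
Hypothesis val_le : forall n (lam : intpart n), (val lam <= n)%N.
Hypothesis val_coord : forall n (lam : intpart n), hook_rect k l lam ->
  (val lam)%:R = (hook_coord k l lam i)%:R + a.

Let h n (lam : intpart n) : R :=
  d%:R / n%:R * (val lam)%:R * (lam \in hook_parts_le k l n z)%:R.

Let h_bound n (lam : intpart n) : lam \in hook_parts k l n -> 0 <= h lam <= d%:R.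
Proof.
move=> _; rewrite /h mulr_ge0 ?mulr_ge0 ?divr_ge0//=.
rewrite -[leRHS]mulr1 ler_pM ?mulr_ge0 ?divr_ge0//; last by case: (_ \in _).
case: n lam => [|n] lam; first by rewrite invr0 mulr0 mul0r.
by rewrite mulrAC ler_pdivrMr ?ltr0n// ler_wpM2l// ler_nat.
Qed.

Let h_lim : {ae lebesgueRn R e, forall w, descending k l <%R w -> forall eps, 0 < eps ->
  \forall n \near \oo, forall lam : intpart n, hook_rect k l lam ->
    lattice_cube (c n) (s n) (hook_coord k l lam) w ->
    `|h lam - \1_(bounded_desc k l z) w| <= eps}.
Proof.
have neq : {ae lebesgueRn R e, forall w, forall i : 'I_d, zero_sum_coord w i != z}.
  by apply: filter_forall => j; exact: (ae_coord_neq de z0 (ltn_ord j)).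
apply: filterS neq => w neq desc eps eps0.
have neq' j : (j < d)%N -> zero_sum_coord w j != z by move=> jd; exact: (neq (Ordinal jd)).
near=> n => lam rect cub.
have uE : forall i, (i < d)%N -> hook_coord k l lam i = lattice_point k l n w i.
  move: lam rect cub; near: n; have := lattice_cube_point de w; apply: filterS => n hn lam rect cub.
  exact/hn.
have -> : \1_(bounded_desc k l z) w = (lam \in hook_parts_le k l n z)%:R :> R.
  by apply/esym; move: lam rect uE {cub}; near: n; exact: near_hook_parts_le.
rewrite /h val_coord// uE//; set X := _ * (_ + _).
have X1 : `|1 - X| <= eps.
  rewrite /X; near: n; have h1 := lattice_point_scaled_cvg w a id.
  by move/cvgrPdist_le : h1; apply.
rewrite -[X in _ - X]mul1r -mulrBl normrM distrC -[leRHS]mulr1 ler_pM//.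
by case: (_ \in _); rewrite ?normr1 ?normr0.
Unshelve. all: by end_near.
Qed.

(** Rows and columns enter only through the fact that their lengths are a
    coordinate plus a constant. Numerator and denominator have the same scale,
    which cancels. *)
Theorem weighted_ratio_cvg : 0 < hook_ratio k l beta z /\
  (fun n => d%:R / n%:R * ((\sum_(lam in hook_parts_le k l n z)
      (val lam)%:R * (nb_syt lam)%:R `^ beta) /
    (\sum_(lam in hook_parts k l n) (nb_syt lam)%:R `^ beta))) @ \oo --> hook_ratio k l beta z.
Proof.
have [Z [mZ Znth ZR]] := hyperplane_Rintegral R de.
have pre (S : set (Rn R d)) : measurable S -> measurable (Z @^-1` S).
  by move=> mS; rewrite -[X in measurable X]setTI; exact: mZ.
have bE : Z @^-1` (Omega_le z) = bounded_desc k l z.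
  by apply/seteqP; split => w; rewrite /preimage /= => /(Omega_le_Z de Znth).
have dE : Z @^-1` (@Omega R k l) = [set w | descending k l <=%R w].
  by apply/seteqP; split => w; rewrite /preimage /= => /(Omega_Z de Znth).
have dens S : measurable S -> \int[hyperplane_measure R d]_(t in S) hook_density beta t =
    \int[lebesgueRn R e]_w limit_density k l beta (Z @^-1` S) w.
  move=> mS; rewrite ZR//; first last.
  - by move=> t; exact: powR_ge0.
  - exact: measurable_hook_density.
  by congr Rintegral; apply/funext => w; rewrite (hook_density_Z Znth).
rewrite /hook_ratio !dens; [|exact: measurable_Omega|exact: measurable_Omega_le].
rewrite bE dE.
have [ig1 cv1] := @hook_sum_cvg R k l e de beta h d%:R (bounded_desc k l z) beta0 (ltW dp)
  h_bound (eq_ind _ measurable (pre _ (measurable_Omega_le z)) _ bE) (@bounded_desc_weak R k l e z) h_lim.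
have [||||ig2 cv2] := @hook_sum_cvg R k l e de beta (fun _ _ => 1) 1 [set w | descending k l <=%R w] beta0 ler01.
- by move=> n lam _; rewrite ler01 lexx.
- by rewrite -dE; apply: pre; exact: measurable_Omega.
- by [].
- apply: aeW => w desc eps eps0; near=> n => lam _ _.
  by rewrite indicE mem_set ?subrr ?normr0 ?(ltW eps0)//; exact: descending_strict_weak.
have p1 := integral_limit_density_gt0 de z0 (fun _ x => x) ig1.
have p2 := integral_limit_density_gt0 de z0 (@bounded_desc_weak R k l e z) ig2.
split; first exact: divr_gt0.
pose N1 n : R := (\sum_(lam in hook_parts k l n) h lam * (nb_syt lam)%:R `^ beta) /
  (hook_scale R k l n `^ beta * s n ^+ e).
pose N2 n : R := (\sum_(lam in hook_parts k l n) 1 * (nb_syt lam)%:R `^ beta) /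
  (hook_scale R k l n `^ beta * s n ^+ e).
have cv : (fun n => N1 n * (N2 n)^-1) @ \oo -->
    (\int[lebesgueRn R e]_w limit_density k l beta (bounded_desc k l z) w /
     \int[lebesgueRn R e]_w limit_density k l beta [set w | descending k l <=%R w] w).
  by apply: cvgM; [exact: cv1|apply: cvgV; [exact: lt0r_neq0|exact: cv2]].
rewrite {}/N1 {}/N2 in cv; apply: (near_cvgn _ cv); near=> n.
have dn : (0 < d <= n)%N by rewrite d0; near: n; exists d.
have A0 := powR_gt0 beta (hook_scale_gt0 R dn).
have n0 : (0 < n)%N by near: n; exists 1%N.
have s0 : 0 < s n ^+ e by rewrite exprn_gt0// sqrtr_gt0 ltr0n.
have -> : \sum_(lam in hook_parts k l n) h lam * (nb_syt lam)%:R `^ beta =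
    d%:R / n%:R * \sum_(lam in hook_parts_le k l n z) (val lam)%:R * (nb_syt lam)%:R `^ beta.
  rewrite mulr_sumr big_mkcond [RHS]big_mkcond; apply: eq_bigr => lam _.
  rewrite /h; case: (boolP (lam \in hook_parts_le k l n z)) => le; last by rewrite mulr0 mul0r if_same.
  have -> : lam \in hook_parts k l n by move: le; rewrite inE => /andP[].
  by rewrite mulr1 mulrA.
rewrite [X in _ / (X / _)](eq_bigr (fun lam : intpart n => (nb_syt lam)%:R `^ beta)); last first.
  by move=> lam _; rewrite mul1r.
have q0 := mulf_neq0 (lt0r_neq0 A0) (lt0r_neq0 s0).
by rewrite invf_div mulrA divfK// [RHS]mulrA.
Unshelve. all: by end_near.
Qed.
End Value.

Lemma row_coord p : (1 <= p <= k)%N -> exists i (a : R), (i < d)%N /\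
  forall n (lam : intpart n), hook_rect k l lam -> (part lam p)%:R = (hook_coord k l lam i)%:R + a.
Proof.
move=> /andP[p0 pk]; have pk' : (p.-1 < k)%N by rewrite prednK.
exists p.-1, (l%:R - (k.-1 - p.-1)%:R); split; first exact: ltn_addr.
move=> n lam rect; have := hook_coord_row rect pk'; rewrite prednK// => /(congr1 (fun x => x%:R : R)).
by rewrite !natrD => hh; lra.
Qed.

Lemma col_coord q : (1 <= q <= l)%N -> exists i (a : R), (i < d)%N /\
  forall n (lam : intpart n), hook_rect k l lam -> (cpart lam q)%:R = (hook_coord k l lam i)%:R + a.
Proof.
move=> /andP[q0 ql]; have ql' : (q.-1 < l)%N by rewrite prednK.
exists (k + q.-1)%N, (k%:R - (l.-1 - q.-1)%:R); split; first by rewrite ltn_add2l.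
move=> n lam rect; have := hook_coord_col rect ql'; rewrite prednK// => /(congr1 (fun x => x%:R : R)).
by rewrite !natrD => hh; lra.
Qed.

Lemma asymp_equiv_linear (u : nat -> R) (r : R) : 0 < r ->
  (fun n => d%:R / n%:R * u n) @ \oo --> r ->
  asymp_equiv u (fun n => n%:R / d%:R * r).
Proof.
move=> r0 h; have D0 := dp; split.
  near=> n; have n0 : 0 < n%:R :> R by rewrite ltr0n; near: n; exists 1%N.
  by rewrite gt_eqF// mulr_gt0// divr_gt0.
have h1 : (fun n => d%:R / n%:R * u n * r^-1) @ \oo --> (r * r^-1 : R) by apply: cvgMl.
rewrite divff ?gt_eqF// in h1; apply: (near_cvgn _ h1); near=> n.
have n0 : 0 < n%:R :> R by rewrite ltr0n; near: n; exists 1%N.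
move: (u n) (n%:R) n0 (d%:R : R) D0 => U N N0 D D0.
by field; rewrite !gt_eqF.
Unshelve. all: by end_near.
Qed.

End Ratio.

Lemma cpart_leq n (lam : intpart n) p : (cpart lam p <= n)%N.
Proof. by rewrite /cpart (leq_trans (count_size _ _))// size_map size_tuple. Qed.

Theorem theorem7p3 (R : realType) (k l : nat) (beta z : R)
    (kl_gt0 : (1 <= k + l)%N) (beta_gt0 : 0 < beta) (z_gt0 : 0 < z) :
  (forall p : nat, (1 <= p <= k)%N ->
     asymp_equiv (fun n : nat => row_distr k l beta p n z)
                 (fun n : nat => n%:R / (k + l)%:R * hook_ratio k l beta z) /\
     (fun n : nat => (k + l)%:R / n%:R * row_distr k l beta p n z) @ \oo
       --> hook_ratio k l beta z) /\
  (forall q : nat, (1 <= q <= l)%N ->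
     asymp_equiv (fun n : nat => col_distr k l beta q n z)
                 (fun n : nat => n%:R / (k + l)%:R * hook_ratio k l beta z) /\
     (fun n : nat => (k + l)%:R / n%:R * col_distr k l beta q n z) @ \oo
       --> hook_ratio k l beta z).
Proof.
have de : (k + l)%N = (k + l).-1.+1 by rewrite prednK.
split=> [p pk|q ql].
  have [i [a [id coord]]] := row_coord R l pk.
  have [r0 lim] := weighted_ratio_cvg (val := fun n lam => part lam p) de beta_gt0 z_gt0 id
    (fun n lam => part_le lam p) coord.
  by split=> //; exact: (asymp_equiv_linear de r0 lim).
have [i [a [id coord]]] := col_coord R k ql.
have [r0 lim] := weighted_ratio_cvg (val := fun n lam => cpart lam q) de beta_gt0 z_gt0 id
  (fun n lam => cpart_leq lam q) coord.
by split=> //; exact: (asymp_equiv_linear de r0 lim).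
Qed.
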